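(* Let $\nu>0$, $\eta>0$, $a_1>0$ and $a_2>0$. Consider on $\mathbb R^2$ the linearized system $$ \begin{cases} \partial_t u_1= \nu\, \partial_{22}u_1- \Delta ^{-1} \partial_{1}\partial_{2} \theta, \\ \partial_t u_2= \nu\, \partial_{22}u_2+ \Delta ^{-1} \partial_{1}\partial_{1} \theta, \\ \partial_t \theta = \eta\, \partial_{11} \theta- u_2,\\ (u_1, u_2, \theta)(x,0) = (u_{01}, u_{02}, \theta_0), \end{cases} $$ and let $(u,\theta)$, $u=(u_1,u_2)$, be the solution corresponding to the initial data $(u_0,\theta_0)$, $u_0=(u_{01},u_{02})$. Let $\varphi$ be defined by $$ \widehat{\varphi}(\xi_1, \xi_2)= \begin{cases} 0, & \text{if } |\xi_1| \leq a_1 \text{ or } |\xi_2|\leq a_2, \\ 1, & \text{otherwise}. \end{cases} $$ If $(u_0, \theta_0) \in H^2(\mathbb R^2)$ with $\nabla\cdot u_0=0$, then there are constants $C_0 =C_0(\nu, \eta, a_1, a_2)>0$ and $C=C(\nu,\eta,a_1,a_2)>0$ such that, for all $t\ge 0$, $$ \|\partial_{t}(\varphi * u)(t)\|_{L^{2}}^{2} + \|(\varphi * u)(t)\|_{H^1}^{2} \le C\, \left(\|\varphi * u_0\|_{H^{2}}^{2} + \|\varphi *\theta_0\|_{L^2}^2\right) e^{-C_0 t}, $$ $$ \|\partial_{t}(\varphi * \theta)(t)\|_{L^{2}}^{2} + \|(\varphi * \theta)(t)\|_{H^1}^{2} \le C\, \left(\|\varphi * \theta_0\|_{H^{2}}^{2}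 + \|\varphi *u_0\|_{L^2}^2\right) e^{-C_0 t}. $$
   Context: Here $\partial_i=\partial_{x_i}$, $\partial_{ii}=\partial_i\partial_i$. $\Delta^{-1}\partial_i\partial_j$ is the Fourier multiplier with symbol $\xi_i\xi_j/|\xi|^2$. $\varphi * f$ is the function whose Fourier transform is $\widehat\varphi\,\widehat f$ (for vector fields, componentwise). $H^k=H^k(\mathbb R^2)$ are the standard inhomogeneous Sobolev spaces. For divergence-free data each of $u$ and $\theta$ then satisfies the damped wave equation $\partial_{tt} f -( \eta \partial_{11} + \nu \partial_{22}) \partial_t f + \nu \eta \partial_{11} \partial_{22} f + \partial_{11}\Delta^{-1} f = 0$, which is the paper's equivalent second-order form of the linearized system. *)

(* Defs.v *)
From HB Require Import structures.
From mathcomp Require Import all_boot all_order all_algebra.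
From mathcomp Require Import complex.
From mathcomp Require Import all_classical all_reals all_analysis.

Set Implicit Arguments.
Unset Strict Implicit.
Unset Printing Implicit Defensive.

Import Order.TTheory GRing.Theory Num.Theory.
Import numFieldNormedType.Exports.

Local Open Scope classical_set_scope.
Local Open Scope ring_scope.
Local Open Scope complex_scope.

Section Plane.
Context {R : realType}.

Definition leb2 : {measure set (measurableTypeR R * measurableTypeR R) -> \bar R} :=
  (@lebesgue_measure R \x @lebesgue_measure R)%E.

Implicit Types (f g : R * R -> R) (F m : R * R -> R[i]) (xi : R * R).

(* Square-integrable representatives; equality in L^2 is [%[ae leb2]]. *)
Definition L2 f : Prop := f \in Lfun leb2 2%:E.

Definition L2norm f : \bar R := ('N[leb2]_2%:E [EFin \o f])%E.

(* The modulus as an element of [R]: the norm of [R[i]] takes values in [R[i]]. *)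
Definition cabs (z : R[i]) : R :=
  Num.sqrt (complex.Re z ^+ 2 + complex.Im z ^+ 2).

Definition dot (x xi : R * R) : R := x.1 * xi.1 + x.2 * xi.2.

Definition sqnorm xi : R := xi.1 ^+ 2 + xi.2 ^+ 2.

Definition box (n : nat) : set (R * R) :=
  `[- n%:R, n%:R]%classic `*` `[- n%:R, n%:R]%classic.

(* (2 pi)^-1 * \int_(box n) f(x) exp(- i x.xi) dx; with this normalization the
   Fourier transform is unitary on L^2 and turns d/dx_j into i xi_j. *)
Definition fourier_box (n : nat) f xi : R[i] :=
  (2 * pi)^-1%:C *
  ((\int[leb2]_(x in box n) (f x * cos (dot x xi)))
   -i* (\int[leb2]_(x in box n) (f x * sin (dot x xi)))).

(* The L^2 (Plancherel) Fourier transform: the limit in L^2 of the truncated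
   Fourier integrals. *)
Definition is_fourier f F : Prop :=
  [/\ measurable_fun setT (fun xi => complex.Re (F xi)),
      measurable_fun setT (fun xi => complex.Im (F xi)),
      (L2norm (fun xi => cabs (F xi)) < +oo)%E &
      L2norm (fun xi => cabs (fourier_box n f xi - F xi)) @[n --> \oo] --> 0%E].

(* A representative, which exists for every [f] in [L2] and is unique a.e. *)
Definition fourier f : R * R -> R[i] := xget (fun=> 0) [set F | is_fourier f F].

(* [g] is the image of [f] under the Fourier multiplier of symbol [m]. *)
Definition multiplier m f g : Prop :=
  [/\ L2 f, L2 g & {ae leb2, forall xi, fourier g xi = m xi * fourier f xi}].

Definition d1_symbol xi : R[i] := 0 +i* xi.1.
Definition d2_symbol xi : R[i] := 0 +i* xi.2.
Definition d11_symbol xi : R[i] := d1_symbol xi * d1_symbol xi.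
Definition d22_symbol xi : R[i] := d2_symbol xi * d2_symbol xi.

(* Symbols of Delta^-1 d_1 d_1 and Delta^-1 d_1 d_2. *)
Definition riesz11_symbol xi : R[i] := (xi.1 * xi.1 / sqnorm xi)%:C.
Definition riesz12_symbol xi : R[i] := (xi.1 * xi.2 / sqnorm xi)%:C.

Definition phi_hat (a1 a2 : R) xi : R :=
  if (`|xi.1| <= a1) || (`|xi.2| <= a2) then 0 else 1.

(* [g = phi * f]. *)
Definition phi_conv (a1 a2 : R) f g : Prop :=
  multiplier (fun xi => (phi_hat a1 a2 xi)%:C) f g.

Definition Hnorm (k : nat) f : \bar R :=
  L2norm (fun xi => Num.sqrt (1 + sqnorm xi) ^+ k * cabs (fourier f xi)).

Definition Sobolev (k : nat) f : Prop := L2 f /\ (Hnorm k f < +oo)%E.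

Definition divergence_free f1 f2 : Prop :=
  exists g1 g2 : R * R -> R,
    [/\ multiplier d1_symbol f1 g1, multiplier d2_symbol f2 g2 &
        (fun x => g1 x + g2 x) = cst 0 %[ae leb2]].

(* [g] is the time derivative at [t] of the curve [w : [0, +oo[ -> L^2]: the
   difference quotients tend to [g] in L^2 (from the right when [t = 0]). *)
Definition time_derivative (w : R -> R * R -> R) (t : R) g : Prop :=
  L2 g /\
  L2norm (fun x => h^-1 * (w (t + h) x - w t x) - g x)
    @[h --> within [set h | 0 <= t + h] 0^'] --> 0%E.

(* Strong solutions: curves in L^2, differentiable on [0, +oo[, for which each
   equation is an identity in L^2.  Only the regularity needed for the terms of
   the system to be L^2 functions is required. *)
Record solution (nu eta : R) (u01 u02 theta0 : R * R -> R)
    (u1 u2 theta : R -> R * R -> R) : Prop := Solution {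
  sol_L2 : forall t, 0 <= t -> [/\ L2 (u1 t), L2 (u2 t) & L2 (theta t)];
  sol_u1 : forall t, 0 <= t -> exists d22u1 r12theta : R * R -> R,
    [/\ multiplier d22_symbol (u1 t) d22u1,
        multiplier riesz12_symbol (theta t) r12theta &
        time_derivative u1 t (fun x => nu * d22u1 x - r12theta x)];
  sol_u2 : forall t, 0 <= t -> exists d22u2 r11theta : R * R -> R,
    [/\ multiplier d22_symbol (u2 t) d22u2,
        multiplier riesz11_symbol (theta t) r11theta &
        time_derivative u2 t (fun x => nu * d22u2 x + r11theta x)];
  sol_theta : forall t, 0 <= t -> exists d11theta : R * R -> R,
    multiplier d11_symbol (theta t) d11theta /\
    time_derivative theta t (fun x => eta * d11theta x - u2 t x);
  sol_init : [/\ u1 0 = u01 %[ae leb2], u2 0 = u02 %[ae leb2] &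
                 theta 0 = theta0 %[ae leb2]]
}.

End Plane.

(* Main.v *)
Require Import Defs.
From HB Require Import structures.
From mathcomp Require Import all_boot all_order all_algebra.
From mathcomp Require Import complex.
From mathcomp Require Import all_classical all_reals all_analysis.
From mathcomp Require Import measurable_realfun ring lra.
Set Implicit Arguments.
Unset Strict Implicit.
Unset Printing Implicit Defensive.
Import Order.TTheory GRing.Theory Num.Theory.
Import numFieldNormedType.Exports.
Local Open Scope classical_set_scope.
Local Open Scope ring_scope.

(** On the Fourier side the system is, for almost every frequency, a damped oscillator:
with [a = nu xi_2^2], [b = eta xi_1^2] and [k = xi_1^2 / |xi|^2], both [V = u_2^] and
[V = theta^] satisfy [V'' + (a + b) V' + (a b + k) V = 0].  With [s = a + b],
[p = a b + k] the energy [(V' + s V / 2)^2 + (s^2 / 4 + p) V^2] decreases at rate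
[s (V'^2 + p V^2)], and where [a] and [b] are bounded below, as on the support of
[phi^], this dissipation controls a multiple of the energy itself, hence the exponential
decay.  The energy also controls [V'^2 + s^2 V^2], where [s^2] dominates [1 + |xi|^2] on
that support.  The first velocity component is recovered from [xi . u^ = 0], which
persists in time, at the price of the weight [|xi|^2 / xi_1^2 = 1 / k].

Since the frequency multipliers are unbounded, the energy identity is integrated over
sets of frequencies where they are bounded, and these sets then exhaust the support of
[phi^].  Going back and forth between physical and frequency space needs Plancherel's
theorem, obtained by regularising with [exp (- e (|xi_1| + |xi_2|))]: the regularised
energy of the transform of [G] is [|G|^2] minus half of the double integral of
[(G x - G y)^2] against the Poisson kernel, which tends to [0], first for indicators of
rectangles, then by a Dynkin class argument for all of L^2. *)

(** * L^2 functions *)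

(** A solution is only a curve in L^2, differentiable in the L^2 sense. For a fixed frequency
    nothing makes its transform differentiable in time, since representatives are chosen separately
    at each time, so the oscillator cannot be solved frequency by frequency. Only squared L^2 norms
    are differentiated; the pointwise algebra enters under the integral. No second time derivative
    is available either: [V'] is replaced by the right-hand side of its equation, so that the energy
    becomes a quadratic form in the two unknowns and only their first derivatives occur. The plain
    energy [V'^2 + p V^2] loses only [2 s V'^2], which does not control [V]. The cross term [s V V']
    in the completed square supplies the missing loss [s p V^2]. The initial energy contains
    [s^2 V^2], where [s] is at most a multiple of [1 + |xi|^2]; this is the origin of the H^2 norm
    of the data. *)

Section ereal_squares.
Context {R : realType}.
Local Open Scope ereal_scope.

Lemma cvge0P {I : Type} {F : set_system I} {FF : Filter F} (u : I -> \bar R) :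
  (forall i, 0 <= u i) ->
  (u i @[i --> F] --> 0 <->
   forall e : R, (0 < e)%R -> \forall i \near F, u i < e%:E).
Proof.
move=> u0; split=> [u_0 e e0|H].
  exact: (u_0 _ (@nbhs_open_ereal_lt R 0%R (fun=> e) e0)).
apply/fine_cvgP; split.
  apply: filterS (H _ ltr01) => i ui.
  by rewrite ge0_fin_numE// (lt_trans ui)// ltry.
apply/cvgrPdist_lt => e e0; apply: filterS (H _ e0) => i ui /=.
have ufin : u i \is a fin_num by rewrite ge0_fin_numE// (lt_trans ui)// ltry.
by rewrite sub0r normrN ger0_norm ?fine_ge0// -lte_fin fineK.
Qed.

Lemma sqre_lt (x : \bar R) (e : R) : (0 < e)%R -> 0 <= x ->
  (x ^+ 2 < (e ^+ 2)%:E) = (x < e%:E).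
Proof.
move=> e0; case: x => [r||]//; rewrite ?lee_fin => r0.
  by rewrite -EFin_expe !lte_fin ltr_pXn2r// nnegrE ltW.
Qed.

Lemma cvge_sqr0 {I : Type} {F : set_system I} {FF : Filter F} (u : I -> \bar R) :
  (forall i, 0 <= u i) ->
  (u i ^+ 2 @[i --> F] --> 0 <-> u i @[i --> F] --> 0).
Proof.
move=> u0.
have u20 i : 0 <= u i ^+ 2 by exact: expe_ge0.
split=> /cvge0P H; apply/cvge0P => // e e0.
  have e20 : (0 < e ^+ 2)%R by rewrite exprn_gt0.
  apply: filterS (H u20 _ e20) => i.
  by rewrite sqre_lt.
have se0 : (0 < Num.sqrt e)%R by rewrite sqrtr_gt0.
apply: filterS (H u0 _ se0) => i.
by rewrite -[in X in _ -> X](@sqr_sqrtr _ e) ?ltW// sqre_lt.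
Qed.

Lemma cvge0_le {I : Type} {F : set_system I} {FF : Filter F} (u v : I -> \bar R) :
  (forall i, 0 <= u i) -> (\forall i \near F, u i <= v i) ->
  v i @[i --> F] --> 0 -> u i @[i --> F] --> 0.
Proof.
move=> u0 uv v0.
apply: (@squeeze_cvge _ _ _ _ (cst 0) _ v _ _ _ v0); last exact: cvg_cst.
by apply: filterS uv => i ->; rewrite u0.
Qed.
End ereal_squares.

Section L2_generic.
Context d (T : measurableType d) (R : realType) (mu : {measure set T -> \bar R}).
Local Open Scope ereal_scope.
Implicit Types f g : T -> R.

(** The squared norm is an integral of a nonnegative function, so additivity and monotonicity hold
    without integrability conditions. *)
Definition nsq f : \bar R := \int[mu]_x ((f x) ^+ 2)%:E.

Lemma nsq_ge0 f : 0 <= nsq f.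
Proof. by apply: integral_ge0 => x _; rewrite lee_fin sqr_ge0. Qed.

Lemma Lnorm2_sqr f : 'N[mu]_2%:E[EFin \o f] ^+ 2 = nsq f.
Proof.
have -> x : 0 <= x -> x ^+ 2 = x `^ 2 :> \bar R.
  case: x => [r||]// r0; last by rewrite poweRyr// expe2 mulyy.
  by rewrite poweR_EFin powR_mulrn// -EFin_expe.
2: exact: Lnorm_ge0.
rewrite powR_Lnorm ?pnatr_eq0//; apply: eq_integral => x _ /=.
by rewrite powR_mulrn// real_normK// num_real.
Qed.

Lemma measurable_sqrE f : measurable_fun setT f ->
  measurable_fun setT (EFin \o (fun x => (f x) ^+ 2)%R).
Proof. by move=> mf; apply/measurable_EFinP; exact: measurable_funX. Qed.

Lemma Lfun2P f :
  f \in Lfun mu 2%:E <-> measurable_fun setT f /\ nsq f < +oo.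
Proof.
split.
  move=> f2; split; last first.
    have /integrableP[_] := Lfun2_integrable_sqr f2.
    by under eq_integral => x _ do rewrite /= ger0_norm ?lee_fin ?sqr_ge0//.
  by move: f2; rewrite inE => /andP[+ _]; rewrite inE.
move=> [mf f2]; rewrite inE; apply/andP; split; rewrite inE//=.
rewrite /finite_norm; move: f2; rewrite -Lnorm2_sqr.
have := Lnorm_ge0 mu 2%:E (EFin \o f).
by case: (Lnorm _ _ _) => [r||]//; rewrite ?ltry// expe2 mulyy.
Qed.

Lemma eq_nsq f g : measurable_fun setT f -> measurable_fun setT g ->
  {ae mu, forall x, f x = g x} -> nsq f = nsq g.
Proof.
move=> mf mg fg; apply: ge0_ae_eq_integral => //.
- exact: measurable_sqrE.
- exact: measurable_sqrE.
- by move=> x _; rewrite lee_fin sqr_ge0.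
- by move=> x _; rewrite lee_fin sqr_ge0.
- by apply: filterS fg => x /= ->.
Qed.

Lemma le_nsq (M : R) f g : (0 <= M)%R -> measurable_fun setT f ->
  measurable_fun setT g ->
  {ae mu, forall x, (`|f x| <= M * `|g x|)%R} -> nsq f <= (M ^+ 2)%:E * nsq g.
Proof.
move=> M0 mf mg fg; rewrite /nsq -ge0_integralZl_EFin//; last 3 first.
- by move=> x _; rewrite lee_fin sqr_ge0.
- exact: measurable_sqrE.
- exact: sqr_ge0.
apply: ae_ge0_le_integral => //.
- by move=> x _; rewrite lee_fin sqr_ge0.
- exact: measurable_sqrE.
- by move=> x _; rewrite -EFinM lee_fin mulr_ge0 ?sqr_ge0.
- by apply: measurable_funeM; exact: measurable_sqrE.
- apply: filterS fg => x fg _; rewrite -EFinM lee_fin.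
  rewrite -real_normK ?num_real// -[(g x ^+ 2)%R]real_normK ?num_real//.
  by rewrite -exprMn ler_pXn2r// nnegrE mulr_ge0.
Qed.

Lemma nsqZ (k : R) f : measurable_fun setT f ->
  nsq (fun x => k * f x)%R = (k ^+ 2)%:E * nsq f.
Proof.
move=> mf; rewrite /nsq -ge0_integralZl_EFin//.
- by apply: eq_integral => x _; rewrite exprMn EFinM.
- by move=> x _; rewrite lee_fin sqr_ge0.
- exact: measurable_sqrE.
- exact: sqr_ge0.
Qed.

Lemma nsqN f : nsq (fun x => - f x)%R = nsq f.
Proof. by apply: eq_integral => x _; rewrite sqrrN. Qed.

Lemma nsq_distC f g : nsq (fun x => f x - g x)%R = nsq (fun x => g x - f x)%R.
Proof. by rewrite -nsqN; congr nsq; apply/funext => x; rewrite opprB. Qed.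

Lemma nsqD_le f g : measurable_fun setT f -> measurable_fun setT g ->
  nsq (fun x => f x + g x)%R <= 2%:E * nsq f + 2%:E * nsq g.
Proof.
move=> mf mg.
rewrite /nsq -!ge0_integralZl_EFin//; [| by move=> x _; rewrite lee_fin sqr_ge0
  |exact: measurable_sqrE| by move=> x _; rewrite lee_fin sqr_ge0
  |exact: measurable_sqrE].
rewrite -ge0_integralD//.
- apply: ge0_le_integral => //.
  + by move=> x _; rewrite lee_fin sqr_ge0.
  + by apply: measurable_sqrE; exact: measurable_funD.
  + by apply: emeasurable_funD; apply: measurable_funeM; exact: measurable_sqrE.
  + move=> x _; rewrite -!EFinM -EFinD lee_fin -subr_ge0.
    rewrite (_ : _ - _ = (f x - g x) ^+ 2)%R ?sqr_ge0//.
    by ring.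
- by move=> x _; rewrite -EFinM lee_fin mulr_ge0 ?sqr_ge0.
- by apply: measurable_funeM; exact: measurable_sqrE.
- by move=> x _; rewrite -EFinM lee_fin mulr_ge0 ?sqr_ge0.
- by apply: measurable_funeM; exact: measurable_sqrE.
Qed.

Lemma nsqB_le f g : measurable_fun setT f -> measurable_fun setT g ->
  nsq (fun x => f x - g x)%R <= 2%:E * nsq f + 2%:E * nsq g.
Proof.
move=> mf mg; rewrite -(nsqN g); apply: nsqD_le => //.
exact: measurableT_comp.
Qed.

Lemma nsq_add_sqr (f g h : T -> R) : measurable_fun setT f -> measurable_fun setT g ->
  (forall x, h x ^+ 2 = f x ^+ 2 + g x ^+ 2)%R ->
  nsq h = nsq f + nsq g.
Proof.
move=> mf mg hfg; rewrite /nsq -ge0_integralD//.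
- by apply: eq_integral => x _; rewrite hfg EFinD.
- by move=> x _; rewrite lee_fin sqr_ge0.
- exact: measurable_sqrE.
- by move=> x _; rewrite lee_fin sqr_ge0.
- exact: measurable_sqrE.
Qed.

End L2_generic.

(** * Completeness of L^2 *)

Section completeness.
Context d (T : measurableType d) (R : realType) (mu : {measure set T -> \bar R}).
Local Open Scope ereal_scope.

Lemma nneseries_half_lty : \sum_(0 <= k <oo) (1 / (2 ^ (k + 1))%:R : R)%:E < +oo.
Proof.
have /cvg_lim -> // := @cvg_geometric_eseries_half R 1%R 0.
exact: ltry.
Qed.

(** Since [|x| <= c + c^-1 * x ^+ 2] for [c > 0], the increments are absolutely summable. The
    weights turn information on squares, which is what L^2 provides, into absolute convergence. *)
Lemma cvg_of_weighted_increments (c : R^nat) (h : R^nat) :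
  (forall k, (0 < c k)%R) -> \sum_(0 <= k <oo) (c k)%:E < +oo ->
  \sum_(0 <= k <oo) ((c k)^-1 * (h k.+1 - h k) ^+ 2)%:E < +oo ->
  cvgn h.
Proof.
move=> c0 sc sh.
have cvg1 : cvgn (series c) by apply: nnseries_is_cvg => // i; exact: ltW.
have cvg2 : cvgn (series (fun k => (c k)^-1 * (h k.+1 - h k) ^+ 2)%R).
  by apply: nnseries_is_cvg => // i; rewrite mulr_ge0 ?sqr_ge0// invr_ge0 ltW.
have cvg3 : cvgn (series (fun k => c k + (c k)^-1 * (h k.+1 - h k) ^+ 2)%R).
  rewrite (_ : series _ = (series c \+ series (fun k => (c k)^-1 * (h k.+1 - h k) ^+ 2))%R).
    exact: is_cvgD.
  by apply/funext => n; rewrite /series/= big_split.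
have cvg4 : cvgn (series (telescope h)).
  apply: normed_cvg; apply: series_le_cvg cvg3 => n; first exact: normr_ge0.
    by apply: addr_ge0; [exact: ltW|rewrite mulr_ge0 ?sqr_ge0// invr_ge0 ltW].
  rewrite /telescope /=; set x := (h n.+1 - h n)%R.
  rewrite -(@ler_pM2l _ (c n))// mulrDr mulrA divff ?gt_eqF// mul1r.
  rewrite -[(x ^+ 2)%R]real_normK ?num_real//.
  have := sqr_ge0 (c n - `|x|); have := sqr_ge0 (c n); have := sqr_ge0 `|x|.
  nra.
rewrite telescopeK in cvg4.
rewrite (_ : h = (fun n => h n - h 0%N) \+ cst (h 0%N))%R; last first.
  by apply/funext => n /=; rewrite subrK.
by apply: is_cvgD => //; exact: is_cvg_cst.
Qed.

(** Riesz-Fischer. Along a subsequence whose increments have squared norm at most [c k ^+ 2], the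
    squared increments weighted by [(c k)^-1] have a summable integral, so their sum is finite and
    the subsequence converges almost everywhere. Fatou's lemma carries the Cauchy bound over to the
    limit. *)
Lemma L2_complete (f : nat -> T -> R) :
  (forall n, measurable_fun setT (f n)) ->
  (forall e : R, (0 < e)%R -> exists N, forall m n, (N <= m)%N -> (N <= n)%N ->
     nsq mu (fun x => f m x - f n x)%R <= e%:E) ->
  exists g : T -> R, measurable_fun setT g /\
    nsq mu (fun x => f n x - g x)%R @[n --> \oo] --> 0.
Proof.
move=> mf cf.
pose c k : R := (1 / (2 ^ (k + 1))%:R)%R.
have c0 k : (0 < c k)%R by rewrite divr_gt0// ltr0n expn_gt0.
have /choice[N HN] : forall k, exists N, forall m n, (N <= m)%N -> (N <= n)%N ->
    nsq mu (fun x => f m x - f n x)%R <= (c k ^+ 2)%:E.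
  by move=> k; apply: cf; rewrite exprn_gt0.
(* Summing all the [(N i).+1] makes [K] monotone and at least as large as both [N k] and [k]. *)
pose K k := (\sum_(i < k.+1) (N i).+1)%N.
have NK k : (N k <= K k)%N by rewrite /K big_ord_recr/= (leq_trans (leqnSn _))// leq_addl.
have leK k : (k <= K k)%N.
  elim: k => // k IH; by rewrite /K big_ord_recr/= addnS ltnS (leq_trans IH)// leq_addr.
have KS k : (K k <= K k.+1)%N by rewrite /K [leqRHS]big_ord_recr/= leq_addr.
pose h k := f (K k).
have mh k : measurable_fun setT (h k) by exact: mf.
have mdh k : measurable_fun setT (fun x => (c k)^-1 * (h k.+1 x - h k x) ^+ 2)%R.
  by apply: measurable_funM => //; apply: measurable_funX; exact: measurable_funB.
pose S x := \sum_(0 <= k <oo) ((c k)^-1 * (h k.+1 x - h k x) ^+ 2)%:E.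
have dh0 k x : 0 <= ((c k)^-1 * (h k.+1 x - h k x) ^+ 2)%:E.
  by rewrite lee_fin mulr_ge0 ?sqr_ge0// invr_ge0 ltW.
have Slty : \int[mu]_x S x < +oo.
  rewrite integral_nneseries//; last by move=> k; exact/measurable_EFinP.
  apply: le_lt_trans nneseries_half_lty.
  apply: lee_nneseries => [k _ _|k _].
    by apply: integral_ge0 => x _; exact: dh0.
  under eq_integral do rewrite EFinM.
  rewrite ge0_integralZl_EFin//; last 3 first.
    by move=> x _; rewrite lee_fin sqr_ge0.
    by apply/measurable_EFinP/measurable_funX; exact: measurable_funB.
    by rewrite invr_ge0 ltW.
  apply: (@le_trans _ _ ((c k)^-1%:E * (c k ^+ 2)%:E)); last first.
    rewrite (_ : _ * _ = (c k)%:E); first exact: lexx.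
    by rewrite -EFinM expr2 mulrA mulVf ?gt_eqF// mul1r.
  apply: lee_wpmul2l; first by rewrite lee_fin invr_ge0 ltW.
  by apply: HN => //; exact: leq_trans (NK _) (KS _).
have S0 x : 0 <= S x by apply: nneseries_ge0 => k _ _; exact: dh0.
have mS : measurable_fun setT S.
  apply: ge0_emeasurable_sum => // k _; exact/measurable_EFinP.
have aeS : {ae mu, forall x, S x < +oo}.
  have : mu.-integrable setT S.
    apply/integrableP; split => //.
    by under eq_integral do rewrite gee0_abs//.
  move=> /integrable_ae => /(_ measurableT).
  by apply: filterS => x /(_ I); rewrite ge0_fin_numE.
(* The upper limit is measurable whether or not the subsequence converges; off the convergence set,
   which has full measure, the value given by [fine] is immaterial. *)
pose g x := fine (limn_esup (fun k => (h k x)%:E)).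
have mg : measurable_fun setT g.
  apply: measurableT_comp => //; apply: measurable_fun_limn_esup => k.
  exact/measurable_EFinP.
have hg : {ae mu, forall x, h k x @[k --> \oo] --> g x}.
  apply: filterS aeS => x Sx.
  have ch : cvgn (h ^~ x).
    exact: (cvg_of_weighted_increments c0 nneseries_half_lty Sx).
  have ceh : (h k x)%:E @[k --> \oo] --> (limn (h ^~ x))%:E by apply/cvg_EFin; [exact: nearW|].
  by rewrite /g (cvg_limn_einf_sup ceh).
exists g; split => //.
apply/cvge0P; first by move=> n; exact: nsq_ge0.
move=> e e0.
have e20 : (0 < e / 2)%R by rewrite divr_gt0.
have [M HM] := cf _ e20.
exists M => // n/= Mn.
apply: (@le_lt_trans _ _ (e / 2)%:E); last by rewrite lte_fin; lra.
(* The shift by [M] puts every index [K (k + M)] beyond [M], so that the Cauchy bound applies to all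
   terms. *)
pose u k x := ((f n x - h (k + M)%N x) ^+ 2)%:E.
have mu_ k : measurable_fun setT (u k).
  by apply/measurable_EFinP/measurable_funX; exact: measurable_funB.
have -> : nsq mu (fun x => f n x - g x)%R = \int[mu]_x limn_einf (u ^~ x).
  apply: ge0_ae_eq_integral => //.
  - by apply/measurable_EFinP/measurable_funX; exact: measurable_funB.
  - rewrite (_ : (fun x => _) = (fun x => - limn_esup (fun k => - u k x))); last first.
      by apply/funext => x; rewrite -limn_einfN; congr limn_einf; apply/funext => k; rewrite /u /= opprK.
    apply: measurableT_comp => //; apply: measurable_fun_limn_esup => k.
    exact: measurableT_comp.
  - by move=> x _; rewrite lee_fin sqr_ge0.
  - move=> x _; rewrite limn_einf_lim; apply: lime_ge; first exact: is_cvg_einfs.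
    apply: nearW => k; apply: le_ereal_inf_tmp => _ [m _ <-].
    by rewrite lee_fin sqr_ge0.
  - apply: filterS hg => x hx _.
    have hM : [sequence h (k + M)%N x]_k @ \oo --> g x by rewrite (cvg_shiftn M (h ^~ x)).
    have : u k x @[k --> \oo] --> ((f n x - g x) ^+ 2)%:E.
      apply/cvg_EFin; first exact: nearW.
      apply: cvgM; apply: cvgB; try exact: cvg_cst.
      exact: hM.
      exact: hM.
    by move=> /cvg_limn_einf_sup[].
apply: le_trans (fatou _ _ _ _) _ => //.
  by move=> k x _; rewrite lee_fin sqr_ge0.
rewrite limn_einf_lim; apply: lime_le; first exact: is_cvg_einfs.
apply: nearW => k.
apply: (@le_trans _ _ (nsq mu (fun x => f n x - h (k + M)%N x)%R)).
  by apply: ereal_inf_lbound; exists k => //=.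
apply: HM => //.
by rewrite (leq_trans _ (leK _))// leq_addl.
Qed.

End completeness.

(** * Poisson kernels *)

Section poisson_kernel.
Context {R : realType}.
Implicit Types (e x y k : R).
Local Notation leb := (@lebesgue_measure R).

(** The Fourier integral of [exp (- e |k|)], hence the total mass [2 * pi] without a normalising
    factor. *)
Definition poisson e x : R := 2 * e / (e ^+ 2 + x ^+ 2).

Lemma poisson_den_gt0 e x : 0 < e -> 0 < e ^+ 2 + x ^+ 2.
Proof. by move=> e0; rewrite ltr_pwDl ?sqr_ge0// exprn_gt0. Qed.

Lemma poisson_ge0 e x : 0 < e -> 0 <= poisson e x.
Proof.
by move=> e0; rewrite divr_ge0 ?ltW ?poisson_den_gt0// mulr_gt0.
Qed.

Lemma poissonN e x : poisson e (- x) = poisson e x.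
Proof. by rewrite /poisson sqrrN. Qed.

Lemma continuous_poisson e : 0 < e -> continuous (poisson e).
Proof.
move=> e0 x; apply: cvgM; first exact: cvg_cst.
apply: cvgV; first by rewrite gt_eqF// poisson_den_gt0.
by apply: cvgD; [exact: cvg_cst|exact: exprn_continuous].
Qed.

Lemma continuous_poissonB e x : 0 < e -> continuous (fun y => poisson e (x - y)).
Proof.
move=> e0 y; apply: (@continuous_comp _ _ _ (fun y => x - y) (poisson e)).
  by apply: cvgB; [exact: cvg_cst|exact: cvg_id].
exact: continuous_poisson.
Qed.

Lemma is_derive_poisson_atan e x y : 0 < e ->
  is_derive y (1 : R) (fun y => 2 * atan ((y - x) / e)) (poisson e (x - y)).
Proof.
move=> e0.
have D1 : is_derive y (1 : R) (fun y => (y - x) / e) (e^-1).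
  by apply: is_derive_eq; rewrite /GRing.scale/=; ring.
have D2 := @is_derive1_comp R atan (fun y => (y - x) / e) y _ _ (is_derive1_atan _) D1.
have D3 := @is_deriveM R _ (cst 2) (atan \o (fun y => (y - x) / e)) y 1 0 _ (is_derive_cst _ _ _) D2.
apply: (is_derive_eq D3).
rewrite /GRing.scale/= /poisson.
have := poisson_den_gt0 (x - y) e0; have := poisson_den_gt0 (y - x) e0.
move=> h1 h2; field.
by rewrite !gt_eqF.
Qed.

Lemma integral_poisson_itv e x a b : 0 < e -> a < b ->
  (\int[leb]_(y in `[a, b]) (poisson e (x - y))%:E)%E =
  (2 * (atan ((b - x) / e) - atan ((a - x) / e)))%:E.
Proof.
move=> e0 ab; pose F y := 2 * atan ((y - x) / e).
have dF y : is_derive y (1 : R) F (poisson e (x - y)) by exact: is_derive_poisson_atan.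
have cF : continuous F.
  move=> y; apply: differentiable_continuous; apply/derivable1_diffP.
  by case: (dF y).
rewrite (@continuous_FTC2 _ _ F)//.
- by rewrite -EFinB /F mulrBr.
- by apply: continuous_subspaceT; exact: continuous_poissonB.
- split.
  + by move=> y _; case: (dF y).
  + exact: cvg_at_right_filter (cF a).
  + exact: cvg_at_left_filter (cF b).
- by move=> y _; rewrite derive1E; case: (dF y).
Qed.

Lemma nondecreasing_itv_nat :
  {homo (fun n => `[- n%:R, n%:R]%classic : set R) : n m / (n <= m)%N >-> (n <= m)%O}.
Proof.
move=> n m nm; apply/subsetPset => x /=; rewrite !in_itv/= => /andP[h1 h2].
have : (n%:R <= m%:R :> R) by rewrite ler_nat.
by move=> h; apply/andP; split; lra.
Qed.

Lemma cvg_atan_seq e (u : R^nat) : 0 < e ->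
  u n @[n --> \oo] --> +oo -> atan (u n / e) @[n --> \oo] --> pi / 2.
Proof.
move=> e0 uy; apply: (@cvg_comp _ _ _ (fun n => u n / e) atan _ (pinfty_nbhs R)).
  apply/cvgryPge => A; have /cvgryPge/(_ (A * e)) := uy.
  by apply: filterS => n; rewrite ler_pdivlMr.
exact: cvgy_atan.
Qed.

Lemma integral_poisson e x : 0 < e ->
  (\int[leb]_y (poisson e (x - y))%:E)%E = (2 * pi)%:E.
Proof.
move=> e0.
have mp : measurable_fun setT (fun y => poisson e (x - y)).
  by apply: continuous_measurable_fun; exact: continuous_poissonB.
have H := @ge0_nondecreasing_set_cvg_integral _ _ _
  (fun n => `[- n%:R, n%:R]%classic : set (measurableTypeR R))
  (fun y => (poisson e (x - y))%:E) leb nondecreasing_itv_nat.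
rewrite (@bigcup_itvT R true false) in H.
apply: (@cvg_unique _ (@ereal_hausdorff R) _ _ _ _ (H _ _ _)).
- by move=> n; exact: measurable_itv.
- by move=> n; apply/measurable_EFinP; exact: measurable_funTS.
- by move=> n y _; rewrite lee_fin poisson_ge0.
apply: (@cvg_trans _ ((2 * (atan ((n%:R - x) / e) + atan ((n%:R + x) / e)))%:E @[n --> \oo])).
  apply: near_eq_cvg; near=> n.
  have n0 : (0 < n%:R :> R) by near: n; exists 1%N => // n /=; rewrite ltr0n.
  rewrite integral_poisson_itv//; last by lra.
  rewrite (_ : (- n%:R - x) / e = - ((n%:R + x) / e)); last by rewrite -opprD mulNr.
  by rewrite atanN opprK.
apply/cvg_EFin; first exact: nearW.
rewrite [X in _ --> X](_ : _ = 2 * (pi / 2 + pi / 2)); last by field.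
apply: cvgM; first exact: cvg_cst.
apply: cvgD; apply: cvg_atan_seq => //; apply/cvgryPge => A.
  have /cvgryPge/(_ (A + x)) := @cvgr_idn R.
  by apply: filterS => n; rewrite lerBrDr.
have /cvgryPge/(_ (A - x)) := @cvgr_idn R.
by apply: filterS => n; rewrite lerBlDr.
Unshelve. all: by end_near. Qed.

Lemma is_derive_expcos e x k : 0 < e ->
  is_derive k (1 : R)
    (fun k => expR (- e * k) * (- e^-1 + (x * sin (x * k) - e * cos (x * k)) / (e ^+ 2 + x ^+ 2)))
    (expR (- e * k) * (1 + cos (x * k))).
Proof.
move=> e0.
have := poisson_den_gt0 x e0; rewrite lt0r => /andP[h _].
apply: is_derive_eq; rewrite /GRing.scale/=.
field; rewrite h/= gt_eqF//.
Qed.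

Lemma is_derive_exp e k : 0 < e ->
  is_derive k (1 : R) (fun k => expR (- e * k) * - e^-1) (expR (- e * k)).
Proof.
move=> e0; apply: is_derive_eq; rewrite /GRing.scale/=.
by field; rewrite gt_eqF.
Qed.

End poisson_kernel.

(** * Fourier integrals of the exponential weight *)

Section exponential_integrals.
Context {R : realType}.
Implicit Types (e x y k : R).
Local Notation leb := (@lebesgue_measure R).

Definition expabs e k : R := expR (- e * `|k|).

Lemma expabs_gt0 e k : 0 < expabs e k. Proof. exact: expR_gt0. Qed.

Lemma expabsN e k : expabs e (- k) = expabs e k.
Proof. by rewrite /expabs normrN. Qed.

Lemma continuous_expabs e : continuous (expabs e).
Proof.
move=> k; apply: (@continuous_comp _ _ _ (fun k => - e * `|k|) expR); last exact: continuous_expR.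
apply: cvgM; first exact: cvg_cst.
exact: norm_continuous.
Qed.

Lemma measurable_expabs e : measurable_fun setT (expabs e).
Proof. by apply: continuous_measurable_fun; exact: continuous_expabs. Qed.

Lemma cvgy_expM e : 0 < e -> expR (- e * k) @[k --> +oo] --> 0.
Proof.
move=> e0.
rewrite (_ : (fun k => _) = (fun z => expR (- z)) \o (fun k => e * k)); last first.
  by apply/funext => k /=; rewrite mulNr.
apply: (@cvg_comp _ _ _ (fun k => e * k) (fun z => expR (- z)) _ (pinfty_nbhs R)).
  apply/cvgryPge => A; have := nbhs_pinfty_ge (num_real (A / e)).
  by apply: filterS => k; rewrite ler_pdivrMr// mulrC.
exact: cvgr_expR.
Qed.

Lemma integral0y_of_antiderivative (f F : R -> R) : (forall x, 0 <= f x) ->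
  continuous f -> (forall x, is_derive x (1 : R) F (f x)) ->
  F k @[k --> +oo] --> 0 ->
  (\int[leb]_(x in `[0%R, +oo[) (f x)%:E = (- F 0)%:E)%E.
Proof.
move=> f0 cf dF F0.
have cF : continuous F.
  move=> y; apply: differentiable_continuous; apply/derivable1_diffP.
  by case: (dF y).
rewrite (@ge0_continuous_FTC2y _ _ F 0 0)//.
- by rewrite sub0e.
- exact: continuous_subspaceT.
- exact: cvg_at_right_filter (cF 0).
- by move=> x _; rewrite derive1E; case: (dF x).
Qed.

Lemma cvgy_expM_bounded e (M : R) (g : R -> R) : 0 < e -> (forall k, `|g k| <= M) ->
  expR (- e * k) * g k @[k --> +oo] --> 0.
Proof.
move=> e0 gM; apply/norm_cvg0P.
apply: (@squeeze_cvgr _ _ _ _ (cst 0) (fun k => expR (- e * k) * M)).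
- apply: nearW => k; rewrite normr_ge0/= normrM ger0_norm ?expR_ge0//.
  by rewrite ler_wpM2l// expR_ge0.
- exact: cvg_cst.
- rewrite -(mul0r M); apply: cvgM; last exact: cvg_cst.
  exact: cvgy_expM.
Qed.

Lemma integral_expabs e : 0 < e ->
  (\int[leb]_k (expabs e k)%:E = (2 / e)%:E)%E.
Proof.
move=> e0; rewrite ge0_symfun_integralT//.
- rewrite (_ : [set x | _] = `[0, +oo[%classic); last first.
    by apply/seteqP; split => x /=; rewrite in_itv/= andbT.
  have -> : (\int[leb]_(k in `[0%R, +oo[) (expabs e k)%:E =
      \int[leb]_(k in `[0%R, +oo[) (expR (- e * k))%:E)%E.
    apply: eq_integral.
    by move=> k; rewrite inE/= in_itv/= andbT => k0; rewrite /expabs ger0_norm.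
  rewrite (integral0y_of_antiderivative _ _ (fun k => is_derive_exp k e0)).
  + by rewrite mulr0 expR0 mul1r opprK -EFinM.
  + by move=> x; exact: expR_ge0.
  + move=> k; apply: (@continuous_comp _ _ _ (fun k => - e * k) expR); last exact: continuous_expR.
    by apply: cvgM; [exact: cvg_cst|exact: cvg_id].
  + by apply: (@cvgy_expM_bounded _ `|e^-1| (fun=> - e^-1)) => // k; rewrite normrN.
- by move=> k; exact: expR_ge0.
- exact: continuous_expabs.
- by move=> k /=; rewrite expabsN.
Qed.

Lemma continuous_cosM x : continuous (fun k => cos (x * k)).
Proof.
move=> k; apply: (@continuous_comp _ _ _ (fun k => x * k) cos); last exact: continuous_cos.
by apply: cvgM; [exact: cvg_cst|exact: cvg_id].
Qed.

Lemma continuous_sinM x : continuous (fun k => sin (x * k)).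
Proof.
move=> k; apply: (@continuous_comp _ _ _ (fun k => x * k) sin); last exact: continuous_sin.
by apply: cvgM; [exact: cvg_cst|exact: cvg_id].
Qed.

(** The summand [1] makes the integrand nonnegative, as the symmetry rule and the fundamental
    theorem on a half-line used here require; it is subtracted again to isolate the cosine. *)
Lemma integral_expabs_1cos e x : 0 < e ->
  (\int[leb]_k (expabs e k * (1 + cos (x * k)))%:E = (2 / e + poisson e x)%:E)%E.
Proof.
move=> e0.
have cos1 k : 0 <= 1 + cos (x * k) by have := cos_geN1 (x * k); lra.
have d0 := poisson_den_gt0 x e0.
rewrite ge0_symfun_integralT//.
- rewrite (_ : [set x | _] = `[0, +oo[%classic); last first.
    by apply/seteqP; split => y /=; rewrite in_itv/= andbT.
  have -> : (\int[leb]_(k in `[0%R, +oo[) (expabs e k * (1 + cos (x * k)))%:E =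
      \int[leb]_(k in `[0%R, +oo[) (expR (- e * k) * (1 + cos (x * k)))%:E)%E.
    apply: eq_integral.
    by move=> k; rewrite inE/= in_itv/= andbT => k0; rewrite /expabs ger0_norm.
  rewrite (integral0y_of_antiderivative _ _ (fun k => is_derive_expcos x k e0)).
  + rewrite !mulr0 expR0 sin0 cos0 mul1r mulr0 -EFinM /poisson; congr EFin.
    by field; rewrite !gt_eqF.
  + by move=> k; rewrite mulr_ge0// expR_ge0.
  + move=> k; apply: cvgM.
      apply: (@continuous_comp _ _ _ (fun k => - e * k) expR); last exact: continuous_expR.
      by apply: cvgM; [exact: cvg_cst|exact: cvg_id].
    by apply: cvgD; [exact: cvg_cst|exact: continuous_cosM].
  + apply: (@cvgy_expM_bounded _ (`|e^-1| + (`|x| + e) / (e ^+ 2 + x ^+ 2))) => // k.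
    rewrite (le_trans (ler_normD _ _))// normrN lerD2l normrM.
    rewrite normfV (gtr0_norm d0) ler_pM2r ?invr_gt0//.
    rewrite (le_trans (ler_normB _ _))// !normrM (gtr0_norm e0).
    have := cos_geN1 (x * k); have := cos_le1 (x * k).
    have := sin_geN1 (x * k); have := sin_le1 (x * k) => h1 h2 h3 h4.
    have h5 : `|sin (x * k)| <= 1 by rewrite ler_norml h1 h2.
    have h6 : `|cos (x * k)| <= 1 by rewrite ler_norml h3 h4.
    apply: lerD; first by rewrite ler_piMr.
    by rewrite ler_piMr// ltW.
- by move=> k; rewrite mulr_ge0// ltW// expabs_gt0.
- move=> k; apply: cvgM; first exact: continuous_expabs.
  by apply: cvgD; [exact: cvg_cst|exact: continuous_cosM].
- by move=> k /=; rewrite expabsN mulrN cosN.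
Qed.

Lemma integrable_expabs e : 0 < e -> leb.-integrable setT (EFin \o expabs e).
Proof.
move=> e0; apply/integrableP; split.
  by apply/measurable_EFinP; exact: measurable_expabs.
under eq_integral do rewrite /= ger0_norm ?(ltW (expabs_gt0 _ _))//.
by rewrite integral_expabs// ltry.
Qed.

Lemma integrable_expabsM e (h : R -> R) : 0 < e -> measurable_fun setT h ->
  (forall k, `|h k| <= 1) ->
  leb.-integrable setT (fun k => (expabs e k * h k)%:E).
Proof.
move=> e0 mh h1; apply: le_integrable (integrable_expabs e0) => //.
  apply/measurable_EFinP; apply: measurable_funM => //.
  exact: measurable_expabs.
move=> k _ /=; rewrite lee_fin normrM ler_piMr ?normr_ge0//.
Qed.

Lemma norm_cos_le1 x : `|cos x| <= 1.
Proof. by rewrite ler_norml cos_geN1 cos_le1. Qed.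

Lemma norm_sin_le1 x : `|sin x| <= 1.
Proof. by rewrite ler_norml sin_geN1 sin_le1. Qed.

Lemma measurable_cosM x : measurable_fun setT (fun k => cos (x * k)).
Proof. by apply: continuous_measurable_fun; exact: continuous_cosM. Qed.

Lemma measurable_sinM x : measurable_fun setT (fun k => sin (x * k)).
Proof. by apply: continuous_measurable_fun; exact: continuous_sinM. Qed.

Lemma integral_expabs_cos e x : 0 < e ->
  (\int[leb]_k (expabs e k * cos (x * k))%:E = (poisson e x)%:E)%E.
Proof.
move=> e0; have := integral_expabs_1cos x e0.
under eq_integral do rewrite mulrDr mulr1.
have int_c := integrable_expabsM e0 (measurable_cosM x) (fun k => norm_cos_le1 _).
rewrite integralD_EFin//; last exact: integrable_expabs.
rewrite integral_expabs//; have /integrable_fin_num/fineK <- := int_c => //.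
by rewrite -EFinD => -[/addrI ->].
Qed.

Lemma ge0_integral_oppr (f : R -> R) : measurable_fun setT f -> (forall x, 0 <= f x) ->
  (\int[leb]_x (f (- x))%:E = \int[leb]_x (f x)%:E)%E.
Proof.
move=> mf f0.
have mo : measurable_fun setT (-%R : measurableTypeR R -> measurableTypeR R).
  exact: (@oppr_measurable R setT).
have := @ge0_integral_pushforward _ _ _ _ R (-%R : measurableTypeR R -> measurableTypeR R)
  mo leb setT (EFin \o f) measurableT.
rewrite preimage_setT /comp => <-//.
- by apply: eq_measure_integral => A mA _; exact: lebesgue_measureN.
- by apply/measurable_EFinP.
- by move=> x _; rewrite lee_fin.
Qed.

(** The reflection rule is for nonnegative functions, so it is applied to [1 + sin]. The integral of
    the sine part then equals its own opposite. *)
Lemma integral_expabs_sin e x : 0 < e ->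
  (\int[leb]_k (expabs e k * sin (x * k))%:E = 0)%E.
Proof.
move=> e0.
have mf : measurable_fun setT (fun k => expabs e k * (1 + sin (x * k))).
  apply: measurable_funM; first exact: measurable_expabs.
  by apply: measurable_funD => //; exact: measurable_sinM.
have f0 k : 0 <= expabs e k * (1 + sin (x * k)).
  by rewrite mulr_ge0 ?(ltW (expabs_gt0 _ _))//; have := sin_geN1 (x * k); lra.
have int_s := integrable_expabsM e0 (measurable_sinM x) (fun k => norm_sin_le1 _).
have int_e := integrable_expabs e0.
have := ge0_integral_oppr mf f0.
under eq_integral do rewrite expabsN mulrN sinN mulrBr mulr1.
rewrite integralB_EFin//.
under [X in _ = X -> _]eq_integral do rewrite mulrDr mulr1.
rewrite integralD_EFin// integral_expabs//.
have /integrable_fin_num/fineK <- := int_s => //.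
rewrite -!EFinD => -[h]; congr EFin.
by lra.
Qed.

End exponential_integrals.

(** Writing the inverse as [x] times a real power of [x ^+ 2] reduces it to the power function; both
    sides are [0] at [0]. *)
Lemma measurable_invr {R : realType} : measurable_fun setT (@GRing.inv R).
Proof.
rewrite (_ : @GRing.inv R = fun x => x * ((x ^+ 2) `^ (-1))).
  apply: measurable_funM => //.
  by apply: (measurableT_comp (measurable_powR _)); exact: measurable_funX.
apply/funext => x; rewrite powR_inv1 ?sqr_ge0//.
have [->|x0] := eqVneq x 0; first by rewrite mul0r invr0.
by field.
Qed.

Lemma measurable_funV d (T : measurableType d) (R : realType) (f : T -> R) :
  measurable_fun setT f -> measurable_fun setT (fun x => (f x)^-1).
Proof. by move=> mf; exact: (measurableT_comp measurable_invr mf). Qed.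

Lemma measurable_funsqrt d (T : measurableType d) (R : realType) (f : T -> R) :
  measurable_fun setT f -> measurable_fun setT (fun x => Num.sqrt (f x)).
Proof.
move=> mf; apply: (measurableT_comp _ mf).
by apply: continuous_measurable_fun => x; exact: sqrt_continuous.
Qed.

(** * Fubini's theorem for products and integral transforms *)

Section product_integrals.
Context d1 d2 (T1 : measurableType d1) (T2 : measurableType d2) (R : realType).
Variable m1 : {sigma_finite_measure set T1 -> \bar R}.
Variable m2 : {sigma_finite_measure set T2 -> \bar R}.
Local Open Scope ereal_scope.

Lemma sigma_finite_prod : sigma_finite setT (m1 \x m2).
Proof.
have /sigma_finiteP[F [TF ndF Foo]] := sigma_finiteT m1.
have /sigma_finiteP[G [TG ndG Goo]] := sigma_finiteT m2.
exists (fun n => F n `*` G n).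
  rewrite -setXTT TF TG; apply/seteqP; split => [[x y]|[x y]].
    move=> [/= [n _ Fx] [k _ Gy]]; exists (maxn n k) => //; split => /=.
      by move: x Fx; apply/subsetPset/ndF/leq_maxl.
    by move: y Gy; apply/subsetPset/ndG/leq_maxr.
  by case=> n _ [/= Fx Gy]; split; exists n.
move=> n; have [mF Fn] := Foo n; have [mG Gn] := Goo n; split.
  exact: measurableX.
by rewrite product_measure1E// lte_mul_pinfty// ge0_fin_numE.
Qed.

(* Packed by hand: a product measure has no canonical sigma-finite structure. *)
Definition prod_sf : {sigma_finite_measure set (T1 * T2)%type -> \bar R} :=
  HB.pack (product_measure1 m1 m2)
    (Measure_isSigmaFinite.Build _ _ _ (m1 \x m2) sigma_finite_prod).

Lemma measurable_prodM (f : T1 -> R) (g : T2 -> R) :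
  measurable_fun setT f -> measurable_fun setT g ->
  measurable_fun setT (fun z : T1 * T2 => f z.1 * g z.2)%R.
Proof.
move=> mf mg; apply: measurable_funM.
  exact: (measurableT_comp mf measurable_fst).
exact: (measurableT_comp mg measurable_snd).
Qed.

Lemma integrable_prodM (f : T1 -> R) (g : T2 -> R) :
  m1.-integrable setT (EFin \o f) -> m2.-integrable setT (EFin \o g) ->
  (m1 \x m2).-integrable setT (fun z => (f z.1 * g z.2)%:E).
Proof.
move=> f1 g1.
have mf : measurable_fun setT f by apply/measurable_EFinP; case/integrableP: f1.
have mg : measurable_fun setT g by apply/measurable_EFinP; case/integrableP: g1.
apply/integrable12ltyP.
  by apply/measurable_EFinP; exact: measurable_prodM.
under eq_integral => x _.
  under eq_integral => y _ do rewrite /= normrM EFinM.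
  rewrite ge0_integralZl_EFin//; last by apply/measurable_EFinP; exact: measurableT_comp.
  over.
have /integrableP[_ gfin] := g1; have /integrableP[_ ffin] := f1.
rewrite ge0_integralZr//.
- by rewrite lte_mul_pinfty// ?integral_ge0// ge0_fin_numE// integral_ge0.
- by apply/measurable_EFinP; exact: measurableT_comp.
- by apply: integral_ge0.
Qed.

Lemma integral_prodM (f : T1 -> R) (g : T2 -> R) :
  m1.-integrable setT (EFin \o f) -> m2.-integrable setT (EFin \o g) ->
  \int[m1 \x m2]_z (f z.1 * g z.2)%:E =
    (\int[m1]_x (f x)%:E) * (\int[m2]_y (g y)%:E).
Proof.
move=> f1 g1; rewrite -integral12_prod_meas1; last exact: integrable_prodM.
rewrite /fubini_F /=.
under eq_integral => x _.
  under eq_integral => y _ do rewrite EFinM.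
  rewrite integralZl//.
  have /integrable_fin_num/fineK <- := g1 => //.
  over.
have /integrable_fin_num/fineK <- := g1 => //.
by rewrite integralZr//.
Qed.

End product_integrals.

Section square_transform.
Context d d' (T : measurableType d) (S : measurableType d') (R : realType).
Variable m : {sigma_finite_measure set T -> \bar R}.
Variable ms : {sigma_finite_measure set S -> \bar R}.
Variables (G : T -> R) (E : S -> R) (K : T * S -> R).
Hypothesis intG : m.-integrable setT (EFin \o G).
Hypothesis intE : ms.-integrable setT (EFin \o E).
Hypothesis mK : measurable_fun setT K.
Hypothesis K1 : forall z, `|K z| <= 1.
Local Open Scope ereal_scope.

Let mG : measurable_fun setT G.
Proof. by apply/measurable_EFinP; case/integrableP: intG. Qed.

Let mE : measurable_fun setT E.
Proof. by apply/measurable_EFinP; case/integrableP: intE. Qed.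

Lemma integrable_transform xi : m.-integrable setT (fun x => (G x * K (x, xi))%:E).
Proof.
apply: le_integrable intG => //.
  apply/measurable_EFinP; apply: measurable_funM => //.
  exact: measurableT_comp (pair2_measurable xi).
by move=> x _ /=; rewrite lee_fin normrM ler_piMr.
Qed.

Lemma integrable_weighted_transform :
  (m \x ms).-integrable setT (fun z => (G z.1 * E z.2 * K z)%:E).
Proof.
apply: le_integrable (integrable_prodM intG intE) => //.
  by apply/measurable_EFinP; apply: measurable_funM => //; exact: measurable_prodM.
by move=> x _ /=; rewrite lee_fin !normrM ler_piMr// mulr_ge0.
Qed.

(** The kernel [K] alone need not be integrable in both variables. A positive integrable weight [E]
    makes it so, Fubini gives measurability, and the weight is divided out. *)
Lemma measurable_transform : (forall xi, 0 < E xi)%R ->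
  measurable_fun setT (fun xi => \int[m]_x (G x * K (x, xi)))%R.
Proof.
move=> E0.
rewrite (_ : (fun xi => _) = (fun xi => (E xi)^-1 * fine (fubini_G m (fun z => (G z.1 * E z.2 * K z)%:E) xi))%R).
  apply: measurable_funM.
    exact: measurable_funV.
  apply: measurableT_comp => //.
  exact: measurable_fubini_G integrable_weighted_transform.
apply/funext => xi; rewrite /fubini_G /=.
under eq_integral do rewrite mulrAC mulrC EFinM.
rewrite integralZl//; last exact: integrable_transform.
rewrite /Rintegral fineM//; last first.
  by apply: integrable_fin_num => //; exact: integrable_transform.
by rewrite /= mulrA mulVf ?mul1r// gt_eqF.
Qed.

(** The square of an integral is a double integral over [z], and the integral in [xi] is moved
    inside. Fubini applies because [|K| <= 1] leaves the integrable majorant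
    [|G z.1| |G z.2| |E xi|]. *)
Lemma integral_square_transform :
  (m \x m).-integrable setT (fun z => (G z.1 * G z.2)%:E *
     \int[ms]_xi (E xi * (K (z.1, xi) * K (z.2, xi)))%:E) /\
  \int[ms]_xi (E xi * (\int[m]_x (G x * K (x, xi)))%R ^+ 2)%:E =
  \int[m \x m]_z ((G z.1 * G z.2)%:E *
     \int[ms]_xi (E xi * (K (z.1, xi) * K (z.2, xi)))%:E).
Proof.
pose mm := prod_sf m m.
pose H (w : (T * T) * S) : \bar R :=
  ((G w.1.1 * G w.1.2) * E w.2 * (K (w.1.1, w.2) * K (w.1.2, w.2)))%:E.
have intGG : mm.-integrable setT (EFin \o (fun z => G z.1 * G z.2)%R) by exact: integrable_prodM.
have mGG : measurable_fun setT (fun z : T * T => G z.1 * G z.2)%R by exact: measurable_prodM.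
have mKK : measurable_fun setT (fun w : T * T * S => (K (w.1.1, w.2) * K (w.1.2, w.2)))%R.
  apply: measurable_funM; apply: (measurableT_comp mK).
    apply: measurable_fun_pair => //.
    exact: (measurableT_comp measurable_fst measurable_fst).
  apply: measurable_fun_pair => //.
  exact: (measurableT_comp measurable_snd measurable_fst).
have intH : (mm \x ms).-integrable setT H.
  apply: le_integrable (integrable_prodM intGG intE) => //.
    apply/measurable_EFinP; apply: measurable_funM => //.
    exact: (measurable_prodM mGG mE).
  move=> w _; rewrite /H /= lee_fin !normrM ler_piMr ?mulr_ge0//.
  by rewrite mulr_ile1.
have FH : fubini_F ms H = (fun z => (G z.1 * G z.2)%:E *
     \int[ms]_xi (E xi * (K (z.1, xi) * K (z.2, xi)))%:E).
  apply/funext => z; rewrite /fubini_F /H /=.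
  under eq_integral do rewrite -mulrA EFinM.
  rewrite integralZl//.
  apply: le_integrable intE => //.
    apply/measurable_EFinP; apply: measurable_funM => //.
    by apply: measurable_funM; exact: measurableT_comp (pair1_measurable _).
  by move=> xi _ /=; rewrite lee_fin !normrM ler_piMr// mulr_ile1.
have := integrable_fubini_F intH; rewrite FH => intFH; split => //.
have := Fubini intH;
have -> : \int[mm]_x \int[ms]_y H (x, y) = \int[mm]_x fubini_F ms H x by [].
rewrite FH => ->; apply: eq_integral => xi _; rewrite /H /=.
under [RHS]eq_integral => z _.
  rewrite (_ : _ * _ * _ * _ = E xi * ((G z.1 * K (z.1, xi)) * (G z.2 * K (z.2, xi))))%R; last by ring.
  rewrite EFinM; over.
rewrite [RHS]integralZl//; last first.
  exact: (integrable_prodM (integrable_transform xi) (integrable_transform xi)).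
rewrite EFinM; congr (_ * _).
rewrite [RHS](integral_prodM (integrable_transform xi) (integrable_transform xi)).
have fin := integrable_fin_num measurableT (integrable_transform xi).
by rewrite /Rintegral expr2 EFinM fineK.
Qed.

End square_transform.

(** * Plancherel's identity for integrable functions *)

Section plancherel_kernel.
Context {R : realType}.
Local Notation leb := (@lebesgue_measure R).
Local Notation R2 := (measurableTypeR R * measurableTypeR R)%type.

Definition leb2_sf : {sigma_finite_measure set R2 -> \bar R} := prod_sf leb leb.

Definition expabs2 (e : R) (xi : R2) : R := expabs e xi.1 * expabs e xi.2.

Definition poisson2 (e : R) (z : R2) : R := poisson e z.1 * poisson e z.2.

Lemma expabs2_gt0 e xi : 0 < expabs2 e xi.
Proof. by rewrite mulr_gt0// expabs_gt0. Qed.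

Lemma measurable_dot : measurable_fun setT (fun z : R2 * R2 => dot z.1 z.2).
Proof.
apply: measurable_funD; apply: measurable_funM.
- exact: (measurableT_comp measurable_fst measurable_fst).
- exact: (measurableT_comp measurable_fst measurable_snd).
- exact: (measurableT_comp measurable_snd measurable_fst).
- exact: (measurableT_comp measurable_snd measurable_snd).
Qed.

Lemma measurable_cos_dot : measurable_fun setT (fun z : R2 * R2 => cos (dot z.1 z.2)).
Proof.
apply: (measurableT_comp _ measurable_dot); apply: continuous_measurable_fun.
exact: continuous_cos.
Qed.

Lemma measurable_sin_dot : measurable_fun setT (fun z : R2 * R2 => sin (dot z.1 z.2)).
Proof.
apply: (measurableT_comp _ measurable_dot); apply: continuous_measurable_fun.
exact: continuous_sin.
Qed.

Lemma integrable_expabs2 e : 0 < e -> leb2_sf.-integrable setT (EFin \o expabs2 e).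
Proof.
by move=> e0; apply: integrable_prodM; exact: integrable_expabs.
Qed.

Lemma integral_expabs2_cos e (z : R2) : 0 < e ->
  (\int[leb2_sf]_xi (expabs2 e xi * cos (dot z xi))%:E = (poisson2 e z)%:E)%E.
Proof.
move=> e0.
have intc x := integrable_expabsM e0 (measurable_cosM x) (fun k => norm_cos_le1 _).
have ints x := integrable_expabsM e0 (measurable_sinM x) (fun k => norm_sin_le1 _).
under eq_integral => xi _.
  rewrite (_ : _ * _ = (expabs e xi.1 * cos (z.1 * xi.1)) * (expabs e xi.2 * cos (z.2 * xi.2))
     - (expabs e xi.1 * sin (z.1 * xi.1)) * (expabs e xi.2 * sin (z.2 * xi.2))); last first.
    by rewrite /dot cosD /expabs2; ring.
  over.
rewrite /= integralB_EFin//; last 2 first.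
- exact: integrable_prodM (intc _) (intc _).
- exact: integrable_prodM (ints _) (ints _).
rewrite (integral_prodM (intc _) (intc _)) (integral_prodM (ints _) (ints _)).
by rewrite !integral_expabs_cos// !integral_expabs_sin// mule0 sube0.
Qed.

Definition cos_transform (G : R2 -> R) (xi : R2) : R :=
  \int[leb2_sf]_x (G x * cos (dot x xi)).

Definition sin_transform (G : R2 -> R) (xi : R2) : R :=
  \int[leb2_sf]_x (G x * sin (dot x xi)).

Lemma measurable_cos_transform G : leb2_sf.-integrable setT (EFin \o G) ->
  measurable_fun setT (cos_transform G).
Proof.
move=> intG.
exact: (measurable_transform intG (integrable_expabs2 ltr01) measurable_cos_dot
  (fun z => norm_cos_le1 _) (expabs2_gt0 1)).
Qed.

Lemma measurable_sin_transform G : leb2_sf.-integrable setT (EFin \o G) ->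
  measurable_fun setT (sin_transform G).
Proof.
move=> intG.
exact: (measurable_transform intG (integrable_expabs2 ltr01) measurable_sin_dot
  (fun z => norm_sin_le1 _) (expabs2_gt0 1)).
Qed.

Lemma measurable_expabs2 e : measurable_fun setT (expabs2 e).
Proof. by apply: measurable_prodM; exact: measurable_expabs. Qed.

Lemma measurable_poisson2B e : 0 < e ->
  measurable_fun setT (fun z : R2 * R2 => poisson2 e (z.1 - z.2)).
Proof.
move=> e0.
have mp : measurable_fun setT (poisson e).
  by apply: continuous_measurable_fun; exact: continuous_poisson.
apply: measurable_funM; apply: (measurableT_comp mp); apply: measurable_funB.
- exact: (measurableT_comp measurable_fst measurable_fst).
- exact: (measurableT_comp measurable_fst measurable_snd).
- exact: (measurableT_comp measurable_snd measurable_fst).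
- exact: (measurableT_comp measurable_snd measurable_snd).
Qed.

Lemma poisson2_ge0 e z : 0 < e -> 0 <= poisson2 e z.
Proof. by move=> e0; rewrite mulr_ge0// poisson_ge0. Qed.

Lemma poisson2N e z : poisson2 e (- z) = poisson2 e z.
Proof. by rewrite /poisson2 /= !poissonN. Qed.

Lemma poisson2_le e z : 0 < e -> poisson2 e z <= (2 / e) ^+ 2.
Proof.
move=> e0.
have H x : poisson e x <= 2 / e.
  rewrite /poisson ler_pdivrMr ?poisson_den_gt0// mulrAC ler_pdivlMr// -mulrA.
  by rewrite ler_pM2l// -expr2 lerDl sqr_ge0.
by rewrite expr2 ler_pM// poisson_ge0.
Qed.

Local Open Scope ereal_scope.

Lemma integrable_poisson e x : (0 < e)%R ->
  leb.-integrable setT (fun y => (poisson e (x - y))%:E).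
Proof.
move=> e0; apply/integrableP; split.
  by apply/measurable_EFinP; apply: continuous_measurable_fun; exact: continuous_poissonB.
under eq_integral do rewrite /= ger0_norm ?poisson_ge0//.
by rewrite integral_poisson// ltry.
Qed.

Lemma integral_poisson2 e (x : R2) : (0 < e)%R ->
  \int[leb2_sf]_y (poisson2 e (x - y))%:E = ((2 * pi) ^+ 2)%:E.
Proof.
move=> e0.
rewrite (integral_prodM (integrable_poisson x.1 e0) (integrable_poisson x.2 e0)).
by rewrite !integral_poisson// -EFinM expr2.
Qed.

Local Notation leb4 := (product_measure1 leb2_sf leb2_sf).

Lemma integrable_quadratic_poisson e G : (0 < e)%R ->
  leb2_sf.-integrable setT (EFin \o G) ->
  leb4.-integrable setT (fun z => (G z.1 * G z.2 * poisson2 e (z.1 - z.2))%:E).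
Proof.
move=> e0 intG.
have mG : measurable_fun setT G by apply/measurable_EFinP; case/integrableP: intG.
have := integrableZl measurableT ((2 / e) ^+ 2) (integrable_prodM intG intG).
apply: le_integrable => //.
  apply/measurable_EFinP; apply: measurable_funM; first exact: measurable_prodM.
  exact: measurable_poisson2B.
move=> z _ /=; rewrite lee_fin normrM [leRHS]normrM mulrC ler_wpM2r//.
by rewrite !ger0_norm ?sqr_ge0 ?poisson2_ge0// poisson2_le.
Qed.

(** The products of cosines and of sines add up to [cos (dot (z.1 - z.2) xi)], whose weighted
    integral in [xi] is the Poisson kernel at [z.1 - z.2]. *)
Lemma integral_weighted_transforms e G : (0 < e)%R ->
  leb2_sf.-integrable setT (EFin \o G) ->
  \int[leb2_sf]_xi (expabs2 e xi * (cos_transform G xi ^+ 2 + sin_transform G xi ^+ 2))%:E =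
  \int[leb4]_z (G z.1 * G z.2 * poisson2 e (z.1 - z.2))%:E.
Proof.
move=> e0 intG.
have intE := integrable_expabs2 e0.
under eq_integral do rewrite mulrDr EFinD.
rewrite ge0_integralD//; last 4 first.
- by move=> xi _; rewrite lee_fin mulr_ge0 ?sqr_ge0// ltW// expabs2_gt0.
- apply/measurable_EFinP; apply: measurable_funM; first exact: measurable_expabs2.
  by apply: measurable_funX; exact: measurable_cos_transform.
- by move=> xi _; rewrite lee_fin mulr_ge0 ?sqr_ge0// ltW// expabs2_gt0.
- apply/measurable_EFinP; apply: measurable_funM; first exact: measurable_expabs2.
  by apply: measurable_funX; exact: measurable_sin_transform.
have [intc ->] := integral_square_transform intG intE measurable_cos_dot (fun z => norm_cos_le1 _).
have [ints ->] := integral_square_transform intG intE measurable_sin_dot (fun z => norm_sin_le1 _).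
rewrite -integralD//; apply: eq_integral => z _.
have intK (h : R -> R) : measurable_fun setT (fun w : R2 * R2 => h (dot w.1 w.2)) ->
    (forall x, `|h x| <= 1)%R ->
    leb2_sf.-integrable setT
      (fun xi => (expabs2 e xi * (h (dot z.1 xi) * h (dot z.2 xi)))%:E).
  move=> mh h1; apply: le_integrable intE => //.
    apply/measurable_EFinP; apply: measurable_funM; first exact: measurable_expabs2.
    by apply: measurable_funM; exact: measurableT_comp mh (pair1_measurable _).
  by move=> xi _ /=; rewrite lee_fin !normrM ler_piMr// ?mulr_ge0// mulr_ile1.
have intKc := intK _ measurable_cos_dot norm_cos_le1.
have intKs := intK _ measurable_sin_dot norm_sin_le1.
rewrite [RHS]EFinM -(integral_expabs2_cos _ e0) -muleDr//; last first.
  by apply: fin_num_adde_defl; apply: integrable_fin_num.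
rewrite -integralD_EFin//; congr (_ * _); apply: eq_integral => xi _ /=.
rewrite (_ : dot (z.1 - z.2) xi = dot z.1 xi - dot z.2 xi)%R; last first.
  by rewrite /dot /=; ring.
by rewrite cosB mulrDr.
Qed.

End plancherel_kernel.

(** * Differences weighted by the Poisson kernel *)

Section poisson_energy.
Context {R : realType}.
Local Notation leb := (@lebesgue_measure R).
Local Notation R2 := (measurableTypeR R * measurableTypeR R)%type.
Local Notation leb2_sf := (@leb2_sf R).
Local Notation leb4 := (product_measure1 leb2_sf leb2_sf).
Local Open Scope ereal_scope.
Implicit Types (e : R) (F G : R2 -> R).

Let M : R := ((2 * pi) ^+ 2)%R.

Definition pnorm2 e (H : R2 * R2 -> R) : \bar R :=
  \int[leb4]_z ((H z) ^+ 2 * poisson2 e (z.1 - z.2))%:E.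

Lemma measurable_pnorm2 e (H : R2 * R2 -> R) : (0 < e)%R -> measurable_fun setT H ->
  measurable_fun setT (fun z : R2 * R2 => (H z) ^+ 2 * poisson2 e (z.1 - z.2))%R.
Proof.
move=> e0 mH; apply: measurable_funM; first exact: measurable_funX.
exact: measurable_poisson2B.
Qed.

Lemma pnorm2_ge0 e H : (0 < e)%R -> 0 <= pnorm2 e H.
Proof.
by move=> e0; apply: integral_ge0 => z _; rewrite lee_fin mulr_ge0 ?sqr_ge0 ?poisson2_ge0.
Qed.

Lemma pnorm2_fst e F : (0 < e)%R -> measurable_fun setT F ->
  pnorm2 e (F \o fst) = M%:E * nsq leb2_sf F.
Proof.
move=> e0 mF; rewrite /pnorm2 (fubini_tonelli1 (fun z => _)); last 2 first.
- apply/measurable_EFinP; exact: (measurable_pnorm2 e0 (measurableT_comp mF measurable_fst)).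
- by move=> z; rewrite lee_fin mulr_ge0 ?sqr_ge0 ?poisson2_ge0.
rewrite /fubini_F /= /nsq -ge0_integralZl_EFin//; last 3 first.
- by move=> x _; rewrite lee_fin sqr_ge0.
- exact: measurable_sqrE.
- exact: sqr_ge0.
apply: eq_integral => x _; rewrite muleC -(integral_poisson2 x e0).
rewrite -ge0_integralZl_EFin ?sqr_ge0//.
- by move=> y _; rewrite lee_fin poisson2_ge0.
- apply/measurable_EFinP.
  exact: (measurableT_comp (measurable_poisson2B e0) (pair1_measurable x)).
Qed.

Lemma pnorm2_snd e F : (0 < e)%R -> measurable_fun setT F ->
  pnorm2 e (F \o snd) = M%:E * nsq leb2_sf F.
Proof.
move=> e0 mF; rewrite /pnorm2 (fubini_tonelli2 (fun z => _)); last 2 first.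
- apply/measurable_EFinP; exact: (measurable_pnorm2 e0 (measurableT_comp mF measurable_snd)).
- by move=> z; rewrite lee_fin mulr_ge0 ?sqr_ge0 ?poisson2_ge0.
rewrite /fubini_G /= /nsq -ge0_integralZl_EFin//; last 3 first.
- by move=> x _; rewrite lee_fin sqr_ge0.
- exact: measurable_sqrE.
- exact: sqr_ge0.
apply: eq_integral => x _; rewrite muleC -(integral_poisson2 x e0).
under eq_integral do rewrite -poisson2N opprB.
rewrite -ge0_integralZl_EFin ?sqr_ge0//.
- by move=> y _; rewrite lee_fin poisson2_ge0.
- apply/measurable_EFinP.
  exact: (measurableT_comp (measurable_poisson2B e0) (pair1_measurable x)).
Qed.

Lemma pnorm2D_le e (H1 H2 : R2 * R2 -> R) : (0 < e)%R -> measurable_fun setT H1 -> measurable_fun setT H2 ->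
  pnorm2 e (fun z => H1 z + H2 z)%R <= 2%:E * pnorm2 e H1 + 2%:E * pnorm2 e H2.
Proof.
move=> e0 m1 m2.
have p0 (H : R2 * R2 -> R) z : 0 <= ((H z) ^+ 2 * poisson2 e (z.1 - z.2))%:E.
  by rewrite lee_fin mulr_ge0 ?sqr_ge0 ?poisson2_ge0.
rewrite /pnorm2 -!ge0_integralZl_EFin//; [|apply/measurable_EFinP; exact: measurable_pnorm2
  |apply/measurable_EFinP; exact: measurable_pnorm2].
rewrite -ge0_integralD//; last 4 first.
- by move=> z _; rewrite mule_ge0.
- by apply: measurable_funeM; apply/measurable_EFinP; exact: measurable_pnorm2.
- by move=> z _; rewrite mule_ge0.
- by apply: measurable_funeM; apply/measurable_EFinP; exact: measurable_pnorm2.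
apply: ge0_le_integral => //.
- by move=> z _; exact: (p0 (fun z => H1 z + H2 z)%R).
- by apply/measurable_EFinP; apply: measurable_pnorm2 => //; exact: measurable_funD.
- by apply: emeasurable_funD; apply: measurable_funeM; apply/measurable_EFinP; exact: measurable_pnorm2.
- move=> z _; rewrite -!EFinM -EFinD lee_fin.
  have := poisson2_ge0 (z.1 - z.2)%R e0; move: (poisson2 _ _) => P P0.
  rewrite !mulrA -mulrDl ler_wpM2r//.
  rewrite -subr_ge0 (_ : _ - _ = (H1 z - H2 z) ^+ 2)%R ?sqr_ge0//.
  by ring.
Qed.

(** Up to a constant factor, the defect in Plancherel's identity caused by the regularisation. *)
Definition pdist e G : \bar R := pnorm2 e (fun z => G z.1 - G z.2)%R.

Lemma measurable_diff G : measurable_fun setT G ->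
  measurable_fun setT (fun z : R2 * R2 => G z.1 - G z.2)%R.
Proof. by move=> mG; apply: measurable_funB; exact: measurableT_comp. Qed.

Lemma pdistD_le e F G : (0 < e)%R -> measurable_fun setT F -> measurable_fun setT G ->
  pdist e (fun x => F x + G x)%R <= 2%:E * pdist e F + 2%:E * pdist e G.
Proof.
move=> e0 mF mG; rewrite /pdist.
rewrite (_ : (fun z => _) = (fun z => (F z.1 - F z.2) + (G z.1 - G z.2))%R); last first.
  by apply/funext => z; ring.
by apply: pnorm2D_le => //; exact: measurable_diff.
Qed.

(** The bound is uniform in [e], which is what allows the vanishing of [pdist] to pass to L^2
    limits. *)
Lemma pdist_le e G : (0 < e)%R -> measurable_fun setT G ->
  pdist e G <= (4 * M)%:E * nsq leb2_sf G.
Proof.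
move=> e0 mG.
have mN : measurable_fun setT (fun z : R2 * R2 => - G z.2)%R.
  exact: (measurableT_comp (@oppr_measurable R setT) (measurableT_comp mG measurable_snd)).
have /le_trans := @pnorm2D_le e (G \o fst) (fun z => - G z.2)%R e0
  (measurableT_comp mG measurable_fst)
  mN.
apply.
have -> : pnorm2 e (fun z => - G z.2)%R = pnorm2 e (G \o snd).
  by apply: eq_integral => z _; rewrite sqrrN.
have M0 : (0 <= 2 * M)%R by rewrite mulr_ge0 ?sqr_ge0.
rewrite pnorm2_fst// pnorm2_snd// !muleA -!EFinM -ge0_muleDl ?lee_fin//.
by rewrite -EFinD; have -> : (2 * M + 2 * M = 4 * M)%R by ring.
Qed.

(** Expand [(G z.1 - G z.2) ^+ 2]: the kernel has mass [M] in either variable, so each square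
    contributes [M * |G|^2]. The cross term stays on the left to avoid a subtraction of extended
    reals. *)
Lemma pdist_identity e G : (0 < e)%R -> G \in Lfun leb2_sf 2%:E ->
  leb2_sf.-integrable setT (EFin \o G) ->
  pdist e G + 2%:E * \int[leb4]_z (G z.1 * G z.2 * poisson2 e (z.1 - z.2))%:E =
  (2 * M)%:E * nsq leb2_sf G.
Proof.
move=> e0 /Lfun2P[mG G2] intG.
have intGG := integrable_quadratic_poisson e0 intG.
have p0 (H : R2 * R2 -> R) z : 0 <= ((H z) ^+ 2 * poisson2 e (z.1 - z.2))%:E.
  by rewrite lee_fin mulr_ge0 ?sqr_ge0 ?poisson2_ge0.
have intH (H : R2 * R2 -> R) : measurable_fun setT H -> pnorm2 e H < +oo ->
    leb4.-integrable setT (fun z => ((H z) ^+ 2 * poisson2 e (z.1 - z.2))%:E).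
  move=> mH Hfin; apply/integrableP; split.
    by apply/measurable_EFinP; exact: measurable_pnorm2.
  by under eq_integral do rewrite gee0_abs//.
have fin1 : M%:E * nsq leb2_sf G < +oo by rewrite lte_mul_pinfty// lee_fin sqr_ge0.
have int1 := intH _ (measurableT_comp mG measurable_fst).
have int2 := intH _ (measurableT_comp mG measurable_snd).
rewrite pnorm2_fst// in int1; rewrite pnorm2_snd// in int2.
have intd := intH _ (measurable_diff mG).
have dfin : pdist e G < +oo.
  by rewrite (le_lt_trans (pdist_le _ _))// lte_mul_pinfty// lee_fin mulr_ge0// sqr_ge0.
rewrite /pdist /pnorm2 -integralZl// -integralD//; [|exact: intd|exact: integrableZl].
transitivity (pnorm2 e (G \o fst) + pnorm2 e (G \o snd)); last first.
  by rewrite pnorm2_fst// pnorm2_snd// mulr_natl mulr2n EFinD ge0_muleDl ?lee_fin ?sqr_ge0.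
rewrite /pnorm2 -integralD//; [|exact: int1|exact: int2].
apply: eq_integral => z _; rewrite -EFinM -!EFinD /=; congr EFin.
by ring.
Qed.

End poisson_energy.

Lemma nsq_dominated d (T : measurableType d) (R : realType)
    (mu : {measure set T -> \bar R}) (f : nat -> T -> R) (F g : T -> R) :
  (forall n, measurable_fun setT (f n)) -> measurable_fun setT F ->
  measurable_fun setT g -> (nsq mu g < +oo)%E ->
  (forall x, f n x @[n --> \oo] --> F x) ->
  (forall n x, `|f n x - F x| <= `|g x|) ->
  (nsq mu (fun x => f n x - F x)%R @[n --> \oo] --> 0)%E.
Proof.
move=> mf mF mg g2 fF fg.
have [] := @dominated_convergence _ _ _ mu setT measurableT
  (fun n x => ((f n x - F x) ^+ 2)%:E) (cst 0%E) (fun x => (g x ^+ 2)%:E).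
- by move=> n; apply: measurable_sqrE; exact: measurable_funB.
- exact: measurable_cst.
- apply/aeW => x _; apply/cvg_EFin; first exact: nearW.
  rewrite -[X in _ --> X](mulr0 (0 : R)).
  have h : f n x - F x @[n --> \oo] --> 0.
    by rewrite -(subrr (F x)); apply: cvgB => //; exact: cvg_cst.
  exact: (cvgM h h).
- apply/integrableP; split; first exact: measurable_sqrE.
  by under eq_integral do rewrite gee0_abs ?lee_fin ?sqr_ge0//.
- apply/aeW => x n _; rewrite gee0_abs ?lee_fin ?sqr_ge0//.
  rewrite -[leLHS]real_normK ?num_real// -[leRHS]real_normK ?num_real//.
  by rewrite ler_pXn2r// nnegrE.
- by move=> _ _; rewrite integral0.
Qed.

(** * Poisson integrals of intervals and rectangles *)

Section interval_poisson.
Context {R : realType}.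
Local Notation leb := (@lebesgue_measure R).
Implicit Types (e a b x : R).

Definition poisson_itv e a b x : R := 2 * (atan ((b - x) / e) - atan ((a - x) / e)).

Lemma integral_indic_poisson e a b x : 0 < e -> a < b ->
  (\int[leb]_y (\1_(`]a, b]) y * poisson e (x - y))%:E = (poisson_itv e a b x)%:E)%E.
Proof.
move=> e0 ab; rewrite /poisson_itv -integral_poisson_itv//.
rewrite -integral_itv_obnd_cbnd; last first.
  apply/measurable_EFinP/measurable_funTS.
  by apply: continuous_measurable_fun; exact: continuous_poissonB.
rewrite [RHS]integral_mkcond; apply: eq_integral => y _.
by rewrite /patch indicE; case: ifPn => _; rewrite ?mul1r ?mul0r.
Qed.

Lemma measurable_poisson_itv e a b : measurable_fun setT (poisson_itv e a b).
Proof.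
have H c : measurable_fun setT (fun x => atan ((c - x) / e)).
  apply: continuous_measurable_fun => x.
  apply: (@continuous_comp _ _ _ (fun x => (c - x) / e) atan); last exact: continuous_atan.
  by apply: cvgM; [apply: cvgB; [exact: cvg_cst|exact: cvg_id]|exact: cvg_cst].
by apply: measurable_funM => //; exact: measurable_funB.
Qed.

Lemma poisson_itv_bounded e a b x : `|poisson_itv e a b x| <= 2 * pi.
Proof.
rewrite /poisson_itv normrM ger0_norm// ler_pM2l// ler_norml.
have := atan_ltpi2 ((b - x) / e); have := atan_gtNpi2 ((b - x) / e).
have := atan_ltpi2 ((a - x) / e); have := atan_gtNpi2 ((a - x) / e).
by move=> *; apply/andP; split; lra.
Qed.

(** A sequence tending to [0] from the right, because the monotone and dominated convergence
    theorems concern sequences. *)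
Definition eps (k : nat) : R := k.+1%:R^-1.

Lemma eps_gt0 k : 0 < eps k. Proof. by rewrite invr_gt0 ltr0n. Qed.

Lemma cvg_atan_eps c : 0 < c -> atan (c / eps k) @[k --> \oo] --> pi / 2.
Proof.
move=> c0; apply: (@cvg_comp _ _ _ (fun k => c / eps k) atan _ (pinfty_nbhs R)); last exact: cvgy_atan.
apply/cvgryPge => A; have /cvgryPge/(_ (A / c)) := @cvgr_idn R.
apply: filterS => n; rewrite /eps invrK ler_pdivrMr// mulrC => /le_trans; apply.
by rewrite ler_pM2l// ler_nat.
Qed.

Lemma cvg_poisson_itv a b x : a < x -> x < b ->
  poisson_itv (eps k) a b x @[k --> \oo] --> 2 * pi.
Proof.
move=> ax xb; rewrite /poisson_itv.
apply: cvgM; first exact: cvg_cst.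
rewrite (_ : (fun k => _) = (fun k => atan ((b - x) / eps k) + atan ((x - a) / eps k))); last first.
  apply/funext => k; rewrite (_ : (x - a) / eps k = - ((a - x) / eps k)) ?atanN//.
  by rewrite -mulNr opprB.
rewrite [X in _ --> X](_ : pi = pi / 2 + pi / 2); last by field.
by apply: cvgD; apply: cvg_atan_eps; rewrite subr_gt0.
Qed.

Lemma integrable_indic_poisson_itv e a b :
  leb.-integrable setT (fun x => (\1_(`]a, b]) x * poisson_itv e a b x)%:E).
Proof.
have intI : leb.-integrable setT (EFin \o \1_(`]a, b] : set (measurableTypeR R))).
  exact: integrable_indic_itv.
apply: le_integrable (integrableZl measurableT (2 * pi) intI) => //.
  by apply/measurable_EFinP; apply: measurable_funM => //; exact: measurable_poisson_itv.
move=> x _ /=; rewrite lee_fin normrM [leRHS]normrM mulrC ler_wpM2r//.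
by rewrite (le_trans (poisson_itv_bounded _ _ _ _))// ler_norm.
Qed.

Lemma cvg_integral_poisson_itv a b : a < b ->
  (\int[leb]_x (\1_(`]a, b]) x * poisson_itv (eps k) a b x)%:E @[k --> \oo] -->
   (2 * pi * (b - a))%:E)%E.
Proof.
move=> ab.
have intI : leb.-integrable setT (EFin \o \1_(`]a, b] : set (measurableTypeR R))).
  exact: integrable_indic_itv.
have [] := @dominated_convergence _ _ _ leb setT measurableT
  (fun k x => (\1_(`]a, b]) x * poisson_itv (eps k) a b x)%:E)
  (fun x => (\1_(`]a, b]) x * (2 * pi))%:E) (fun x => (2 * pi)%:E * (\1_(`]a, b]) x)%:E)%E.
- by move=> k; case/integrableP: (integrable_indic_poisson_itv (eps k) a b).
- by apply/measurable_EFinP; exact: measurable_funM.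
(* At the endpoint [b], which belongs to []a, b]], the limit is [pi] instead of [2 * pi]; a single
   point is negligible. *)
- exists [set b]; split => //; first exact: lebesgue_measure_set1.
  move=> x /= /not_implyP[_]; apply: contra_notP => xb.
  apply/cvg_EFin; first exact: nearW.
  have [xab|xab] := boolP (x \in `]a, b]%classic).
    apply: cvgM; first exact: cvg_cst.
    move: xab; rewrite inE/= in_itv/= => /andP[ax].
    by rewrite le_eqVlt => /orP[/eqP//|xltb]; exact: cvg_poisson_itv.
  rewrite indicE (negbTE xab) mul0r.
  by under eq_fun do rewrite mul0r; exact: cvg_cst.
- exact: integrableZl.
- apply/aeW => x k _; rewrite -EFinM lee_fin normrM mulrC ler_pM//.
    exact: poisson_itv_bounded.
  by rewrite ger0_norm// indicE.
move=> _ _;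
have -> : ((2 * pi * (b - a))%:E = \int[leb]_x (\1_(`]a, b]) x * (2 * pi))%:E)%E; last by [].
under [RHS]eq_integral do rewrite mulrC EFinM.
rewrite integralZl// integral_indic// setIT.
have mI : leb `]a, b]%classic = (b - a)%:E by rewrite lebesgue_measure_itv/= lte_fin ab.
by rewrite [X in _ = (_ * X)%E]mI -EFinM.
Qed.

End interval_poisson.

Section poisson_continuity.
Context {R : realType}.
Local Notation leb := (@lebesgue_measure R).
Local Notation R1 := (measurableTypeR R).
Local Notation R2 := (measurableTypeR R * measurableTypeR R)%type.
Local Notation leb2_sf := (@leb2_sf R).
Local Notation leb4 := (product_measure1 leb2_sf leb2_sf).
Local Notation eps := (@eps R).
Implicit Types (F G : R2 -> R).

Definition poisson_continuous G :=
  (pdist (eps k) G @[k --> \oo] --> 0)%E.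

Lemma pdist_ge0 e G : 0 < e -> (0 <= pdist e G)%E.
Proof. exact: pnorm2_ge0. Qed.

Lemma poisson_continuousD F G : measurable_fun setT F -> measurable_fun setT G ->
  poisson_continuous F -> poisson_continuous G ->
  poisson_continuous (fun x => F x + G x).
Proof.
move=> mF mG cF cG.
apply: (@cvge0_le _ _ _ _ _ (fun k => 2%:E * pdist (eps k) F + 2%:E * pdist (eps k) G)%E).
- by move=> k; exact/pdist_ge0/eps_gt0.
- by apply: nearW => k; apply: pdistD_le => //; exact: eps_gt0.
- rewrite -[X in _ --> X]adde0 -[X in (X + _)%E](mule0 2%:E) -[X in (_ + X)%E](mule0 2%:E).
  by apply: cvgeD => //; apply: cvgeZl.
Qed.

Lemma pdistZ e (c : R) G : 0 < e -> measurable_fun setT G ->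
  pdist e (fun x => c * G x) = ((c ^+ 2)%:E * pdist e G)%E.
Proof.
move=> e0 mG; rewrite /pdist /pnorm2 -ge0_integralZl_EFin ?sqr_ge0//.
- by apply: eq_integral => z _; rewrite -EFinM; congr EFin; ring.
- by move=> z _; rewrite lee_fin mulr_ge0 ?sqr_ge0 ?poisson2_ge0.
- by apply/measurable_EFinP; apply: measurable_pnorm2 => //; exact: measurable_diff.
Qed.

Lemma poisson_continuousZ (c : R) G : measurable_fun setT G ->
  poisson_continuous G -> poisson_continuous (fun x => c * G x).
Proof.
move=> mG cG; rewrite /poisson_continuous.
under eq_fun do rewrite pdistZ ?eps_gt0//.
by rewrite -(mule0 (c ^+ 2)%:E); apply: cvgeZl.
Qed.

Lemma poisson_continuousB F G : measurable_fun setT F -> measurable_fun setT G ->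
  poisson_continuous F -> poisson_continuous G ->
  poisson_continuous (fun x => F x - G x).
Proof.
move=> mF mG cF cG.
rewrite (_ : (fun x => _) = (fun x => F x + (-1) * G x)); last first.
  by apply/funext => x; rewrite mulN1r.
apply: poisson_continuousD => //; first exact: measurable_funM.
exact: poisson_continuousZ.
Qed.

Lemma poisson_continuous_sum (I : Type) (s : seq I) (f : I -> R2 -> R) :
  (forall i, measurable_fun setT (f i)) -> (forall i, poisson_continuous (f i)) ->
  poisson_continuous (fun x => \sum_(i <- s) f i x).
Proof.
move=> mf cf; elim: s => [|i s IH].
  rewrite /poisson_continuous.
  rewrite (_ : (fun k => _) = cst 0%E); first exact: cvg_cst.
  apply/funext => k; rewrite /pdist /pnorm2; apply: integral0_eq => z _.
  by rewrite !big_nil subr0 expr0n mul0r.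
rewrite (_ : (fun x => _) = (fun x => f i x + \sum_(j <- s) f j x)); last first.
  by apply/funext => x; rewrite big_cons.
by apply: poisson_continuousD => //; exact: measurable_sum.
Qed.

(** An approximant [f n] is fixed first: [pdist_le] bounds the contribution of [G - f n] uniformly
    in [k], and that of [f n] tends to [0]. The [8] in [M] is the [4] of [pdist_le] times the [2] of
    [pdistD_le]. *)
Lemma poisson_continuous_lim (f : nat -> R2 -> R) G :
  (forall n, measurable_fun setT (f n)) -> measurable_fun setT G ->
  (forall n, poisson_continuous (f n)) ->
  (nsq leb2_sf (fun x => f n x - G x)%R @[n --> \oo] --> 0)%E ->
  poisson_continuous G.
Proof.
move=> mf mG cf fG.
pose M : R := 8 * (2 * pi) ^+ 2.
have M0 : 0 < M by rewrite mulr_gt0// exprn_gt0// mulr_gt0// pi_gt0.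
apply/cvge0P; first by move=> k; exact/pdist_ge0/eps_gt0.
move=> e e0.
have e1 : 0 < e / 2 / M by rewrite !divr_gt0.
have /cvge0P/(_ _ e1) := fG.
move=> /(_ (fun n => nsq_ge0 _ _)) [n _ /(_ n (leqnn n))/= Hn].
have e2 : 0 < e / 2 / 2 by rewrite !divr_gt0.
have /cvge0P/(_ _ e2) := cf n.
move=> /(_ (fun k => pdist_ge0 _ (eps_gt0 k))); apply: filterS => k Hk.
have mfG : measurable_fun setT (fun x => G x - f n x) by exact: measurable_funB.
have := pdistD_le (eps_gt0 k) (mf n) mfG.
rewrite (_ : (fun x => _ + _) = G); last by apply/funext => x; rewrite addrC subrK.
move=> /le_lt_trans; apply.
have := pdist_le (eps_gt0 k) mfG; rewrite nsq_distC => H.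
have -> : (e%:E = 2%:E * (e / 2 / 2)%:E + 2%:E * ((4 * (2 * pi) ^+ 2)%:E * (e / 2 / M)%:E))%E.
  rewrite -!EFinM -EFinD; congr EFin; rewrite /M.
  have : 0 < (2 * pi : R) ^+ 2 by rewrite exprn_gt0// mulr_gt0// pi_gt0.
  move: ((2 * pi) ^+ 2) => p p0; field.
  by rewrite gt_eqF.
apply: lteD; first by rewrite lte_pmul2l.
rewrite lte_pmul2l//; apply: le_lt_trans H _; rewrite lte_pmul2l//.
by rewrite lte_fin mulr_gt0// exprn_gt0// mulr_gt0// pi_gt0.
Qed.

(** For a rectangle the cross term of [pdist_identity] factors into two one-dimensional arctangent
    integrals. Its limit is [(2 * pi) ^+ 2] times the area, exactly what cancels the right-hand
    side. *)
Lemma poisson_continuous_rect (a b c d : R) : a < b -> c < d ->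
  poisson_continuous (\1_(`]a, b]%classic `*` `]c, d]%classic) : R2 -> R).
Proof.
move=> ab cd.
pose I : set R1 := `]a, b]%classic; pose J : set R1 := `]c, d]%classic.
have intI : leb.-integrable setT (EFin \o \1_I) by exact: integrable_indic_itv.
have intJ : leb.-integrable setT (EFin \o \1_J) by exact: integrable_indic_itv.
pose G : R2 -> R := \1_(I `*` J).
have GE z : G z = \1_I z.1 * \1_J z.2.
  by rewrite /G !indicE in_setX -natrM mulnb.
have intG : leb2_sf.-integrable setT (EFin \o G).
  rewrite (_ : EFin \o G = fun z => (\1_I z.1 * \1_J z.2)%:E); last first.
    by apply/funext => z /=; rewrite GE.
  exact: integrable_prodM.
have mG : measurable_fun setT G by apply/measurable_EFinP; case/integrableP: intG.
have nG : (nsq leb2_sf G = ((b - a) * (d - c))%:E)%E.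
  rewrite /nsq (_ : (fun z => _) = fun z => (\1_I z.1 * \1_J z.2)%:E); last first.
    apply/funext => z; rewrite GE exprMn !indicE.
    by case: (_ \in _); case: (_ \in _); rewrite ?expr0n ?expr1n.
  have msI : measurable I by exact: measurable_itv.
  have msJ : measurable J by exact: measurable_itv.
  rewrite (integral_prodM intI intJ) !integral_indic// ?setIT.
  have mI : leb I = (b - a)%:E by rewrite lebesgue_measure_itv/= lte_fin ab.
  have mJ : leb J = (d - c)%:E by rewrite lebesgue_measure_itv/= lte_fin cd.
  by rewrite [X in (X * _)%E]mI [X in (_ * X)%E]mJ.
have L2G : G \in Lfun leb2_sf 2%:E by apply/Lfun2P; split=> //; rewrite nG ltry.
pose q k (u v x : R) := (\1_(`]u, v]) x * poisson_itv (eps k) u v x)%:E.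
have QE k : (\int[leb4]_z (G z.1 * G z.2 * poisson2 (eps k) (z.1 - z.2))%:E =
    (\int[leb]_x q k a b x) * (\int[leb]_x q k c d x))%E.
  rewrite -integral12_prod_meas1; last first.
    by apply: integrable_quadratic_poisson => //; exact: eps_gt0.
  rewrite -(integral_prodM (integrable_indic_poisson_itv (eps k) a b)
    (integrable_indic_poisson_itv (eps k) c d)).
  apply: eq_integral => x _; rewrite /fubini_F /=.
  have mul1 (u v : R) : measurable_fun setT (\1_`]u, v] : R1 -> R) by exact: measurable_indic.
  have intp (u v w : R) : leb.-integrable setT (fun y => (\1_(`]u, v]) y * poisson (eps k) (w - y))%:E).
    apply: le_integrable (integrable_poisson w (eps_gt0 k)) => //.
      apply/measurable_EFinP; apply: measurable_funM; first exact: mul1.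
      by apply: continuous_measurable_fun; exact: continuous_poissonB (eps_gt0 k).
    move=> y _; rewrite lee_fin normrM ler_piMl// indicE.
    by case: (_ \in _); rewrite ?normr1 ?normr0.
  under eq_integral => y _.
    rewrite !GE (_ : _ * _ * _ = \1_I x.1 * \1_J x.2 *
      ((\1_I y.1 * poisson (eps k) (x.1 - y.1)) * (\1_J y.2 * poisson (eps k) (x.2 - y.2)))); last first.
      by rewrite /poisson2 /=; ring.
    rewrite EFinM; over.
  rewrite integralZl//; last exact: (integrable_prodM (intp a b x.1) (intp c d x.2)).
  rewrite (integral_prodM (intp a b x.1) (intp c d x.2)).
  rewrite !integral_indic_poisson ?eps_gt0// -!EFinM; congr EFin; ring.
have Qlim : (\int[leb4]_z (G z.1 * G z.2 * poisson2 (eps k) (z.1 - z.2))%:E @[k --> \oo] -->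
    ((2 * pi) ^+ 2 * ((b - a) * (d - c)))%:E)%E.
  under eq_fun do rewrite QE.
  have -> : (((2 * pi) ^+ 2 * ((b - a) * (d - c)))%:E =
      (2 * pi * (b - a))%:E * (2 * pi * (d - c))%:E)%E.
    by rewrite -EFinM; congr EFin; ring.
  by apply: cvgeM => //; exact: cvg_integral_poisson_itv.
have Dk k : (pdist (eps k) G = (2 * (2 * pi) ^+ 2 * ((b - a) * (d - c)))%:E -
    2%:E * \int[leb4]_z (G z.1 * G z.2 * poisson2 (eps k) (z.1 - z.2))%:E)%E.
  have := pdist_identity (eps_gt0 k) L2G intG; rewrite nG -EFinM => <-.
  rewrite addeK// fin_numM//.
  by apply: integrable_fin_num => //; apply: integrable_quadratic_poisson => //; exact: eps_gt0.
rewrite /poisson_continuous -/I -/J -/G.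
under eq_fun do rewrite Dk.
have -> : (0 = (2 * (2 * pi) ^+ 2 * ((b - a) * (d - c)))%:E -
   2%:E * ((2 * pi) ^+ 2 * ((b - a) * (d - c)))%:E :> \bar R)%E.
  by rewrite -EFinM -EFinB; congr EFin; ring.
apply: cvgeB => //; first exact: cvg_cst.
exact: cvgeZl.
Qed.

End poisson_continuity.

(** * From rectangles to all of L^2 *)

Section poisson_continuity_L2.
Context {R : realType}.
Local Notation leb := (@lebesgue_measure R).
Local Notation R1 := (measurableTypeR R).
Local Notation R2 := (measurableTypeR R * measurableTypeR R)%type.
Local Notation leb2_sf := (@leb2_sf R).
Implicit Types (F G : R2 -> R).

Lemma nsq_indic_lty (B : set R2) : measurable B -> (leb2_sf B < +oo)%E ->
  (nsq leb2_sf \1_B < +oo)%E.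
Proof.
move=> mB Bfin; have -> : nsq leb2_sf \1_B = (\int[leb2_sf]_x (\1_B x)%:E)%E.
  apply: eq_integral => x _; rewrite indicE.
  by case: (_ \in _); rewrite ?expr0n ?expr1n.
by rewrite integral_indic// setIT.
Qed.

(** Intersecting with a set [B] of finite measure keeps all indicators square integrable and turns
    complements into differences from [\1_B]. The map [h] lets one argument serve for each
    coordinate and for the plane itself. *)
Lemma poisson_continuous_dynkin d (T : measurableType d) (h : R2 -> T) (B : set R2)
    (Gen : set (set T)) :
  measurable_fun setT h -> measurable B -> (leb2_sf B < +oo)%E ->
  @measurable _ T = <<s Gen >> -> setI_closed Gen ->
  poisson_continuous \1_B ->
  (forall A, Gen A -> poisson_continuous \1_(h @^-1` A `&` B)) ->
  forall A, measurable A -> poisson_continuous \1_(h @^-1` A `&` B).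
Proof.
move=> mh mB Bfin GenE GenI pcB pcGen A mA.
have mhA (C : set T) : measurable C -> measurable (h @^-1` C `&` B).
  by move=> mC; apply: measurableI => //; rewrite -[X in measurable X]setTI; exact: mh.
apply: (@dynkin_induction _ T Gen (fun C => poisson_continuous \1_(h @^-1` C `&` B))) => //.
- by rewrite preimage_setT setTI.
- move=> S mS pcS.
  rewrite (_ : \1_(h @^-1` (~` S) `&` B) = fun x => \1_B x - \1_(h @^-1` S `&` B) x); last first.
    apply/funext => x; rewrite !indicE preimage_setC !in_setI in_setC.
    by case: (_ \in _); case: (_ \in _); rewrite /= ?subrr ?subr0.
  apply: poisson_continuousB => //; apply: measurable_indic => //; exact: mhA.
- move=> F mF tF pcF.
  pose f n (x : R2) : R := \sum_(k < n) \1_(h @^-1` (F k) `&` B) x.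
  have f_in n x j : F j (h x) -> f n x = (j < n)%N%:R * \1_B x.
    move=> Fj.
    have fk k : \1_(h @^-1` (F k) `&` B) x = (k == j)%:R * \1_B x :> R.
      rewrite !indicE in_setI -natrM mulnb; congr ((nat_of_bool (_ && _))%:R).
      apply/idP/eqP => [|->]; last by rewrite inE.
      by rewrite inE => Fk; apply: tF => //; exists (h x).
    rewrite /f; under eq_bigr do rewrite fk.
    rewrite -mulr_suml; congr (_ * _).
    have [jn|nj] := ltnP j n.
      rewrite (bigD1 (Ordinal jn))//= eqxx big1 ?addr0// => i.
      by rewrite -val_eqE/= => /negbTE ->.
    rewrite big1// => i _; case: eqP => // ij.
    by have := ltn_ord i; rewrite ij ltnNge nj.
  have f_notin n x : (forall j, ~ F j (h x)) -> f n x = 0.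
    move=> Fx; rewrite /f big1// => i _; rewrite indicE memNset//.
    by move=> -[/Fx].
  have U_in x j : F j (h x) -> \1_(h @^-1` (\bigcup_k F k) `&` B) x = \1_B x :> R.
    move=> Fj; rewrite !indicE in_setI (_ : (x \in h @^-1` (\bigcup_k F k)) = true)//.
    by apply/mem_set; exists j.
  have U_notin x : (forall j, ~ F j (h x)) -> \1_(h @^-1` (\bigcup_k F k) `&` B) x = 0 :> R.
    by move=> Fx; rewrite indicE memNset// => -[[k _ /Fx]].
  have mf n : measurable_fun setT (f n).
    by apply: measurable_sum => k; apply: measurable_indic; exact: mhA.
  have mU : measurable (h @^-1` (\bigcup_k F k) `&` B).
    by apply: mhA; exact: bigcupT_measurable.
  apply: (@poisson_continuous_lim _ f) => //.
    by move=> n; apply: poisson_continuous_sum => i //; apply: measurable_indic; exact: mhA.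
  apply: (nsq_dominated (g := \1_B)) => //.
  + exact: nsq_indic_lty.
  + move=> x; have [[j Fj]|Fx] := pselect (exists j, F j (h x)).
      rewrite (U_in _ _ Fj); apply: cvg_near_cst; near=> n.
      rewrite (f_in _ _ _ Fj) (_ : (j < n)%N) ?mul1r//.
      by near: n; exact: nbhs_infty_gt.
    have {}Fx j : ~ F j (h x) by move=> Fj; apply: Fx; exists j.
    rewrite U_notin//; apply: cvg_near_cst; apply: nearW => n.
    by rewrite f_notin.
  + move=> n x; have [[j Fj]|Fx] := pselect (exists j, F j (h x)).
      rewrite (U_in _ _ Fj) (f_in _ _ _ Fj); case: (j < n)%N.
        by rewrite mul1r subrr normr0.
      by rewrite mul0r sub0r normrN.
    have {}Fx j : ~ F j (h x) by move=> Fj; apply: Fx; exists j.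
    by rewrite U_notin// f_notin// subrr normr0.
- by rewrite -GenE.
Unshelve. all: by end_near. Qed.

(** Half-open, unlike [box], so that its sides belong to the intersection-stable generator [ocitv]
    of the Borel sets. *)
Definition oc_box (n : nat) : set R2 :=
  `]- n%:R, n%:R]%classic `*` `]- n%:R, n%:R]%classic.

Lemma measurable_oc_box n : measurable (oc_box n).
Proof. by apply: measurableX; exact: measurable_itv. Qed.

Lemma leb2_setX_itv_lty (A B : set R1) (n m : nat) : measurable A -> measurable B ->
  A `<=` `]- n%:R, n%:R]%classic -> B `<=` `]- m%:R, m%:R]%classic ->
  (leb2_sf (A `*` B) < +oo)%E.
Proof.
move=> mA mB An Bm.
have H (C : set R1) k : measurable C -> C `<=` `]- k%:R, k%:R]%classic -> (leb C < +oo)%E.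
  move=> mC Ck; apply: (@le_lt_trans _ _ (leb `]- k%:R, k%:R]%classic)).
    by apply: le_measure; rewrite ?inE//; exact: measurable_itv.
  by rewrite lebesgue_measure_itv/=; case: ifP => _; rewrite ?ltry// -EFinD ltry.
rewrite [leb2_sf _]product_measure1E// lte_mul_pinfty//; [|exact: H Bm].
by rewrite ge0_fin_numE//; exact: H An.
Qed.

Lemma poisson_continuous_oc (I J : set R1) : ocitv I -> ocitv J ->
  poisson_continuous (\1_(I `*` J) : R2 -> R).
Proof.
have pc0 : poisson_continuous (\1_(set0 : set R2) : R2 -> R).
  rewrite /poisson_continuous (_ : (fun k => _) = cst 0%E); first exact: cvg_cst.
  apply/funext => k; apply: integral0_eq => z _.
  by rewrite indic0 subrr expr0n mul0r.
move=> /ocitvP[->|[[a b] ab ->]]; first by rewrite set0X.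
move=> /ocitvP[->|[[c d] cd ->]]; first by rewrite setX0.
exact: poisson_continuous_rect.
Qed.

(** Three Dynkin arguments: the first side of a rectangle is extended from intervals to Borel sets,
    then the second side, and finally measurable rectangles, which generate the product
    sigma-algebra, give all measurable sets. *)
Lemma poisson_continuous_box_set n (A : set R2) : measurable A ->
  poisson_continuous (\1_(A `&` oc_box n) : R2 -> R).
Proof.
pose I : set R1 := `]- n%:R, n%:R]%classic.
have mI : measurable I by exact: measurable_itv.
have oI : ocitv I by exact: is_ocitv.
have step1 (A1 : set R1) (J : set R1) : measurable A1 -> ocitv J -> J `<=` I ->
    poisson_continuous (\1_((A1 `&` I) `*` J) : R2 -> R).
  move=> mA1 oJ JI; have mJ : measurable J by exact: sub_sigma_algebra.
  rewrite (_ : (A1 `&` I) `*` J = fst @^-1` A1 `&` (I `*` J)); last first.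
    by apply/seteqP; split => -[x y] /=; [move=> [[]]|move=> [? []]].
  apply: (@poisson_continuous_dynkin _ R1 fst (I `*` J) (@ocitv R)) => //.
  - exact: measurableX.
  - by apply: (@leb2_setX_itv_lty I J n n).
  - exact: ocitvI.
  - exact: poisson_continuous_oc.
  - move=> A2 oA2; rewrite (_ : _ `&` _ = (A2 `&` I) `*` J); last first.
      by apply/seteqP; split => -[x y] /=; [move=> [? []]|move=> [[]]].
    by apply: poisson_continuous_oc => //; exact: ocitvI.
have step2 (A1 A2 : set R1) : measurable A1 -> measurable A2 ->
    poisson_continuous (\1_((A1 `&` I) `*` (A2 `&` I)) : R2 -> R).
  move=> mA1 mA2; have mA1I : measurable (A1 `&` I) by exact: measurableI.
  rewrite (_ : _ `*` _ = snd @^-1` A2 `&` ((A1 `&` I) `*` I)); last first.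
    by apply/seteqP; split => -[x y] /=; [move=> [? []]|move=> [? []]].
  apply: (@poisson_continuous_dynkin _ R1 snd ((A1 `&` I) `*` I) (@ocitv R)) => //.
  - exact: measurableX.
  - by apply: (@leb2_setX_itv_lty (A1 `&` I) I n n) => // x [].
  - exact: ocitvI.
  - exact: step1.
  - move=> A3 oA3; rewrite (_ : _ `&` _ = (A1 `&` I) `*` (A3 `&` I)); last first.
      by apply/seteqP; split => -[x y] /=; [move=> [? []]|move=> [? []]].
    by apply: step1 => //; exact: ocitvI.
move=> mA.
apply: (@poisson_continuous_dynkin _ R2 id (oc_box n)
   [set C `*` D | C in (@measurable _ R1) & D in (@measurable _ R1)]) => //.
- exact: measurable_oc_box.
- by apply: (@leb2_setX_itv_lty I I n n).
- exact: measurable_prod_measurableType.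
- move=> _ _ [A1 mA1 [A2 mA2 <-]] [B1 mB1 [B2 mB2 <-]].
  exists (A1 `&` B1); first exact: measurableI.
  exists (A2 `&` B2); first exact: measurableI.
  by rewrite setXI.
- exact: poisson_continuous_oc.
- move=> _ [A1 mA1 [A2 mA2 <-]].
  rewrite preimage_id /oc_box -setXI; exact: step2.
Qed.

Import HBNNSimple.

Lemma poisson_continuous_simple_box n (phi : {nnsfun R2 >-> R}) :
  poisson_continuous (fun x => phi x * \1_(oc_box n) x).
Proof.
have [s sE] : exists s : seq R, forall x, phi x = \sum_(y <- s) y * \1_(phi @^-1` [set y]) x.
  by eexists => x; rewrite fimfunE fsbig_finite.
rewrite (_ : (fun x => _) = fun x => \sum_(y <- s)
    (y * \1_(phi @^-1` [set y] `&` oc_box n) x)); last first.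
  apply/funext => x; rewrite sE mulr_suml.
  by apply: eq_bigr => y _; rewrite -mulrA indicI.
have mphi (y : R) : measurable (phi @^-1` [set y]) by [].
have mI (y : R) : measurable_fun setT (\1_(phi @^-1` [set y] `&` oc_box n) : R2 -> R).
  by apply: measurable_indic; apply: measurableI => //; exact: measurable_oc_box.
apply: poisson_continuous_sum => y; first exact: measurable_funM.
by apply: poisson_continuousZ => //; exact: poisson_continuous_box_set.
Qed.

Lemma oc_box_near (x : R2) : \forall n \near \oo, oc_box n x.
Proof.
near=> n; rewrite /oc_box /= !in_itv/=.
have : `|x.1| + `|x.2| + 1 <= n%:R.
  by near: n; exact: nbhs_infty_ger.
have := ler_norm x.1; have := ler_norm x.2; have := ler_norm (- x.1); have := ler_norm (- x.2).
rewrite !normrN => *.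
have := normr_ge0 x.1; have := normr_ge0 x.2 => *.
by split; apply/andP; split; lra.
Unshelve. all: by end_near. Qed.

Lemma poisson_continuous_ge0 G : measurable_fun setT G -> (forall x, 0 <= G x) ->
  (nsq leb2_sf G < +oo)%E -> poisson_continuous G.
Proof.
move=> mG G0 G2.
have mEG : measurable_fun setT (EFin \o G) by apply/measurable_EFinP.
pose phi := nnsfun_approx measurableT mEG.
have phiG x : phi n x @[n --> \oo] --> G x.
  have : EFin \o phi ^~ x @ \oo --> (G x)%:E.
    by apply: (cvg_nnsfun_approx measurableT mEG) => // y _; rewrite lee_fin.
  by move=> /fine_cvgP[].
have phile n x : phi n x <= G x.
  rewrite -(cvg_lim _ (phiG x))//.
  apply: nondecreasing_cvgn_le; last by apply/cvg_ex; exists (G x).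
  by move=> a b ab; exact/lefP/nd_nnsfun_approx.
have mphi n : measurable_fun setT (fun x => phi n x * \1_(oc_box n) x).
  by apply: measurable_funM => //; apply: measurable_indic; exact: measurable_oc_box.
apply: (@poisson_continuous_lim _ (fun n x => phi n x * \1_(oc_box n) x)) => //.
  by move=> n; exact: poisson_continuous_simple_box.
apply: (nsq_dominated (g := G)) => //.
- move=> x; rewrite -[X in _ --> X]mulr1; apply: cvgM; first exact: phiG.
  apply: cvg_near_cst; apply: filterS (oc_box_near x) => n xn.
  by rewrite indicE mem_set.
- move=> n x; rewrite (ger0_norm (G0 x)) ler_norml.
  have h1 := phile n x; have h2 : 0 <= phi n x by [].
  have := G0 x; rewrite indicE; case: (x \in oc_box n); rewrite ?mulr1 ?mulr0 => h3.
    by apply/andP; split; lra.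
  by apply/andP; split; lra.
Qed.

Theorem poisson_continuous_L2 G : G \in Lfun leb2_sf 2%:E -> poisson_continuous G.
Proof.
move=> /Lfun2P[mG G2].
have split_norm (h : R2 -> R) : measurable_fun setT h -> (forall x, 0 <= h x) ->
    (forall x, `|h x| <= 1 * `|G x|) -> poisson_continuous h.
  move=> mh h0 hG; apply: poisson_continuous_ge0 => //.
  by apply: le_lt_trans (le_nsq ler01 mh mG (aeW _ hG)) _; rewrite expr1n mul1e.
pose P x := Num.max (G x) 0; pose N x := Num.max (- G x) 0.
have mP : measurable_fun setT P by exact: measurable_maxr.
have mN : measurable_fun setT N by apply: measurable_maxr => //; exact: measurableT_comp.
rewrite (_ : G = fun x => P x - N x); last first.
  by apply/funext => x; rewrite /P /N; case: (leP (G x) 0); case: (leP (- G x) 0); lra.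
have G_norm x := ler_norm (G x).
have G_normN x : - G x <= `|G x| by rewrite -normrN ler_norm.
apply: poisson_continuousB => //; apply: split_norm => // x.
- by rewrite le_max lexx orbT.
- by rewrite mul1r ger0_norm ?le_max ?lexx ?orbT// ge_max G_norm normr_ge0.
- by rewrite le_max lexx orbT.
- by rewrite mul1r ger0_norm ?le_max ?lexx ?orbT// ge_max G_normN normr_ge0.
Qed.

End poisson_continuity_L2.

(** * Removing the regularisation *)

Section plancherel.
Context {R : realType}.
Local Notation R2 := (measurableTypeR R * measurableTypeR R)%type.
Local Notation leb2_sf := (@leb2_sf R).
Local Notation leb4 := (product_measure1 leb2_sf leb2_sf).
Local Notation eps := (@eps R).

Lemma cvg_expabs2 (xi : R2) : expabs2 (eps k) xi @[k --> \oo] --> (1 : R).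
Proof.
have H (x : R) : expabs (eps k) x @[k --> \oo] --> (1 : R).
  rewrite /expabs -expR0; apply: (@cvg_comp _ _ _ (fun k => - eps k * `|x|) expR _ (nbhs (0 : R))).
    rewrite -(mul0r `|x|); apply: cvgM; last exact: cvg_cst.
    by rewrite -oppr0; apply: cvgN; exact: cvg_harmonic.
  exact: continuous_expR.
by rewrite -[X in _ --> X]mulr1; apply: cvgM; exact: H.
Qed.

Lemma expabs2_nd (xi : R2) m n : (m <= n)%N -> expabs2 (eps m) xi <= expabs2 (eps n) xi.
Proof.
move=> mn.
have H (x : R) : expabs (eps m) x <= expabs (eps n) x.
  rewrite /expabs ler_expR !mulNr lerN2 ler_wpM2r//.
  by rewrite lef_pV2 ?posrE ?ltr0n// ler_nat.
by rewrite /expabs2 ler_pM// ltW// expabs_gt0.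
Qed.

(** The weights increase to [1], so by monotone convergence the weighted energies tend to the full
    energy, finite or not. The other side of the identity computes the same limit, as the defect
    [pdist] vanishes. *)
Theorem plancherel_L1 (G : R2 -> R) : G \in Lfun leb2_sf 2%:E ->
  leb2_sf.-integrable setT (EFin \o G) ->
  (nsq leb2_sf (cos_transform G) + nsq leb2_sf (sin_transform G) =
   ((2 * pi) ^+ 2)%:E * nsq leb2_sf G)%E.
Proof.
move=> L2G intG; have /Lfun2P[mG G2] := L2G.
have mA := measurable_cos_transform intG; have mB := measurable_sin_transform intG.
set A := cos_transform G in mA *; set B := sin_transform G in mB *.
have -> : (nsq leb2_sf A + nsq leb2_sf B = \int[leb2_sf]_xi (A xi ^+ 2 + B xi ^+ 2)%:E)%E.
  rewrite /nsq -ge0_integralD//.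
  - by move=> x _; rewrite lee_fin sqr_ge0.
  - exact: measurable_sqrE.
  - by move=> x _; rewrite lee_fin sqr_ge0.
  - exact: measurable_sqrE.
have AB0 xi : 0 <= A xi ^+ 2 + B xi ^+ 2 by rewrite addr_ge0 ?sqr_ge0.
pose g k (xi : R2) := (expabs2 (eps k) xi * (A xi ^+ 2 + B xi ^+ 2))%:E.
have glim : (\int[leb2_sf]_xi g k xi @[k --> \oo] --> \int[leb2_sf]_xi (A xi ^+ 2 + B xi ^+ 2)%:E)%E.
  rewrite (_ : (\int[leb2_sf]_xi (A xi ^+ 2 + B xi ^+ 2)%:E)%E =
    (\int[leb2_sf]_xi limn (g ^~ xi))%E); last first.
    apply: eq_integral => xi _; apply/esym/cvg_lim => //.
    apply/cvg_EFin; first exact: nearW.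
    rewrite -[X in _ --> X]mul1r; apply: cvgM; last exact: cvg_cst.
    exact: cvg_expabs2.
  apply: cvg_monotone_convergence => //.
  - move=> k; apply/measurable_EFinP; apply: measurable_funM; first exact: measurable_expabs2.
    by apply: measurable_funD; exact: measurable_funX.
  - by move=> k xi _; rewrite lee_fin mulr_ge0// ltW// expabs2_gt0.
  - by move=> xi _ m n mn; rewrite lee_fin ler_wpM2r// expabs2_nd.
have [r rE] : exists r, nsq leb2_sf G = r%:E.
  by exists (fine (nsq leb2_sf G)); rewrite fineK// ge0_fin_numE// nsq_ge0.
have qE k : (\int[leb2_sf]_xi g k xi =
    ((2 * pi) ^+ 2 * r)%:E - (2^-1)%:E * pdist (eps k) G)%E.
  rewrite integral_weighted_transforms ?eps_gt0//.
  have := integrable_fin_num measurableT (integrable_quadratic_poisson (eps_gt0 k) intG).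
  have := pdist_identity (eps_gt0 k) L2G intG; rewrite rE.
  set q := (\int[leb4]_z _)%E => + /fineK qfin; rewrite -qfin -!EFinM.
  case: (pdist _ _) => [p||]//; rewrite -EFinD => -[h]; rewrite -EFinM -EFinB; congr EFin.
  by lra.
have qlim : (\int[leb2_sf]_xi g k xi @[k --> \oo] --> ((2 * pi) ^+ 2 * r)%:E)%E.
  rewrite (_ : (fun k => _) = fun k =>
    ((2 * pi) ^+ 2 * r)%:E - (2^-1)%:E * pdist (eps k) G)%E; last first.
    by apply/funext => k; exact: qE.
  rewrite -[X in _ --> X]sube0 -[X in (_ - X)%E](mule0 (2^-1)%:E).
  apply: cvgeB => //; first exact: cvg_cst.
  by apply: cvgeZl => //; exact: poisson_continuous_L2.
by rewrite rE -EFinM; exact: (cvg_unique _ glim qlim).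
Qed.

End plancherel.

(** * The L^2 Fourier transform *)

Section fourier_truncations.
Context {R : realType}.
Local Notation leb := (@lebesgue_measure R).
Local Notation R2 := (measurableTypeR R * measurableTypeR R)%type.
Local Notation mu := (@leb2_sf R).
Implicit Types (f g : R2 -> R).

Definition trunc (n : nat) f : R2 -> R := fun x => \1_(box n) x * f x.

Lemma measurable_box n : measurable (box n : set R2).
Proof. by apply: measurableX; exact: measurable_itv. Qed.

Lemma box_lty n : (mu (box n) < +oo)%E.
Proof.
have H : (leb `[(- n%:R)%R, (n%:R)%R]%classic < +oo)%E.
  by rewrite lebesgue_measure_itv/=; case: ifP => _; rewrite ?ltry// -EFinD ltry.
rewrite [mu _]product_measure1E//.
by rewrite lte_mul_pinfty// ge0_fin_numE.
Qed.

Lemma measurable_trunc n f : measurable_fun setT f -> measurable_fun setT (trunc n f).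
Proof.
move=> mf; apply: measurable_funM => //; apply: measurable_indic; exact: measurable_box.
Qed.

Lemma trunc_le n f x : `|trunc n f x| <= 1 * `|f x|.
Proof.
rewrite /trunc normrM ler_wpM2r// indicE; case: (_ \in _); rewrite ?normr1 ?normr0//.
Qed.

Lemma L2_trunc n f : f \in Lfun mu 2%:E -> trunc n f \in Lfun mu 2%:E.
Proof.
move=> /Lfun2P[mf f2]; apply/Lfun2P; split; first exact: measurable_trunc.
apply: le_lt_trans (le_nsq ler01 (measurable_trunc n mf) mf (aeW _ (trunc_le n f))) _.
by rewrite expr1n mul1e.
Qed.

(** A box has finite measure and [|f| <= 1 + f ^+ 2], so truncations of L^2 functions are in L^1,
    where [plancherel_L1] applies. *)
Lemma integrable_trunc n f : f \in Lfun mu 2%:E -> mu.-integrable setT (EFin \o trunc n f).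
Proof.
move=> f2; have /Lfun2P[mf _] := f2.
have := Lfun2_integrable_sqr f2.
have : mu.-integrable setT (EFin \o (\1_(box n) : R2 -> R)).
  have mb := measurable_box n.
  apply/integrableP; split; first by apply/measurable_EFinP; exact: measurable_indic.
  under eq_integral => x _ do rewrite /= ger0_norm ?indicE//.
  by rewrite integral_indic// setIT box_lty.
move=> i1 i2; apply: le_integrable (integrableD measurableT i1 i2) => //.
  by apply/measurable_EFinP; exact: measurable_trunc.
move=> x _ /=; rewrite lee_fin /trunc.
have h : 0 <= (\1_(box n) x : R) by rewrite indicE.
rewrite [leRHS]ger0_norm ?addr_ge0 ?sqr_ge0//.
rewrite normrM (ger0_norm h) indicE; case: (_ \in _); rewrite ?mul1r ?mul0r ?add0r ?sqr_ge0//=.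
rewrite -[f x ^+ 2]real_normK ?num_real//.
by have := sqr_ge0 (`|f x| - 1); have := normr_ge0 (f x); nra.
Qed.

Lemma cvg_trunc f : f \in Lfun mu 2%:E ->
  (nsq mu (fun x => trunc n f x - f x)%R @[n --> \oo] --> 0)%E.
Proof.
move=> /Lfun2P[mf f2].
apply: (nsq_dominated (g := f)) => //; first by move=> n; exact: measurable_trunc.
- move=> x; rewrite -[X in _ --> X]mul1r; apply: cvgM; last exact: cvg_cst.
  apply: cvg_near_cst; near=> n; rewrite indicE mem_set// /box /= !in_itv/= -!ler_norml.
  have : `|x.1| + `|x.2| <= n%:R by near: n; exact: nbhs_infty_ger.
  have := normr_ge0 x.1; have := normr_ge0 x.2.
  by move=> *; split; lra.
- move=> n x; rewrite /trunc indicE; case: (_ \in _); rewrite ?mul1r ?subrr ?normr0//.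
  by rewrite mul0r sub0r normrN.
Unshelve. all: by end_near. Qed.

Lemma trunc_lin n (a b : R) f g :
  trunc n (fun x => a * f x + b * g x) = (fun x => a * trunc n f x + b * trunc n g x).
Proof. by apply/funext => x; rewrite /trunc; ring. Qed.

Lemma integrable_cos_dot G xi : mu.-integrable setT (EFin \o G) ->
  mu.-integrable setT (fun x => (G x * cos (dot x xi))%:E).
Proof. by move=> iG; exact: (integrable_transform iG measurable_cos_dot (fun z => norm_cos_le1 _)). Qed.

Lemma integrable_sin_dot G xi : mu.-integrable setT (EFin \o G) ->
  mu.-integrable setT (fun x => (G x * sin (dot x xi))%:E).
Proof. by move=> iG; exact: (integrable_transform iG measurable_sin_dot (fun z => norm_sin_le1 _)). Qed.

Lemma Rintegral_lin (a b : R) (F G : R2 -> R) :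
  mu.-integrable setT (EFin \o F) -> mu.-integrable setT (EFin \o G) ->
  \int[mu]_x (a * F x + b * G x) = a * \int[mu]_x F x + b * \int[mu]_x G x.
Proof.
move=> iF iG; rewrite -!RintegralZl// -RintegralD//.
  exact: (integrableZl measurableT a iF).
exact: (integrableZl measurableT b iG).
Qed.

Lemma cos_transform_lin (a b : R) F G xi :
  mu.-integrable setT (EFin \o F) -> mu.-integrable setT (EFin \o G) ->
  cos_transform (fun x => a * F x + b * G x) xi = a * cos_transform F xi + b * cos_transform G xi.
Proof.
move=> iF iG; rewrite /cos_transform -Rintegral_lin; [|exact: integrable_cos_dot|exact: integrable_cos_dot].
by apply: eq_Rintegral => x _; ring.
Qed.

Lemma sin_transform_lin (a b : R) F G xi :
  mu.-integrable setT (EFin \o F) -> mu.-integrable setT (EFin \o G) ->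
  sin_transform (fun x => a * F x + b * G x) xi = a * sin_transform F xi + b * sin_transform G xi.
Proof.
move=> iF iG; rewrite /sin_transform -Rintegral_lin; [|exact: integrable_sin_dot|exact: integrable_sin_dot].
by apply: eq_Rintegral => x _; ring.
Qed.

(* [true] and [false] select the real and the imaginary part of the transform. *)
Definition box_part (b : bool) (n : nat) f (xi : R2) : R :=
  if b then (2 * pi)^-1 * cos_transform (trunc n f) xi
  else - ((2 * pi)^-1 * sin_transform (trunc n f) xi).

Definition cpart (b : bool) (z : R[i]) : R :=
  if b then complex.Re z else complex.Im z.

Lemma cpart_fourier_box b n f xi : cpart b (fourier_box n f xi) = box_part b n f xi.
Proof.
have E (h : R -> R) : \int[leb2]_(x in box n) (f x * h (dot x xi)) =
    \int[mu]_x (trunc n f x * h (dot x xi)).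
  rewrite Rintegral_mkcond; apply: eq_Rintegral => x _.
  by rewrite /patch /trunc indicE; case: (_ \in _); rewrite ?mul1r ?mul0r.
rewrite /fourier_box /box_part /cpart /cos_transform /sin_transform.
case: b => /=; rewrite ?mul0r ?subr0 ?addr0 ?mulrN.
  by rewrite (E cos).
by rewrite (E sin).
Qed.

Lemma measurable_box_part b n f : f \in Lfun mu 2%:E -> measurable_fun setT (box_part b n f).
Proof.
move=> f2; have i := integrable_trunc n f2.
rewrite /box_part; case: b; first by apply: measurable_funM => //; exact: measurable_cos_transform.
apply: measurableT_comp => //.
by apply: measurable_funM => //; exact: measurable_sin_transform.
Qed.

Lemma box_part_lin b n (a c : R) f g : f \in Lfun mu 2%:E -> g \in Lfun mu 2%:E ->
  box_part b n (fun x => a * f x + c * g x) = fun xi => a * box_part b n f xi + c * box_part b n g xi.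
Proof.
move=> f2 g2; apply/funext => xi.
have i1 := integrable_trunc n f2; have i2 := integrable_trunc n g2.
rewrite /box_part trunc_lin; case: b.
  by rewrite cos_transform_lin//; ring.
by rewrite sin_transform_lin//; ring.
Qed.

(** This makes the truncated transforms Cauchy in L^2, because the truncations themselves are. *)
Lemma box_part_plancherel n m f : f \in Lfun mu 2%:E ->
  (nsq mu (fun xi => box_part true n f xi - box_part true m f xi)%R +
   nsq mu (fun xi => box_part false n f xi - box_part false m f xi)%R =
   nsq mu (fun x => trunc n f x - trunc m f x)%R)%E.
Proof.
move=> f2; pose G x := 1 * trunc n f x + (-1) * trunc m f x.
have GE : G = fun x => trunc n f x - trunc m f x by apply/funext => x; rewrite /G; ring.
have in_ := integrable_trunc n f2; have im := integrable_trunc m f2.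
have G2 : G \in Lfun mu 2%:E.
  have /Lfun2P[mn n2] := L2_trunc n f2; have /Lfun2P[mm m2] := L2_trunc m f2.
  rewrite GE; apply/Lfun2P; split; first exact: measurable_funB.
  rewrite (le_lt_trans (nsqB_le mu mn mm))//.
  by rewrite lte_add_pinfty// lte_mul_pinfty.
have iG : mu.-integrable setT (EFin \o G).
  rewrite GE; exact: (integrableB measurableT in_ im).
have /Lfun2P[mG _] := G2.
have := plancherel_L1 G2 iG; rewrite -GE => /esym H.
have c0 : (2 * pi : R) != 0 by rewrite mulf_neq0// gt_eqF// pi_gt0.
have -> : nsq mu G = (((2 * pi)^-1 ^+ 2)%:E * (nsq mu (cos_transform G) + nsq mu (sin_transform G)))%E.
  by rewrite -H muleA -EFinM -exprMn mulVf// expr1n mul1e.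
rewrite ge0_muleDr ?nsq_ge0//; congr (_ + _)%E; rewrite -nsqZ.
- by congr nsq; apply/funext => xi; rewrite /box_part cos_transform_lin//; ring.
- exact: measurable_cos_transform.
- rewrite -nsqN; congr nsq; apply/funext => xi; rewrite /box_part sin_transform_lin//; ring.
- exact: measurable_sin_transform.
Qed.

Lemma box_part_norm n f : f \in Lfun mu 2%:E ->
  (nsq mu (box_part true n f) + nsq mu (box_part false n f) = nsq mu (trunc n f))%E.
Proof.
move=> f2; have i := integrable_trunc n f2.
have := plancherel_L1 (L2_trunc n f2) i => /esym H.
have c0 : (2 * pi : R) != 0 by rewrite mulf_neq0// gt_eqF// pi_gt0.
have -> : nsq mu (trunc n f) = (((2 * pi)^-1 ^+ 2)%:E *
    (nsq mu (cos_transform (trunc n f)) + nsq mu (sin_transform (trunc n f))))%E.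
  by rewrite -H muleA -EFinM -exprMn mulVf// expr1n mul1e.
rewrite ge0_muleDr ?nsq_ge0//; congr (_ + _)%E; rewrite -nsqZ.
- by [].
- exact: measurable_cos_transform.
- by rewrite -nsqN; congr nsq; apply/funext => xi; rewrite /box_part opprK.
- exact: measurable_sin_transform.
Qed.

End fourier_truncations.

Section cvge0_combinations.
Context {R : realType} {I : Type} {F : set_system I} {FF : Filter F}.
Local Open Scope ereal_scope.
Implicit Types u v : I -> \bar R.

Lemma cvge0D u v : u i @[i --> F] --> 0 -> v i @[i --> F] --> 0 ->
  u i + v i @[i --> F] --> 0.
Proof. by move=> u0 v0; rewrite -[X in _ --> X]adde0; apply: cvgeD. Qed.

Lemma cvge0Z (a : R) u : u i @[i --> F] --> 0 -> a%:E * u i @[i --> F] --> 0.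
Proof. by move=> u0; rewrite -(mule0 a%:E); apply: cvgeZl. Qed.

End cvge0_combinations.

(** * Norms and uniqueness of L^2 limits *)

Section nsq_limits.
Context d (T : measurableType d) (R : realType) (mu : {measure set T -> \bar R}).
Local Open Scope ereal_scope.
Implicit Types f g : T -> R.
Local Notation nrm f := ('N[mu]_2%:E[EFin \o f]).

Lemma Lnorm2_lty f : nsq mu f < +oo -> nrm f < +oo.
Proof.
rewrite -Lnorm2_sqr; have := Lnorm_ge0 mu 2%:E (EFin \o f).
by case: (nrm f) => [r||]//; rewrite ?ltry// expe2 mulyy.
Qed.

Lemma Lnorm2D f g : measurable_fun setT f -> measurable_fun setT g ->
  nrm (fun x => f x + g x)%R <= nrm f + nrm g.
Proof. by move=> mf mg; apply: minkowski_EFin => //; exact: (lee1n 2). Qed.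

Lemma Lnorm2_distC f g : nrm (fun x => f x - g x)%R = nrm (fun x => g x - f x)%R.
Proof.
rewrite unlock; congr (_ `^ _); apply: eq_integral => x _ /=.
by rewrite -normrN opprB.
Qed.

(** The inequality [nsqD_le] loses a factor [2] and cannot give convergence of norms. Minkowski's
    inequality is used instead, and the result is squared at the end. *)
Lemma cvg_nsq {I : Type} {F : set_system I} {FF : ProperFilter F} (f : I -> T -> R) g :
  (forall i, measurable_fun setT (f i)) -> measurable_fun setT g -> nsq mu g < +oo ->
  nsq mu (fun x => f i x - g x)%R @[i --> F] --> 0 -> nsq mu (f i) @[i --> F] --> nsq mu g.
Proof.
move=> mf mg g2 fg.
have gfin : nrm g \is a fin_num by rewrite ge0_fin_numE ?Lnorm_ge0// Lnorm2_lty.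
have d0 : nrm (fun x => f i x - g x)%R @[i --> F] --> 0.
  apply/cvge_sqr0; first by move=> i; exact: Lnorm_ge0.
  by under eq_fun do rewrite Lnorm2_sqr.
have nf : nrm (f i) @[i --> F] --> nrm g.
  apply: (@squeeze_cvge _ _ _ _ (fun i => nrm g - nrm (fun x => f i x - g x)%R)
     _ (fun i => nrm g + nrm (fun x => f i x - g x)%R)).
  - apply: nearW => i; apply/andP; split.
      have := @Lnorm2D (fun x => g x - f i x)%R (f i).
      move=> /(_ (measurable_funB mg (mf i)) (mf i)).
      rewrite (_ : (fun x => g x - f i x + f i x)%R = g); last by apply/funext => x; rewrite subrK.
      rewrite [X in _ -> _ - X <= _]Lnorm2_distC.
      have := Lnorm_ge0 mu 2%:E (EFin \o (fun x => g x - f i x)%R).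
      case: (Lnorm _ _ (EFin \o (fun x => g x - f i x)%R)) => [r||]// _ H.
        by rewrite leeBlDr// addeC.
      by rewrite -(fineK gfin) /= leNye.
    have := @Lnorm2D g (fun x => f i x - g x)%R mg (measurable_funB (mf i) mg).
    by rewrite (_ : (fun x => _ + _)%R = f i)//; apply/funext => x; rewrite addrC subrK.
  - rewrite -[X in _ --> X]sube0; apply: (cvgeB _ (cvg_cst (nrm g)) d0).
    by rewrite fin_num_adde_defl.
  - rewrite -[X in _ --> X]adde0; apply: (cvgeD _ (cvg_cst (nrm g)) d0).
    by rewrite fin_num_adde_defl.
under eq_fun do rewrite -Lnorm2_sqr expe2.
rewrite -Lnorm2_sqr expe2; apply: cvgeM => //.
by rewrite mule_def_fin.
Qed.

Lemma nsq_eq0 f : measurable_fun setT f -> nsq mu f = 0 -> {ae mu, forall x, f x = 0%R}.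
Proof.
move=> mf; rewrite /nsq => f0.
have := (ae_eq_integral_abs mu measurableT (measurable_sqrE mf)).1.
rewrite (_ : \int[mu]_x _ = 0); last first.
  by rewrite -[RHS]f0; apply: eq_integral => x _; rewrite /= ger0_norm// sqr_ge0.
move=> /(_ erefl); apply: filterS => x /(_ I)[] /eqP.
by rewrite sqrf_eq0 => /eqP.
Qed.

Lemma nsq_limit_unique {I : Type} {F : set_system I} {FF : ProperFilter F}
    (f : I -> T -> R) (g h : T -> R) :
  (forall i, measurable_fun setT (f i)) -> measurable_fun setT g -> measurable_fun setT h ->
  nsq mu (fun x => f i x - g x)%R @[i --> F] --> 0 ->
  nsq mu (fun x => f i x - h x)%R @[i --> F] --> 0 ->
  {ae mu, forall x, g x = h x}.
Proof.
move=> mf mg mh fg fh.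
have mgh : measurable_fun setT (fun x => g x - h x)%R by exact: measurable_funB.
suff : nsq mu (fun x => g x - h x)%R = 0.
  by move=> /(nsq_eq0 mgh); apply: filterS => x /eqP; rewrite subr_eq0 => /eqP.
apply/eqP; rewrite eq_le nsq_ge0 andbT.
have lim0 : 2%:E * nsq mu (fun x => f i x - g x)%R + 2%:E * nsq mu (fun x => f i x - h x)%R
    @[i --> F] --> 0.
  rewrite -[X in _ --> X]adde0 -[X in (X + _)%E](mule0 2%:E) -[X in (_ + X)%E](mule0 2%:E).
  by apply: cvgeD => //; apply: cvgeZl.
suff /(cvg_unique _ (cvg_cst _)) -> :
    cst (nsq mu (fun x => g x - h x)%R) i @[i --> F] --> 0 by [].
apply: cvge0_le lim0; first by move=> i; exact: nsq_ge0.
apply: nearW => i; rewrite /= (nsq_distC _ (f i) g).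
apply: le_trans (nsqD_le mu (measurable_funB mg (mf i)) (measurable_funB (mf i) mh)).
rewrite (_ : (fun x => _ + _)%R = (fun x => g x - h x)%R)//.
by apply/funext => x; rewrite addrA subrK.
Qed.

End nsq_limits.

(** * Existence, isometry and linearity of the transform *)

Section fourier_transform.
Context {R : realType}.
Local Notation R2 := (measurableTypeR R * measurableTypeR R)%type.
Local Notation mu := (@leb2_sf R).
Implicit Types (f g : R2 -> R).

Lemma cabs_sqr (z : R[i]) : cabs z ^+ 2 = cpart true z ^+ 2 + cpart false z ^+ 2.
Proof. by rewrite /cabs sqr_sqrtr// addr_ge0 ?sqr_ge0. Qed.

Lemma cpartB b (z w : R[i]) : cpart b (z - w) = cpart b z - cpart b w.
Proof. by case: b; case: z => ? ?; case: w. Qed.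

Lemma L2norm_cabs_sqr (F : R2 -> R[i]) :
  (forall b, measurable_fun setT (fun xi => cpart b (F xi))) ->
  (L2norm (fun xi => cabs (F xi)) ^+ 2 =
   nsq mu (fun xi => cpart true (F xi)) + nsq mu (fun xi => cpart false (F xi)))%E.
Proof.
move=> mF; rewrite /L2norm [LHS]Lnorm2_sqr.
exact: (nsq_add_sqr mu (mF true) (mF false) (fun xi => cabs_sqr (F xi))).
Qed.

Lemma L2norm_ge0 (h : R * R -> R) : (0 <= L2norm h)%E.
Proof. exact: Lnorm_ge0. Qed.

(** The real and imaginary parts separate, so that the theory of real L^2 functions applies to each,
    with [b] selecting the part. *)
Lemma is_fourierP f (F : R2 -> R[i]) : f \in Lfun mu 2%:E ->
  is_fourier f F <-> forall b,
    [/\ measurable_fun setT (fun xi => cpart b (F xi)),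
        (nsq mu (fun xi => cpart b (F xi)) < +oo)%E &
        (nsq mu (fun xi => box_part b n f xi - cpart b (F xi))%R @[n --> \oo] --> 0)%E].
Proof.
move=> f2.
have mb b n := measurable_box_part b n f2.
have mD b n : measurable_fun setT (fun xi => cpart b (F xi)) ->
    measurable_fun setT (fun xi => box_part b n f xi - cpart b (F xi)).
  by move=> mF; exact: measurable_funB.
have E n : (forall b, measurable_fun setT (fun xi => cpart b (F xi))) ->
   (L2norm (fun xi => cabs (fourier_box n f xi - F xi)%R) ^+ 2 =
    nsq mu (fun xi => box_part true n f xi - cpart true (F xi))%R +
    nsq mu (fun xi => box_part false n f xi - cpart false (F xi))%R)%E.
  move=> mF; rewrite L2norm_cabs_sqr; last first.
    move=> b; rewrite (_ : (fun xi => _) = (fun xi => box_part b n f xi - cpart b (F xi))); first exact: mD.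
    by apply/funext => xi; rewrite cpartB cpart_fourier_box.
  by congr (_ + _)%E; apply: eq_integral => xi _; rewrite cpartB cpart_fourier_box.
split.
  move=> [mR mI F2 FB].
  have mF b : measurable_fun setT (fun xi => cpart b (F xi)) by case: b.
  have F2' : (L2norm (fun xi => cabs (F xi)) ^+ 2 < +oo)%E.
    by rewrite expe2 lte_mul_pinfty ?L2norm_ge0// ge0_fin_numE// L2norm_ge0.
  rewrite L2norm_cabs_sqr// in F2'.
  have := (cvge_sqr0 (fun n => L2norm_ge0 (fun xi => cabs (fourier_box n f xi - F xi)))).2 FB.
  under eq_fun do rewrite E//.
  move=> /(_ eventually_filter) S0; case; split => //.
  - by rewrite (le_lt_trans _ F2')// leeDl// nsq_ge0.
  - apply: (@cvge0_le _ _ _ _ _ (fun n =>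
        nsq mu (fun xi => box_part true n f xi - cpart true (F xi))%R +
        nsq mu (fun xi => box_part false n f xi - cpart false (F xi))%R)%E _ _ S0).
      by move=> n; exact: nsq_ge0.
    by apply: nearW => n; rewrite leeDl// nsq_ge0.
  - by rewrite (le_lt_trans _ F2')// leeDr// nsq_ge0.
  - apply: (@cvge0_le _ _ _ _ _ (fun n =>
        nsq mu (fun xi => box_part true n f xi - cpart true (F xi))%R +
        nsq mu (fun xi => box_part false n f xi - cpart false (F xi))%R)%E _ _ S0).
      by move=> n; exact: nsq_ge0.
    by apply: nearW => n; rewrite leeDr// nsq_ge0.
move=> H.
have mF b : measurable_fun setT (fun xi => cpart b (F xi)) by have [] := H b.
split; [exact: (mF true)|exact: (mF false)| |].
- apply: Lnorm2_lty; rewrite -Lnorm2_sqr [X in (X < _)%E](L2norm_cabs_sqr mF).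
  by have [_ h1 _] := H true; have [_ h2 _] := H false; rewrite lte_add_pinfty.
- apply/cvge_sqr0; first by move=> n; exact: L2norm_ge0.
  under eq_fun do rewrite E//.
  have [_ _ l1] := H true; have [_ _ l2] := H false.
  exact: cvge0D l1 l2.
Qed.

Lemma is_fourier_ex f : f \in Lfun mu 2%:E -> exists F, is_fourier f F.
Proof.
move=> f2.
have mt n := proj1 ((Lfun2P _ _).1 (L2_trunc n f2)).
have [mf ffin] := (Lfun2P _ _).1 f2.
have H b : exists g : R2 -> R, measurable_fun setT g /\
    (nsq mu (fun xi => box_part b n f xi - g xi)%R @[n --> \oo] --> 0)%E.
  apply: L2_complete; first by move=> n; exact: measurable_box_part.
  move=> e e0.
  have e4 : 0 < e / 4 by rewrite divr_gt0.
  have /cvge0P/(_ _ e4) := cvg_trunc f2.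
  move=> /(_ (fun n => nsq_ge0 _ _)) [N _ HN].
  exists N => m n Nm Nn.
  apply: (@le_trans _ _ (nsq mu (fun x => trunc m f x - trunc n f x)%R)).
    by rewrite -box_part_plancherel//; case: b; rewrite ?leeDl ?leeDr// nsq_ge0.
  rewrite (_ : (fun x => _) = (fun x => (trunc m f x - f x) - (trunc n f x - f x))); last first.
    by apply/funext => x; ring.
  apply: le_trans (nsqB_le mu (measurable_funB (mt m) mf) (measurable_funB (mt n) mf)) _.
  rewrite (_ : e%:E = (2%:E * (e / 4)%:E + 2%:E * (e / 4)%:E)%E); last first.
    by rewrite -!EFinM -EFinD; congr EFin; field.
  by apply: leeD; apply: lee_wpmul2l => //; apply: ltW; exact: HN.
have [gt [mgt gtl]] := H true; have [gf [mgf gfl]] := H false.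
exists (fun xi => Complex (gt xi) (gf xi)); apply/is_fourierP => //.
have fin b n : (nsq mu (box_part b n f) < +oo)%E.
  have /Lfun2P[_ t2] := L2_trunc n f2.
  apply: le_lt_trans t2; rewrite -box_part_norm//.
  by case: b; rewrite ?leeDl ?leeDr// nsq_ge0.
have lim_fin b g : measurable_fun setT g ->
    (nsq mu (fun xi => box_part b n f xi - g xi)%R @[n --> \oo] --> 0)%E -> (nsq mu g < +oo)%E.
  move=> mg /cvge0P/(_ _ ltr01).
  move=> /(_ (fun n => nsq_ge0 _ _)) [N _ /(_ N (leqnn N))/= HN].
  have mbN := measurable_box_part b N f2.
  have := nsqB_le mu mbN (measurable_funB mbN mg).
  rewrite (_ : (fun x => _) = g); last by apply/funext => x; rewrite opprB addrC subrK.
  move=> /le_lt_trans; apply.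
  rewrite lte_add_pinfty// lte_mul_pinfty//.
  by rewrite (lt_trans HN)// ltry.
case; split => //=; [exact: (lim_fin true)|exact: (lim_fin false)].
Qed.

Lemma fourierP f : f \in Lfun mu 2%:E -> is_fourier f (fourier f).
Proof.
move=> f2; rewrite /fourier; case: xgetP => [F -> //|H].
by have [F HF] := is_fourier_ex f2; have := H F.
Qed.

Definition fpart (b : bool) f (xi : R2) : R := cpart b (fourier f xi).

Lemma measurable_fpart b f : f \in Lfun mu 2%:E -> measurable_fun setT (fpart b f).
Proof. by move=> f2; have [] := (is_fourierP _ f2).1 (fourierP f2) b. Qed.

Theorem plancherel f : f \in Lfun mu 2%:E ->
  (nsq mu (fpart true f) + nsq mu (fpart false f) = nsq mu f)%E.
Proof.
move=> f2.
have H b := (is_fourierP _ f2).1 (fourierP f2) b.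
have mt n := proj1 ((Lfun2P _ _).1 (L2_trunc n f2)).
have [mf ffin] := (Lfun2P _ _).1 f2.
have L b : (nsq mu (box_part b n f) @[n --> \oo] --> nsq mu (fpart b f))%E.
  have [mF F2 lF] := H b.
  by apply: cvg_nsq => // n; exact: measurable_box_part.
have L1 : (nsq mu (trunc n f) @[n --> \oo] --> nsq mu f)%E.
  by apply: cvg_nsq => //; exact: cvg_trunc.
have L2 : (nsq mu (trunc n f) @[n --> \oo] --> nsq mu (fpart true f) + nsq mu (fpart false f))%E.
  under eq_fun do rewrite -box_part_norm//.
  by apply: cvgeD => //; rewrite ge0_adde_def// inE nsq_ge0.
exact: (cvg_unique _ L2 L1).
Qed.

Lemma L2_fpart b f : f \in Lfun mu 2%:E -> fpart b f \in Lfun mu 2%:E.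
Proof.
move=> f2; apply/Lfun2P; split; first exact: measurable_fpart.
by have [] := (is_fourierP _ f2).1 (fourierP f2) b.
Qed.

Lemma L2_lin (a c : R) f g : f \in Lfun mu 2%:E -> g \in Lfun mu 2%:E ->
  (fun x => a * f x + c * g x) \in Lfun mu 2%:E.
Proof.
move=> /Lfun2P[mf f2] /Lfun2P[mg g2].
have maf : measurable_fun setT (fun x => a * f x) by exact: measurable_funM.
have mcg : measurable_fun setT (fun x => c * g x) by exact: measurable_funM.
apply/Lfun2P; split; first exact: measurable_funD.
rewrite (le_lt_trans (nsqD_le mu maf mcg))// !nsqZ// !muleA.
by rewrite lte_add_pinfty// lte_mul_pinfty// -EFinM lee_fin mulr_ge0// sqr_ge0.
Qed.

(** [fourier] is a chosen representative, so linearity can hold only almost everywhere; it comes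
    from the linearity of the truncated integrals and the uniqueness of L^2 limits. *)
Lemma fpart_lin b (a c : R) f g : f \in Lfun mu 2%:E -> g \in Lfun mu 2%:E ->
  {ae mu, forall xi, fpart b (fun x => a * f x + c * g x) xi = a * fpart b f xi + c * fpart b g xi}.
Proof.
move=> f2 g2; have h2 := L2_lin a c f2 g2.
have [mf _ lf] := (is_fourierP _ f2).1 (fourierP f2) b.
have [mg _ lg] := (is_fourierP _ g2).1 (fourierP g2) b.
have [mh _ lh] := (is_fourierP _ h2).1 (fourierP h2) b.
apply: (nsq_limit_unique (f := fun n => box_part b n (fun x => a * f x + c * g x))) lh _ => //.
- by move=> n; exact: measurable_box_part.
- exact: (measurable_funD (measurable_funM (measurable_cst a) (measurable_fpart b f2))
    (measurable_funM (measurable_cst c) (measurable_fpart b g2))).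
have mdf n : measurable_fun setT (fun xi => box_part b n f xi - fpart b f xi).
  exact: (measurable_funB (measurable_box_part b n f2) (measurable_fpart b f2)).
have mdg n : measurable_fun setT (fun xi => box_part b n g xi - fpart b g xi).
  exact: (measurable_funB (measurable_box_part b n g2) (measurable_fpart b g2)).
apply: (@cvge0_le _ _ _ _ _ (fun n =>
    2%:E * ((a ^+ 2)%:E * nsq mu (fun xi => box_part b n f xi - fpart b f xi)%R) +
    2%:E * ((c ^+ 2)%:E * nsq mu (fun xi => box_part b n g xi - fpart b g xi)%R)))%E.
- by move=> n; exact: nsq_ge0.
- apply: nearW => n; rewrite -!nsqZ//.
  apply: le_trans (nsqD_le mu (measurable_funM (measurable_cst a) (mdf n))
     (measurable_funM (measurable_cst c) (mdg n))).
  rewrite le_eqVlt; apply/orP; left; apply/eqP; congr nsq.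
  apply/funext => x; rewrite (box_part_lin b n a c f2 g2) /=.
  move: (box_part b n f x) (box_part b n g x) (fpart b f x) (fpart b g x) => u v w z.
  by ring.
- exact: (cvge0D (cvge0Z 2 (cvge0Z (a ^+ 2) lf)) (cvge0Z 2 (cvge0Z (c ^+ 2) lg))).
Qed.

(** The equality holds everywhere despite the choice of a representative: the truncated integrals of
    [f] and [g] coincide, so both choices are made from the same set of candidates. *)
Lemma eq_ae_fourier f g : measurable_fun setT f -> measurable_fun setT g ->
  {ae mu, forall x, f x = g x} -> fourier f = fourier g.
Proof.
move=> mf mg fg.
have H n (h : R -> R) xi : measurable_fun setT (fun z : R2 * R2 => h (dot z.1 z.2)) ->
    \int[mu]_x (trunc n f x * h (dot x xi)) = \int[mu]_x (trunc n g x * h (dot x xi)).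
  move=> mh; have mhx : measurable_fun setT (fun x : R2 => h (dot x xi)).
    exact: (measurableT_comp mh (pair2_measurable xi)).
  rewrite /Rintegral; congr fine; apply: ae_eq_integral => //.
  - by apply/measurable_EFinP; apply: measurable_funM => //; exact: measurable_trunc.
  - by apply/measurable_EFinP; apply: measurable_funM => //; exact: measurable_trunc.
  - by apply: filterS fg => x fgx _; rewrite /trunc fgx.
have E : fourier_box ^~ f = fourier_box ^~ g.
  apply/funext => n; apply/funext => xi; apply/eqP; rewrite eq_complex.
  have P b : cpart b (fourier_box n f xi) = cpart b (fourier_box n g xi).
    rewrite !cpart_fourier_box /box_part /cos_transform /sin_transform.
    by case: b; rewrite (H _ _ _ measurable_cos_dot, H _ _ _ measurable_sin_dot).
  by have /= -> := P true; have /= -> := P false; rewrite !eqxx.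
rewrite /fourier; congr xget; apply/funext => F; rewrite /is_fourier /=.
rewrite (_ : (fun n => L2norm (fun xi => cabs (fourier_box n f xi - F xi))) =
  (fun n => L2norm (fun xi => cabs (fourier_box n g xi - F xi))))//.
by apply/funext => n; rewrite (congr1 (fun k => k n) E).
Qed.

End fourier_transform.

(** * Time derivatives of curves in L^2 *)

Section fourier_derivatives.
Context {R : realType}.
Local Notation R2 := (measurableTypeR R * measurableTypeR R)%type.
Local Notation mu := (@leb2_sf R).
Implicit Types (f g : R2 -> R) (w : R -> R2 -> R).

Definition time_filter (t : R) : set_system R := within [set h | 0 <= t + h] (0:R)^'.

(** Only a [Filter], not a proper one: for [t < 0] the admissible increments stay away from [0]. *)
Global Instance time_filter_filter t : Filter (time_filter t).
Proof. by rewrite /time_filter; apply: within_filter. Qed.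

Definition quotient w (t h : R) : R2 -> R := fun x => h^-1 * (w (t + h) x - w t x).

Definition nsq_derivative w (t : R) g : Prop :=
  (nsq mu (fun x => quotient w t h x - g x)%R @[h --> time_filter t] --> 0)%E.

Lemma time_derivativeE w t g : time_derivative w t g <->
  (g \in Lfun mu 2%:E /\ nsq_derivative w t g).
Proof.
have H := cvge_sqr0 (FF := time_filter_filter t)
  (fun h => L2norm_ge0 (fun x => h^-1 * (w (t + h) x - w t x) - g x)).
split=> -[g2 D]; split=> //.
  apply: cvg_trans (H.2 D).
  by apply: near_eq_cvg; apply: nearW => h; exact: Lnorm2_sqr.
apply: H.1; apply: cvg_trans D.
by apply: near_eq_cvg; apply: nearW => h; exact/esym/Lnorm2_sqr.
Qed.

Lemma time_filter_ge0 t : \forall h \near time_filter t, 0 <= t + h.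
Proof. by rewrite /time_filter near_withinE; apply: nearW. Qed.

(** Provides admissible increments indexed by the integers, along which completeness can produce a
    limit. *)
Lemma cvg_eps_time_filter t : 0 <= t -> eps n @[n --> \oo] --> time_filter t.
Proof.
move=> t0 A [e /= e0 HA].
have [N _ HN] : \forall n \near \oo, `|0 - eps n| < e.
  by have /cvgrPdist_lt := @cvg_harmonic R; apply.
exists N => // n /= Nn; apply: HA => /=.
- exact: HN.
- by rewrite gt_eqF// eps_gt0.
- by rewrite addr_ge0// ltW// eps_gt0.
Qed.

Lemma L2B f g : f \in Lfun mu 2%:E -> g \in Lfun mu 2%:E -> (fun x => f x - g x) \in Lfun mu 2%:E.
Proof.
move=> f2 g2; have := L2_lin 1 (-1) f2 g2.
by under eq_fun do rewrite mul1r mulN1r.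
Qed.

Lemma L2Z (c : R) f : f \in Lfun mu 2%:E -> (fun x => c * f x) \in Lfun mu 2%:E.
Proof.
move=> f2; have := L2_lin c 0 f2 f2.
by under eq_fun do rewrite mul0r addr0.
Qed.

Lemma fpartB b f g : f \in Lfun mu 2%:E -> g \in Lfun mu 2%:E ->
  {ae mu, forall xi, fpart b (fun x => f x - g x) xi = fpart b f xi - fpart b g xi}.
Proof.
move=> f2 g2; have := fpart_lin b 1 (-1) f2 g2.
rewrite (_ : (fun x => 1 * f x + -1 * g x) = (fun x => f x - g x)); last first.
  by apply/funext => x; rewrite mul1r mulN1r.
by apply: filterS => xi ->; rewrite mul1r mulN1r.
Qed.

Lemma fpartZ b (c : R) f : f \in Lfun mu 2%:E ->
  {ae mu, forall xi, fpart b (fun x => c * f x) xi = c * fpart b f xi}.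
Proof.
move=> f2; have := fpart_lin b c 0 f2 f2.
rewrite (_ : (fun x => c * f x + 0 * f x) = (fun x => c * f x)); last first.
  by apply/funext => x; rewrite mul0r addr0.
by apply: filterS => xi ->; rewrite mul0r addr0.
Qed.

Lemma fpart_nsq_le b f : f \in Lfun mu 2%:E -> (nsq mu (fpart b f) <= nsq mu f)%E.
Proof.
by move=> f2; rewrite -(plancherel f2); case: b; rewrite ?leeDl ?leeDr// nsq_ge0.
Qed.

Definition fcurve b w : R -> R2 -> R := fun t => fpart b (w t).

Lemma L2_quotient w t h : (forall t, 0 <= t -> w t \in Lfun mu 2%:E) -> 0 <= t -> 0 <= t + h ->
  quotient w t h \in Lfun mu 2%:E.
Proof. by move=> w2 t0 th; apply: L2Z; apply: L2B; exact: w2. Qed.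

Lemma fpart_quotient b w t h : (forall t, 0 <= t -> w t \in Lfun mu 2%:E) -> 0 <= t -> 0 <= t + h ->
  {ae mu, forall xi, fpart b (quotient w t h) xi = quotient (fcurve b w) t h xi}.
Proof.
move=> w2 t0 th.
have := fpartZ b h^-1 (L2B (w2 _ th) (w2 _ t0)); have := fpartB b (w2 _ th) (w2 _ t0).
by apply: filterS2 => xi e1 e2; rewrite [LHS]e2 e1.
Qed.

(** The transform is linear and, part by part, does not increase the norm ([fpart_nsq_le]), hence it
    commutes with the limit of difference quotients. *)
Lemma nsq_derivative_fpart b w t g : (forall t, 0 <= t -> w t \in Lfun mu 2%:E) ->
  g \in Lfun mu 2%:E -> 0 <= t -> nsq_derivative w t g ->
  nsq_derivative (fcurve b w) t (fpart b g).
Proof.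
move=> w2 g2 t0; apply: cvge0_le; first by move=> h; exact: nsq_ge0.
apply: filterS (time_filter_ge0 t) => h th.
have q2 := L2_quotient w2 t0 th.
apply: le_trans (fpart_nsq_le b (L2B q2 g2)).
rewrite le_eqVlt; apply/orP; left; apply/eqP; apply: eq_nsq.
- have /Lfun2P[m1 _] := L2_fpart b (w2 _ th); have /Lfun2P[m2 _] := L2_fpart b (w2 _ t0).
  have /Lfun2P[m3 _] := L2_fpart b g2.
  exact: (measurable_funB (measurable_funM (measurable_cst h^-1) (measurable_funB m1 m2)) m3).
- exact: measurable_fpart (L2B q2 g2).
- have := fpartB b q2 g2; have := fpart_quotient b w2 t0 th.
  by apply: filterS2 => xi e1 e2; rewrite e2 e1.
Qed.

Lemma multiplier_real (m : R2 -> R) f g : multiplier (fun xi => (m xi)%:C%C) f g ->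
  forall b, {ae mu, forall xi, fpart b g xi = m xi * fpart b f xi}.
Proof.
move=> [_ _ H] b.
have {}H : {ae mu, forall xi : R2, fourier g xi = (m xi)%:C%C * fourier f xi} by [].
apply: filterS H => xi; rewrite /fpart => ->.
by case: (fourier f xi) => x y; case: b; rewrite /= ?mul0r ?subr0 ?addr0.
Qed.

Lemma multiplier_L2 (m : R2 -> R[i]) f g : multiplier m f g ->
  f \in Lfun mu 2%:E /\ g \in Lfun mu 2%:E.
Proof. by case. Qed.

Lemma measurable_fcurve_quotient b w t h : (forall t, 0 <= t -> w t \in Lfun mu 2%:E) ->
  0 <= t -> 0 <= t + h -> measurable_fun setT (quotient (fcurve b w) t h).
Proof.
move=> w2 t0 th.
have m1 := measurable_fpart b (w2 _ th); have m2 := measurable_fpart b (w2 _ t0).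
exact: (measurable_funM (measurable_cst h^-1) (measurable_funB m1 m2)).
Qed.

(* The limit exists by completeness, since the Fourier transform is isometric
   and the multiplier is bounded. *)
Lemma time_derivative_multiplier (m : R2 -> R) w pw t g :
  measurable_fun setT m -> (forall xi, `|m xi| <= 1) ->
  (forall t, 0 <= t -> multiplier (fun xi => (m xi)%:C%C) (w t) (pw t)) ->
  0 <= t -> time_derivative w t g ->
  exists g', time_derivative pw t g' /\
    forall b, {ae mu, forall xi, fpart b g' xi = m xi * fpart b g xi}.
Proof.
move=> mm m1 wpw t0 /time_derivativeE[g2 Dg].
have w2 s : 0 <= s -> w s \in Lfun mu 2%:E by move=> /wpw/multiplier_L2[].
have pw2 s : 0 <= s -> pw s \in Lfun mu 2%:E by move=> /wpw/multiplier_L2[].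
have pq b h : 0 <= t + h ->
    {ae mu, forall xi, fpart b (quotient pw t h) xi = m xi * quotient (fcurve b w) t h xi}.
  move=> th; have := fpart_quotient b pw2 t0 th.
  apply: filterS3 (multiplier_real (wpw _ th) b) (multiplier_real (wpw _ t0) b).
  by move=> xi e1 e2 ->; rewrite /quotient /fcurve e1 e2 -mulrBr mulrCA.
have mfq b h th := @measurable_fcurve_quotient b w t h w2 t0 th.
have mg b := measurable_fpart b g2.
have D b := nsq_derivative_fpart b w2 g2 t0 Dg.
have te n : 0 <= t + eps n by rewrite addr_ge0// ltW// eps_gt0.
have Dn b : (nsq mu (fun xi => quotient (fcurve b w) t (eps n) xi - fpart b g xi)%R
    @[n --> \oo] --> 0)%E.
  exact: cvg_comp (cvg_eps_time_filter t0) (D b).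
have q2 n := L2_quotient pw2 t0 (te n).
have mult_le (F : R2 -> R) : measurable_fun setT F ->
    (nsq mu (fun xi => m xi * F xi)%R <= nsq mu F)%E.
  move=> mF; have := @le_nsq _ _ _ mu 1 (fun xi => m xi * F xi) F ler01.
  rewrite expr1n mul1e; apply => //; first exact: (measurable_funM mm mF).
  by apply/aeW => xi; rewrite normrM ler_wpM2r.
have [g' [mg' g'lim]] : exists g' : R2 -> R, measurable_fun setT g' /\
    (nsq mu (fun x => quotient pw t (eps n) x - g' x)%R @[n --> \oo] --> 0)%E.
  apply: L2_complete; first by move=> n; have /Lfun2P[] := q2 n.
  move=> e e0; have e8 : 0 < e / 8 by rewrite divr_gt0.
  have [N HN] : exists N, forall b n, (N <= n)%N ->
      (nsq mu (fun xi => quotient (fcurve b w) t (eps n) xi - fpart b g xi)%R <= (e / 8)%:E)%E.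
    have /cvge0P/(_ _ e8) := Dn true; move=> /(_ (fun n => nsq_ge0 _ _)) [N1 _ H1].
    have /cvge0P/(_ _ e8) := Dn false; move=> /(_ (fun n => nsq_ge0 _ _)) [N2 _ H2].
    exists (maxn N1 N2) => b n; rewrite geq_max => /andP[n1 n2].
    by apply: ltW; case: b; [exact: H1|exact: H2].
  exists N => p n Np Nn.
  rewrite -plancherel; last exact: L2B.
  have B b : (nsq mu (fpart b (fun x => quotient pw t (eps p) x - quotient pw t (eps n) x)%R) <= (e / 2)%:E)%E.
    set A := fun xi => quotient (fcurve b w) t (eps p) xi - fpart b g xi.
    set A' := fun xi => quotient (fcurve b w) t (eps n) xi - fpart b g xi.
    have mA : measurable_fun setT A by exact: (measurable_funB (mfq b _ (te p)) (mg b)).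
    have mA' : measurable_fun setT A' by exact: (measurable_funB (mfq b _ (te n)) (mg b)).
    have mAA : measurable_fun setT (fun xi => A xi - A' xi).
      exact: (measurable_funB mA mA').
    rewrite (_ : nsq mu _ = nsq mu (fun xi => m xi * (A xi - A' xi))%R); last first.
      apply: eq_nsq.
      - exact: measurable_fpart (L2B (q2 p) (q2 n)).
      - exact: (measurable_funM mm mAA).
      - apply: filterS3 (fpartB b (q2 p) (q2 n)) (pq b _ (te p)) (pq b _ (te n)).
        have E (x y z v : R) : v * x - v * y = v * ((x - z) - (y - z)) by ring.
        by move=> xi -> -> ->; exact: E.
    apply: (@le_trans _ _ (nsq mu (fun xi => A xi - A' xi)%R)); first exact: (mult_le _ mAA).
    apply: (le_trans (nsqB_le mu mA mA')).
    rewrite (_ : (e / 2)%:E = (2%:E * (e / 8)%:E + 2%:E * (e / 8)%:E)%E); last first.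
      by rewrite -!EFinM -EFinD; congr EFin; field.
    by apply: leeD; apply: lee_wpmul2l => //; exact: HN.
  have -> : e%:E = ((e / 2)%:E + (e / 2)%:E)%E by rewrite -EFinD; congr EFin; field.
  by apply: leeD; exact: B.
have g'2 : g' \in Lfun mu 2%:E.
  apply/Lfun2P; split => //.
  have /cvge0P/(_ _ ltr01) := g'lim.
  move=> /(_ (fun n => nsq_ge0 _ _)) [N _ /(_ N (leqnn N))/= HN].
  have /Lfun2P[mq qfin] := q2 N.
  have := nsqB_le mu mq (measurable_funB mq mg').
  rewrite (_ : (fun x => _) = g'); last by apply/funext => x; rewrite opprB addrC subrK.
  move=> /le_lt_trans; apply.
  by rewrite lte_add_pinfty// lte_mul_pinfty// (lt_trans HN)// ltry.
have mfg' b := measurable_fpart b g'2.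
have fg' b : {ae mu, forall xi, fpart b g' xi = m xi * fpart b g xi}.
  apply: (@nsq_limit_unique _ _ _ mu _ \oo _ (fun n => fpart b (quotient pw t (eps n)))).
  - by move=> n; exact: measurable_fpart.
  - exact: mfg'.
  - exact: measurable_funM mm (mg b).
  - apply: cvge0_le g'lim; first by move=> n; exact: nsq_ge0.
    apply: nearW => n; apply: le_trans (fpart_nsq_le b (L2B (q2 n) g'2)).
    rewrite le_eqVlt; apply/orP; left; apply/eqP; apply: eq_nsq.
    + exact: (measurable_funB (measurable_fpart b (q2 n)) (mfg' b)).
    + exact: measurable_fpart (L2B (q2 n) g'2).
    + by apply: filterS (fpartB b (q2 n) g'2) => xi ->.
  - apply: cvge0_le (Dn b); first by move=> n; exact: nsq_ge0.
    apply: nearW => n.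
    apply: le_trans (mult_le _ (measurable_funB (mfq b _ (te n)) (mg b))).
    rewrite le_eqVlt; apply/orP; left; apply/eqP; apply: eq_nsq.
    + exact: (measurable_funB (measurable_fpart b (q2 n)) (measurable_funM mm (mg b))).
    + exact: (measurable_funM mm (measurable_funB (mfq b _ (te n)) (mg b))).
    + by apply: filterS (pq b _ (te n)) => xi ->; rewrite mulrBr.
exists g'; split; last exact: fg'.
apply/time_derivativeE; split => //.
(* The limit [g'] was obtained along the increments [eps n] only. Its explicit transform gives
   convergence along the whole filter. *)
apply: cvge0_le (cvge0D (D true) (D false)); first by move=> h; exact: nsq_ge0.
apply: filterS (time_filter_ge0 t) => h th.
have qh2 := L2_quotient pw2 t0 th.
rewrite -plancherel; last exact: L2B.
have B b : (nsq mu (fpart b (fun x => quotient pw t h x - g' x)%R) <=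
    nsq mu (fun xi => quotient (fcurve b w) t h xi - fpart b g xi)%R)%E.
  apply: le_trans (mult_le _ (measurable_funB (mfq b _ th) (mg b))).
  rewrite le_eqVlt; apply/orP; left; apply/eqP; apply: eq_nsq.
  - exact: measurable_fpart (L2B qh2 g'2).
  - exact: (measurable_funM mm (measurable_funB (mfq b _ th) (mg b))).
  - apply: filterS3 (fpartB b qh2 g'2) (pq b _ th) (fg' b).
    by move=> xi -> -> ->; rewrite mulrBr.
by apply: leeD; exact: B.
Qed.

End fourier_derivatives.

(** * Energy estimates *)

Section gronwall.
Context {R : realType}.
Implicit Types (E D : R -> R) (t : R).

Lemma time_filter_dnbhs (t : R) : 0 < t -> (0:R)^' `=>` time_filter t.
Proof.
move=> t0 A [e /= e0 H].
exists (Num.min e t); first by rewrite /= lt_min e0.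
move=> h /=; rewrite sub0r normrN lt_min => /andP[he ht] hn0.
apply: H => //=; first by rewrite sub0r normrN.
by move: ht; rewrite ltr_norml => /andP[? _]; lra.
Qed.

Lemma time_filter_right : (0:R)^'+ `=>` time_filter 0.
Proof.
move=> A; rewrite /time_filter /within/= => -[e /= e0 H].
exists e => //= h /= he h0; apply: H => //=; first by rewrite gt_eqF.
by rewrite add0r ltW.
Qed.

(** The function [expR (c * t) * E t] is nonincreasing. At [0] only increments to the right are
    available, so [E] is differentiated on the open half-line, and right continuity at [0] is
    recovered from the convergence of the quotients. *)
Lemma gronwall E D (c : R) :
  (forall t, 0 <= t -> h^-1 * (E (t + h) - E t) @[h --> time_filter t] --> D t) ->
  (forall t, 0 <= t -> D t <= - c * E t) ->
  forall t, 0 <= t -> E t <= expR (- c * t) * E 0.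
Proof.
move=> DE Dle t; rewrite le_eqVlt => /predU1P[<-|t0].
  by rewrite mulr0 expR0 mul1r.
have dE (s : R) : 0 < s -> is_derive s 1 E (D s).
  move=> s0; have H : h^-1 *: ((E \o shift s) (h *: 1) - E s) @[h --> (0:R)^'] --> D s.
    rewrite (_ : (fun h => _) = (fun h => h^-1 * (E (s + h) - E s))); last first.
      by apply/funext => h /=; rewrite /GRing.scale/= mulr1 [h + s]addrC.
    exact: cvg_trans (cvg_app _ (time_filter_dnbhs s0)) (DE s (ltW s0)).
  apply: DeriveDef; first by apply/cvg_ex; exists (D s).
  exact: cvg_lim H.
pose F (s : R) := expR (c * s) * E s.
have dF (s : R) : 0 < s -> is_derive s 1 F (expR (c * s) * (D s + c * E s)).
  move=> s0; have := dE s s0 => ?.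
  have ? : is_derive s 1 (fun s : R => expR (c * s)) (c * expR (c * s)).
    by apply: is_derive_eq; rewrite /GRing.scale/=; ring.
  by rewrite /F; apply: is_derive_eq; rewrite /GRing.scale/=; ring.
have cE0 : E x @[x --> 0^'+] --> E 0.
  have H := cvg_trans (cvg_app (fun h => h^-1 * (E (0 + h) - E 0)) time_filter_right) (DE 0 (lexx 0)).
  have : x * (x^-1 * (E (0 + x) - E 0)) + E 0 @[x --> 0^'+] --> 0 * D 0 + E 0.
    apply: cvgD; last exact: cvg_cst.
    by apply: cvgM H; exact: (cvg_at_right_filter cvg_id).
  rewrite mul0r add0r; apply: cvg_trans; apply: near_eq_cvg; near=> x.
  by rewrite add0r mulrA divff ?mul1r ?subrK// gt_eqF.
have FF : F t <= F 0.
  apply: (@ler0_derive1_le_cc R F 0 t) => //.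
  - by move=> s; rewrite in_itv/= => /andP[s0 _]; have [] := dF s s0.
  - move=> s; rewrite in_itv/= => /andP[s0 _]; rewrite derive1E (@derive_val _ _ _ _ _ _ _ (dF s s0)).
    rewrite mulr_ge0_le0 ?expR_ge0//; have := Dle s (ltW s0); lra.
  - apply/continuous_within_itvP => //; split.
    + move=> s; rewrite in_itv/= => /andP[s0 _].
      by apply: differentiable_continuous; apply/derivable1_diffP; have [] := dF s s0.
    + apply: cvgM cE0; apply: cvg_at_right_filter.
      by apply: continuous_comp; [exact: mulrl_continuous|exact: continuous_expR].
    + apply: cvg_at_left_filter.
      by apply: differentiable_continuous; apply/derivable1_diffP; have [] := dF t t0.
  - by rewrite in_itv/= ltW//= lexx.
  - by rewrite in_itv/= lexx ltW.
  - exact: ltW.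
move: FF; rewrite /F mulr0 expR0 mul1r => FF.
by rewrite mulNr expRN mulrC ler_pdivlMr ?expR_gt0// mulrC.
Unshelve. all: by end_near. Qed.

End gronwall.

(** * Differentiating squared norms *)

Section energy.
Context {R : realType}.
Local Notation R2 := (measurableTypeR R * measurableTypeR R)%type.
Local Notation mu := (@leb2_sf R).
Local Notation L2f := (Lfun mu 2%:E).
Implicit Types (f g k : R2 -> R) (w : R -> R2 -> R).

Definition inner f g : R := \int[mu]_x (f x * g x).

Lemma integrable_mul f g : f \in L2f -> g \in L2f ->
  mu.-integrable setT (EFin \o (fun x => f x * g x)).
Proof.
by move=> f2 g2; apply/Lfun1_integrable; exact: Lfun2_mul_Lfun1.
Qed.

Lemma innerC f g : inner f g = inner g f.
Proof. by rewrite /inner; under eq_Rintegral do rewrite mulrC. Qed.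

Lemma innerDl f g k : f \in L2f -> g \in L2f -> k \in L2f ->
  inner (fun x => f x + g x) k = inner f k + inner g k.
Proof.
move=> f2 g2 k2; rewrite /inner -RintegralD//; [|exact: integrable_mul..].
by apply: eq_Rintegral => x _; rewrite mulrDl.
Qed.

Lemma innerZl (a : R) f k : f \in L2f -> k \in L2f ->
  inner (fun x => a * f x) k = a * inner f k.
Proof.
move=> f2 k2; rewrite /inner -RintegralZl//; last exact: integrable_mul.
by apply: eq_Rintegral => x _; rewrite mulrA.
Qed.

Lemma nsq_inner f : f \in L2f -> nsq mu f = (inner f f)%:E.
Proof.
move=> f2; have I := integrable_mul f2 f2.
rewrite /inner /Rintegral fineK; last exact: integrable_fin_num I.
by rewrite /nsq; apply: eq_integral => x _; rewrite expr2.
Qed.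

Lemma inner_ge0 f : 0 <= inner f f.
Proof. by apply: Rintegral_ge0 => x _; rewrite -expr2 sqr_ge0. Qed.

Lemma L2D f g : f \in L2f -> g \in L2f -> (fun x => f x + g x) \in L2f.
Proof.
move=> f2 g2; have := L2_lin 1 1 f2 g2.
by under eq_fun do rewrite !mul1r.
Qed.

Lemma inner_lin_sqr (a : R) f g : f \in L2f -> g \in L2f ->
  inner (fun x => f x + a * g x) (fun x => f x + a * g x) =
  inner f f + 2 * a * inner f g + a ^+ 2 * inner g g.
Proof.
move=> f2 g2; have ag2 := L2Z a g2; have s2 := L2D f2 ag2.
rewrite innerDl// innerZl// [inner f _]innerC [inner g _]innerC.
by rewrite !innerDl// !innerZl// (innerC g f); ring.
Qed.

(** Cauchy-Schwarz with [inner g g + 1] in place of [inner g g], which avoids a separate case for a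
    vanishing [g]. The loss is harmless where the other factor tends to [0]. *)
Lemma inner_sqr_le f g : f \in L2f -> g \in L2f ->
  inner f g ^+ 2 <= inner f f * (inner g g + 1).
Proof.
move=> f2 g2.
have := inner_ge0 (fun x => f x + (- (inner f g / (inner g g + 1))) * g x).
rewrite inner_lin_sqr//; have := inner_ge0 g.
move: (inner f g) (inner f f) (inner g g) => c A B B0 H.
have B1 : 0 < B + 1 by lra.
have : 0 <= (B + 1) ^+ 2 * (A + 2 * - (c / (B + 1)) * c + (- (c / (B + 1))) ^+ 2 * B).
  by rewrite mulr_ge0// sqr_ge0.
rewrite (_ : _ * _ = (B + 1) * (A * (B + 1)) - c ^+ 2 * (B + 1) - c ^+ 2); last first.
  by field; rewrite gt_eqF.
move=> K; have c0 := sqr_ge0 c.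
have : 0 <= (B + 1) * (A * (B + 1) - c ^+ 2).
  by rewrite mulrBr [_ * c ^+ 2]mulrC; lra.
by rewrite pmulr_rge0// subr_ge0.
Qed.

Lemma inner_derivative w t g : (forall s, 0 <= s -> w s \in L2f) -> g \in L2f -> 0 <= t ->
  nsq_derivative w t g ->
  h^-1 * (inner (w (t + h)) (w (t + h)) - inner (w t) (w t)) @[h --> time_filter t] -->
  2 * inner (w t) g.
Proof.
move=> w2 g2 t0 D.
pose u h := fine (nsq mu (fun x => quotient w t h x - g x)%R).
have u0 : u h @[h --> time_filter t] --> (0:R) by exact: (fine_cvg D).
have h0 : (fun h : R => `|h|) h @[h --> time_filter t] --> (0:R).
  rewrite -[X in _ --> X](@normr0 _ R); apply: cvg_norm.
  apply: cvg_trans (@cvg_id _ (nbhs (0:R))).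
  apply: cvg_trans (@nbhs_dnbhs _ (0:R)); exact: cvg_within.
(* With [q] the difference quotient, [w (t + h) = w t + h q] and the quotient of the squared norm is
   [2 <w t, q> + h |q|^2]. The first summand of [B] bounds [2 <w t, q - g>] by Cauchy-Schwarz, the
   second bounds [h |q|^2] through [|q|^2 <= 2 |q - g|^2 + 2 |g|^2]. *)
pose B h := 2 * (Num.sqrt (u h) * Num.sqrt (inner (w t) (w t) + 1))
  + `|h| * (2 * u h + 2 * inner g g).
have B0 : B h @[h --> time_filter t] --> (0:R).
  have -> : (0:R) = 2 * (0 * Num.sqrt (inner (w t) (w t) + 1)) + 0 * (2 * 0 + 2 * inner g g).
    by ring.
  apply: cvgD; first (apply: cvgMl_tmp; apply: cvgMr_tmp).
    rewrite -[X in _ --> X](@sqrtr0 R); apply: continuous_cvg u0; exact: sqrt_continuous.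
  by apply: cvgM h0 _; apply: cvgD; [exact: cvgMl_tmp|exact: cvg_cst].
apply: (@squeeze_cvgr _ _ _ _ (fun h => 2 * inner (w t) g - B h) (fun h => 2 * inner (w t) g + B h)).
- near=> h.
  have hn0 : h != 0.
    by near: h; rewrite /time_filter near_withinE; apply: filterS (nbhs_dnbhs_neq 0).
  have th : 0 <= t + h by near: h; exact: time_filter_ge0.
  have q2 := L2_quotient w2 t0 th; have d2 := L2B q2 g2; have wt2 := w2 _ t0.
  have -> : w (t + h) = fun x => w t x + h * quotient w t h x.
    by apply/funext => x; rewrite /quotient; field.
  rewrite inner_lin_sqr//.
  have -> : inner (w t) (quotient w t h) = inner (w t) g + inner (fun x => quotient w t h x - g x) (w t).
    rewrite (innerC (w t) g) -innerDl// innerC; congr inner.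
    by apply/funext => x; rewrite addrC subrK.
  have E : inner (quotient w t h) (quotient w t h) <= 2 * u h + 2 * inner g g.
    rewrite /u nsq_inner//=.
    have : (nsq mu (quotient w t h) <=
        2%:E * nsq mu (fun x => quotient w t h x - g x)%R + 2%:E * nsq mu g)%E.
      have := nsqD_le mu (proj1 ((Lfun2P _ _).1 d2)) (proj1 ((Lfun2P _ _).1 g2)).
      apply: le_trans; rewrite le_eqVlt; apply/orP; left; apply/eqP.
      by congr nsq; apply/funext => x; rewrite subrK.
    by rewrite !nsq_inner// -!EFinM -EFinD lee_fin.
  have CS : `|inner (fun x => quotient w t h x - g x) (w t)| <=
      Num.sqrt (u h) * Num.sqrt (inner (w t) (w t) + 1).
    rewrite -sqrtr_sqr -sqrtrM; last by rewrite /u nsq_inner//= inner_ge0.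
    by rewrite ler_wsqrtr// /u nsq_inner//= inner_sqr_le.
  have Q0 := inner_ge0 (quotient w t h).
  rewrite /B; move: Q0 E CS.
  move: (inner (w t) (w t)) (inner _ (w t)) (inner (w t) g) (inner (quotient w t h) _)
    (Num.sqrt (u h) * _) (2 * u h + _) => A c L Q S U Q0 E CS.
  rewrite (_ : h^-1 * _ = 2 * L + (2 * c + h * Q)); last by field.
  have HQ : `|h * Q| <= `|h| * U by rewrite normrM (ger0_norm Q0) ler_wpM2l.
  by move: CS HQ; rewrite !ler_norml; lra.
- rewrite -[X in _ --> X]subr0; apply: (cvgB _ B0); exact: (@cvg_cst _ _ _ _ (time_filter_filter t)).
- rewrite -[X in _ --> X]addr0; apply: (cvgD _ B0); exact: (@cvg_cst _ _ _ _ (time_filter_filter t)).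
Unshelve. all: by end_near. Qed.

Definition L2_curve w (dw : R -> R2 -> R) : Prop := forall t, 0 <= t ->
  [/\ w t \in L2f, dw t \in L2f & nsq_derivative w t (dw t)].

(** The exceptional null set may depend on the time: the inequality is integrated in [x] at each
    time, and Gronwall's argument is applied to the resulting real function. *)
Lemma energy_decay (X Y dX dY : R -> R2 -> R) (c : R) :
  L2_curve X dX -> L2_curve Y dY ->
  (forall t, 0 <= t -> {ae mu, forall x,
    2 * (X t x * dX t x + Y t x * dY t x) <= - c * (X t x ^+ 2 + Y t x ^+ 2)}) ->
  forall t, 0 <= t ->
  (nsq mu (X t) + nsq mu (Y t) <= (expR (- c * t))%:E * (nsq mu (X 0%R) + nsq mu (Y 0%R)))%E.
Proof.
move=> CX CY H t t0.
have X2 s : 0 <= s -> X s \in L2f by move=> /CX[].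
have Y2 s : 0 <= s -> Y s \in L2f by move=> /CY[].
pose E s := inner (X s) (X s) + inner (Y s) (Y s).
pose D s := 2 * inner (X s) (dX s) + 2 * inner (Y s) (dY s).
rewrite !nsq_inner//; try exact: X2; try exact: Y2.
rewrite -!EFinD -EFinM lee_fin -/(E t) -/(E 0).
apply: (@gronwall _ E D) => // s s0.
  have [_ dX2 DX] := CX _ s0; have [_ dY2 DY] := CY _ s0.
  rewrite (_ : (fun h => _) = (fun h =>
      h^-1 * (inner (X (s + h)) (X (s + h)) - inner (X s) (X s)) +
      h^-1 * (inner (Y (s + h)) (Y (s + h)) - inner (Y s) (Y s)))); last first.
    by apply/funext => h; rewrite /E opprD addrACA mulrDr.
  exact: cvgD (inner_derivative X2 dX2 s0 DX) (inner_derivative Y2 dY2 s0 DY).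
have [Xs dX2 _] := CX _ s0; have [Ys dY2 _] := CY _ s0.
rewrite /D /E -mulrDr.
have iXd := integrable_mul Xs dX2; have iYd := integrable_mul Ys dY2.
have iX := integrable_mul Xs Xs; have iY := integrable_mul Ys Ys.
rewrite /inner -!RintegralD//.
have i1 : mu.-integrable setT (EFin \o (fun x => X s x * dX s x + Y s x * dY s x)).
  by have := integrableD measurableT iXd iYd.
have i2 : mu.-integrable setT (EFin \o (fun x => X s x * X s x + Y s x * Y s x)).
  by have := integrableD measurableT iX iY.
rewrite -!RintegralZl// /Rintegral -subr_ge0.
have i1' : mu.-integrable setT (EFin \o (fun x => 2 * (X s x * dX s x + Y s x * dY s x))).
  by have := integrableZl measurableT 2 i1.
have i2' : mu.-integrable setT (EFin \o (fun x => - c * (X s x * X s x + Y s x * Y s x))).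
  by have := integrableZl measurableT (- c) i2.
have := RintegralB measurableT i2' i1'; rewrite /Rintegral => <-.
have := integrableB measurableT i2' i1' => i3.
have /measurable_int m3 := i3.
rewrite fine_ge0//.
pose F (x : R2) := - c * (X s x * X s x + Y s x * Y s x) - 2 * (X s x * dX s x + Y s x * dY s x).
rewrite (_ : (\int[mu]_x _ = \int[mu]_x (F x)%:E)%E); last exact: eq_integral.
(* [F] is nonnegative only almost everywhere; replacing it by its positive part leaves the integral
   unchanged and makes the sign evident. *)
have -> : (\int[mu]_x (F x)%:E = \int[mu]_x maxe 0 (F x)%:E)%E.
  apply: ae_eq_integral => //.
  + by apply: measurable_maxe => //; exact: measurable_cst.
  + apply: filterS (H s s0) => x Hx _ /=; apply/esym/max_idPr; rewrite lee_fin /F.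
    by move: Hx; rewrite !expr2; lra.
by apply: integral_ge0 => x _; rewrite le_max lexx.
Qed.
End energy.

(** * Energies with frequency weights *)

Section weighted_energy.
Context {R : realType}.
Local Notation R2 := (measurableTypeR R * measurableTypeR R)%type.
Local Notation mu := (@leb2_sf R).
Local Notation L2f := (Lfun mu 2%:E).
Implicit Types (f g m : R2 -> R) (w dw : R -> R2 -> R).

Lemma le_nsq_weight (M : R) m f : (forall x, `|m x| <= M) -> measurable_fun setT m ->
  measurable_fun setT f -> (nsq mu (fun x => m x * f x)%R <= (M ^+ 2)%:E * nsq mu f)%E.
Proof.
move=> mM mm mf; apply: le_nsq => //.
- by apply: le_trans (mM (0, 0)).
- exact: (measurable_funM mm mf).
- by apply/aeW => x; rewrite normrM ler_wpM2r.
Qed.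

Lemma L2_weight (M : R) m f : (forall x, `|m x| <= M) -> measurable_fun setT m ->
  f \in L2f -> (fun x => m x * f x) \in L2f.
Proof.
move=> mM mm /Lfun2P[mf f2]; apply/Lfun2P; split; first exact: (measurable_funM mm mf).
apply: (le_lt_trans (le_nsq_weight mM mm mf)).
by rewrite lte_mul_pinfty// lee_fin sqr_ge0.
Qed.

Lemma L2_curve_weight (M : R) m w dw : (forall x, `|m x| <= M) -> measurable_fun setT m ->
  L2_curve w dw -> L2_curve (fun t x => m x * w t x) (fun t x => m x * dw t x).
Proof.
move=> mM mm C t t0; have [w2 dw2 D] := C t t0.
split; [exact: (L2_weight mM)|exact: (L2_weight mM)|].
apply: cvge0_le (cvge0Z (M ^+ 2) D); first by move=> h; exact: nsq_ge0.
apply: filterS (time_filter_ge0 t) => h th.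
have q2 : quotient w t h \in L2f by apply: L2Z; apply: L2B => //; have [] := C _ th.
have /Lfun2P[mq _] := L2B q2 dw2.
apply: le_trans (le_nsq_weight mM mm mq).
rewrite le_eqVlt; apply/orP; left; apply/eqP; congr nsq; apply/funext => x.
rewrite /quotient; move: (w (t + h) x) (w t x) (dw t x) (m x) h^-1 => a b d e k.
by ring.
Qed.

Lemma L2_curveD w dw w1 dw1 : L2_curve w dw -> L2_curve w1 dw1 ->
  L2_curve (fun t x => w t x + w1 t x) (fun t x => dw t x + dw1 t x).
Proof.
move=> C C1 t t0; have [w2 dw2 D] := C t t0; have [w21 dw21 D1] := C1 t t0.
split; [exact: L2D|exact: L2D|].
apply: cvge0_le (cvge0D (cvge0Z 2 D) (cvge0Z 2 D1)); first by move=> h; exact: nsq_ge0.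
apply: filterS (time_filter_ge0 t) => h th.
have q2 : quotient w t h \in L2f by apply: L2Z; apply: L2B => //; have [] := C _ th.
have q21 : quotient w1 t h \in L2f by apply: L2Z; apply: L2B => //; have [] := C1 _ th.
have /Lfun2P[mq _] := L2B q2 dw2; have /Lfun2P[mq1 _] := L2B q21 dw21.
apply: le_trans (nsqD_le mu mq mq1).
rewrite le_eqVlt; apply/orP; left; apply/eqP; congr nsq; apply/funext => x.
rewrite /quotient; move: (w (t + h) x) (w t x) (w1 (t + h) x) (w1 t x) => a b c d.
by ring.
Qed.

Lemma integral_weight_sqr (A : set R2) f g : measurable A -> measurable_fun setT f ->
  measurable_fun setT g ->
  (nsq mu (fun x => \1_A x * f x)%R + nsq mu (fun x => \1_A x * g x)%R =
   \int[mu]_(x in A) (f x ^+ 2 + g x ^+ 2)%:E)%E.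
Proof.
move=> mA mf mg; have m1 : measurable_fun setT (\1_A : R2 -> R) by exact: measurable_indic.
have mAf := measurable_sqrE (measurable_funM m1 mf).
have mAg := measurable_sqrE (measurable_funM m1 mg).
rewrite /nsq -ge0_integralD//; last 2 first.
- by move=> x _; rewrite lee_fin sqr_ge0.
- by move=> x _; rewrite lee_fin sqr_ge0.
rewrite [RHS]integral_mkcond; apply: eq_integral => x _.
rewrite /patch indicE; case: ifPn => xA.
  by rewrite !mul1r EFinD.
by rewrite !mul0r expr0n/= adde0.
Qed.

(* Weights that are unbounded on [S] are reached by exhausting [S] by the sets on which
   they are bounded. *)
Lemma weighted_energy_decay (P Q dP dQ : R -> R2 -> R) (x1 x2 y1 y2 : R2 -> R) (c : R)
    (S : set R2) :
  let X t xi := x1 xi * P t xi + x2 xi * Q t xi in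
  let Y t xi := y1 xi * P t xi + y2 xi * Q t xi in
  L2_curve P dP -> L2_curve Q dQ -> measurable S ->
  measurable_fun setT x1 -> measurable_fun setT x2 ->
  measurable_fun setT y1 -> measurable_fun setT y2 ->
  (forall t xi, 0 <= t -> S xi ->
    2 * (X t xi * (x1 xi * dP t xi + x2 xi * dQ t xi) +
         Y t xi * (y1 xi * dP t xi + y2 xi * dQ t xi)) <= - c * (X t xi ^+ 2 + Y t xi ^+ 2)) ->
  forall t, 0 <= t ->
  (\int[mu]_(xi in S) (X t xi ^+ 2 + Y t xi ^+ 2)%:E <=
   (expR (- c * t))%:E * \int[mu]_(xi in S) (X 0%R xi ^+ 2 + Y 0%R xi ^+ 2)%:E)%E.
Proof.
move=> X Y CP CQ mS mx1 mx2 my1 my2 H t t0.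
have mP s : 0 <= s -> measurable_fun setT (P s) by move=> /CP[/Lfun2P[]].
have mQ s : 0 <= s -> measurable_fun setT (Q s) by move=> /CQ[/Lfun2P[]].
have mX s : 0 <= s -> measurable_fun setT (X s).
  by move=> s0; exact: (measurable_funD (measurable_funM mx1 (mP _ s0)) (measurable_funM mx2 (mQ _ s0))).
have mY s : 0 <= s -> measurable_fun setT (Y s).
  by move=> s0; exact: (measurable_funD (measurable_funM my1 (mP _ s0)) (measurable_funM my2 (mQ _ s0))).
have mXY s : 0 <= s -> measurable_fun setT (fun x => (X s x ^+ 2 + Y s x ^+ 2)%:E).
  move=> s0; apply/measurable_EFinP.
  exact: (measurable_funD (measurable_funX 2 (mX _ s0)) (measurable_funX 2 (mY _ s0))).
have XY0 s x : (0 <= (X s x ^+ 2 + Y s x ^+ 2)%:E)%E by rewrite lee_fin addr_ge0// sqr_ge0.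
(* One function dominating all four weights, so that a single exhaustion of [S] bounds them
   together. *)
pose k xi := (`|x1 xi| + `|x2 xi|) + (`|y1 xi| + `|y2 xi|).
have mk : measurable_fun setT k.
  have mn (f : R2 -> R) : measurable_fun setT f -> measurable_fun setT (fun x => `|f x|).
    by move=> mf; exact: (measurableT_comp (@normr_measurable R setT) mf).
  exact: (measurable_funD (measurable_funD (mn _ mx1) (mn _ mx2)) (measurable_funD (mn _ my1) (mn _ my2))).
pose A n := S `&` (k @^-1` `]-oo, n%:R]).
have mA n : measurable (A n).
  by apply: measurableI => //; rewrite -[X in measurable X]setTI; exact: mk.
have AS : \bigcup_n A n = S.
  apply/seteqP; split=> x; first by move=> [n _ []].
  move=> Sx; exists (Num.truncn (k x)).+1 => //; split=> //=.
  by rewrite in_itv/= ltW// truncnS_gt.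
have ndA : nondecreasing_seq A.
  move=> p n pn; apply/subsetPset => x [Sx] /=; rewrite in_itv/= => kx.
  by split=> //=; rewrite in_itv/= (le_trans kx)// ler_nat.
rewrite -[in X in (X <= _)%E]AS.
have cv : (\int[mu]_(x in A n) (X t x ^+ 2 + Y t x ^+ 2)%:E @[n --> \oo] -->
    \int[mu]_(x in \bigcup_n A n) (X t x ^+ 2 + Y t x ^+ 2)%:E)%E.
  apply: ge0_nondecreasing_set_cvg_integral => // n.
  exact: measurable_funTS (mXY _ t0).
rewrite -(cvg_lim _ cv)//; apply: lime_le; first by apply/cvg_ex; eexists; exact: cv.
apply: nearW => n.
have bnd (y : R2 -> R) : (forall xi, `|y xi| <= k xi) -> forall xi, `|\1_(A n) xi * y xi| <= n%:R.
  move=> yk xi; rewrite indicE; case: (boolP (xi \in A n)); last by rewrite mul0r normr0.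
  by rewrite inE => -[_ /=]; rewrite in_itv/= mul1r; apply: le_trans.
have m1 : measurable_fun setT (\1_(A n) : R2 -> R) by exact: measurable_indic.
have cW (y z : R2 -> R) : (forall xi, `|y xi| <= k xi) -> (forall xi, `|z xi| <= k xi) ->
  measurable_fun setT y -> measurable_fun setT z ->
  L2_curve (fun t xi => \1_(A n) xi * (y xi * P t xi + z xi * Q t xi))
    (fun t xi => \1_(A n) xi * (y xi * dP t xi + z xi * dQ t xi)).
  move=> yk zk my mz.
  have := L2_curveD (L2_curve_weight (bnd _ yk) (measurable_funM m1 my) CP)
    (L2_curve_weight (bnd _ zk) (measurable_funM m1 mz) CQ).
  by congr L2_curve; apply/funext => s; apply/funext => xi; rewrite mulrDr !mulrA.
have k1 xi : `|x1 xi| <= k xi by rewrite /k -!addrA lerDl !addr_ge0.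
have k2 xi : `|x2 xi| <= k xi by rewrite /k addrAC lerDr !addr_ge0.
have k3 xi : `|y1 xi| <= k xi by rewrite /k addrCA lerDl !addr_ge0.
have k4 xi : `|y2 xi| <= k xi by rewrite /k addrA lerDr !addr_ge0.
have := energy_decay (cW _ _ k1 k2 mx1 mx2) (cW _ _ k3 k4 my1 my2).
move=> /(_ c) /(_ _ t t0).
rewrite -/(X t) -/(Y t) -/(X 0) -/(Y 0) !integral_weight_sqr//; try exact: mX; try exact: mY.
move=> E; apply: le_trans (E _) _; last first.
  apply: lee_wpmul2l; first by rewrite lee_fin expR_ge0.
  apply: ge0_subset_integral => //; first by apply: measurable_funTS; exact: mXY.
    by move=> x _; exact: XY0.
  by move=> x [].
move=> s s0. apply/aeW => xi; rewrite indicE.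
case: (boolP (xi \in A n)); last by rewrite !mul0r expr0n/= addr0 !mulr0.
by rewrite inE => -[Sxi _]; rewrite !mul1r; exact: H.
Qed.

End weighted_energy.

(** * Damped oscillators *)

Section damped_oscillator.
Context {R : realType}.
Local Notation R2 := (measurableTypeR R * measurableTypeR R)%type.
Local Notation mu := (@leb2_sf R).

(* Here [dV = - a V + l Q] and [dQ = - b Q - m V], and the squared quantities are
   [r (dV + s V / 2)], written in terms of [V] and [Q], and [r sqrt (s^2 / 4 + p) V]. *)
Lemma oscillator_dissipation (a b l m c r V Q s p dV dQ y : R) :
  0 <= c -> 4 * c <= a -> 4 * c <= b -> 0 <= l * m ->
  s = a + b -> p = a * b + l * m -> dV = - a * V + l * Q -> dQ = - b * Q - m * V ->
  y = r * Num.sqrt (s ^+ 2 / 4 + p) ->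
  2 * ((r * (s / 2 - a) * V + r * l * Q) * (r * (s / 2 - a) * dV + r * l * dQ) +
    y * V * (y * dV)) <=
  - c * ((r * (s / 2 - a) * V + r * l * Q) ^+ 2 + (y * V) ^+ 2).
Proof.
move=> c0 ca cb lm sE pE dVE dQE yE.
have a0 : 0 <= a by lra.
have b0 : 0 <= b by lra.
have p0 : 0 <= p by rewrite pE addr_ge0// mulr_ge0.
have y2 : y ^+ 2 = r ^+ 2 * (s ^+ 2 / 4 + p).
  by rewrite yE exprMn sqr_sqrtr// addr_ge0// divr_ge0// sqr_ge0.
have -> : y * V * (y * dV) = y ^+ 2 * (V * dV) by ring.
rewrite [(y * V) ^+ 2]exprMn {}y2.
have -> : r * (s / 2 - a) * V + r * l * Q = r * (dV + s / 2 * V) by rewrite dVE; field.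
have -> : r * (s / 2 - a) * dV + r * l * dQ = r * (- (s / 2) * dV - p * V).
  by rewrite dQE dVE pE sE; field.
rewrite -subr_ge0.
(* The origin of the factor [4] in the hypotheses: [a, b >= 4 * c] gives
   [1 / a + 1 / b <= 1 / (2 * c)] when [c > 0], that is, [a * b >= 2 * c * s]. *)
have pc : 2 * c * s <= p.
  suff : 0 <= a * b - 2 * c * s by rewrite pE; lra.
  rewrite (_ : _ - _ = ((a - 4 * c) * b + (b - 4 * c) * a) / 2); last by rewrite sE; field.
  by rewrite divr_ge0// addr_ge0// mulr_ge0//; lra.
have s0 : 0 <= s by rewrite sE; lra.
(* Up to [r ^+ 2], the loss [s * (dV ^+ 2 + p * V ^+ 2)] minus [c] times the energy. Its cross term
   [- c * s * dV * V] is absorbed in the first square, and [pc] keeps the coefficient of [V ^+ 2]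
   nonnegative. *)
rewrite (_ : _ - _ = r ^+ 2 * (c * (dV - s / 2 * V) ^+ 2 + (s - 2 * c) * dV ^+ 2 +
   V ^+ 2 * (s / 2 * (p - 2 * c * s) + (s / 2 - c) * p + c * s ^+ 2 / 4))); last by field.
have s2c : 0 <= s - 2 * c by rewrite sE; lra.
have sc : 0 <= s / 2 - c by rewrite sE; lra.
have pcs : 0 <= p - 2 * c * s by rewrite subr_ge0.
apply: mulr_ge0; first exact: sqr_ge0.
have h1 := mulr_ge0 c0 (sqr_ge0 (dV - s / 2 * V)).
have h2 := mulr_ge0 s2c (sqr_ge0 dV).
have h3 : 0 <= s / 2 * (p - 2 * c * s) + (s / 2 - c) * p + c * s ^+ 2 / 4.
  by (apply: addr_ge0; first apply: addr_ge0); rewrite ?divr_ge0// mulr_ge0 ?divr_ge0 ?sqr_ge0.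
exact: addr_ge0 (addr_ge0 h1 h2) (mulr_ge0 (sqr_ge0 V) h3).
Qed.

(** With [X = dV] and [Y = s * V], the difference without the term in [p] is
    [5 X^2 + 6 X Y + 2 Y^2], which is positive definite; [6] is the least integer constant for which
    this happens. *)
Lemma oscillator_energy_ge (a b l m r V Q s p dV y : R) :
  0 <= a -> 0 <= b -> 0 <= l * m ->
  s = a + b -> p = a * b + l * m -> dV = - a * V + l * Q ->
  y = r * Num.sqrt (s ^+ 2 / 4 + p) ->
  r ^+ 2 * (dV ^+ 2 + s ^+ 2 * V ^+ 2) <=
  6 * ((r * (s / 2 - a) * V + r * l * Q) ^+ 2 + (y * V) ^+ 2).
Proof.
move=> a0 b0 lm sE pE dVE yE.
have p0 : 0 <= p by rewrite pE addr_ge0// mulr_ge0.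
have y2 : y ^+ 2 = r ^+ 2 * (s ^+ 2 / 4 + p).
  by rewrite yE exprMn sqr_sqrtr// addr_ge0// divr_ge0// sqr_ge0.
have -> : r * (s / 2 - a) * V + r * l * Q = r * (dV + s / 2 * V) by rewrite dVE; field.
rewrite [(y * V) ^+ 2]exprMn {}y2 -subr_ge0.
rewrite (_ : _ - _ = r ^+ 2 * (5 * (dV + 3 / 5 * (s * V)) ^+ 2 + (s * V) ^+ 2 / 5 + 6 * p * V ^+ 2)); last by field.
apply: mulr_ge0; first exact: sqr_ge0.
have := sqr_ge0 (dV + 3 / 5 * (s * V)); have := sqr_ge0 (s * V).
have := mulr_ge0 p0 (sqr_ge0 V); rewrite -[6 * p * _]mulrA; lra.
Qed.

(** The product [a * b] in [p] is at most [s ^+ 2 / 4], so only [l * m] has to be added to [s ^+ 2]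
    on the right. *)
Lemma oscillator_energy_le (a b l m r V Q s p dV y : R) :
  0 <= a -> 0 <= b -> 0 <= l * m ->
  s = a + b -> p = a * b + l * m -> dV = - a * V + l * Q ->
  y = r * Num.sqrt (s ^+ 2 / 4 + p) ->
  (r * (s / 2 - a) * V + r * l * Q) ^+ 2 + (y * V) ^+ 2 <=
  3 / 2 * (r ^+ 2 * (dV ^+ 2 + (s ^+ 2 + l * m) * V ^+ 2)).
Proof.
move=> a0 b0 lm sE pE dVE yE.
have p0 : 0 <= p by rewrite pE addr_ge0// mulr_ge0.
have y2 : y ^+ 2 = r ^+ 2 * (s ^+ 2 / 4 + p).
  by rewrite yE exprMn sqr_sqrtr// addr_ge0// divr_ge0// sqr_ge0.
have -> : r * (s / 2 - a) * V + r * l * Q = r * (dV + s / 2 * V) by rewrite dVE; field.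
rewrite [(y * V) ^+ 2]exprMn {}y2 -subr_ge0.
rewrite (_ : _ - _ = r ^+ 2 * ((dV - s * V) ^+ 2 / 2 + (s ^+ 2 / 4 - a * b + s ^+ 2 / 4 + l * m / 2) * V ^+ 2)); last first.
  by rewrite pE; field.
apply: mulr_ge0; first exact: sqr_ge0.
apply: addr_ge0; first by rewrite divr_ge0// sqr_ge0.
apply: mulr_ge0; last exact: sqr_ge0.
rewrite (_ : s ^+ 2 / 4 - a * b = (a - b) ^+ 2 / 4); last by rewrite sE; field.
by (apply: addr_ge0; first apply: addr_ge0); rewrite divr_ge0// sqr_ge0.
Qed.

(** The energy is equivalent to the displayed quantities, and [9 = 6 * (3 / 2)] is the product of
    the two comparison constants. The signs of [l] and [m] are left free and a weight [r] is carried
    along, so that velocity and temperature are both instances. *)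
Lemma damped_oscillator_decay (P Q : R -> R2 -> R) (a b l m r : R2 -> R) (c : R) (S : set R2) :
  L2_curve P (fun t x => - a x * P t x + l x * Q t x) ->
  L2_curve Q (fun t x => - b x * Q t x - m x * P t x) ->
  measurable S -> measurable_fun setT a -> measurable_fun setT b ->
  measurable_fun setT l -> measurable_fun setT m -> measurable_fun setT r ->
  0 <= c -> (forall x, S x -> [/\ 4 * c <= a x, 4 * c <= b x & 0 <= l x * m x]) ->
  forall t, 0 <= t ->
  (\int[mu]_(x in S) (r x ^+ 2 * ((- a x * P t x + l x * Q t x) ^+ 2
      + (a x + b x) ^+ 2 * P t x ^+ 2))%:E <=
   (9 * expR (- c * t))%:E * \int[mu]_(x in S) (r x ^+ 2 * ((- a x * P 0 x + l x * Q 0 x) ^+ 2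
      + ((a x + b x) ^+ 2 + l x * m x) * P 0 x ^+ 2))%:E)%E.
Proof.
move=> CP CQ mS ma mb ml mm mr c0 HS t t0.
pose s x := a x + b x; pose p x := a x * b x + l x * m x.
have msf : measurable_fun setT s by exact: measurable_funD ma mb.
have mp : measurable_fun setT p by exact: (measurable_funD (measurable_funM ma mb) (measurable_funM ml mm)).
pose x1 x := r x * (s x / 2 - a x); pose x2 x := r x * l x.
pose y x := r x * Num.sqrt (s x ^+ 2 / 4 + p x).
have mx1 : measurable_fun setT x1.
  exact: (measurable_funM mr (measurable_funB (measurable_funM msf (measurable_cst (2^-1 : R))) ma)).
have mx2 : measurable_fun setT x2 by exact: (measurable_funM mr ml).
have my : measurable_fun setT y.
  have := measurable_funD (measurable_funM (measurable_funX 2 msf) (measurable_cst (4^-1 : R))) mp.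
  by move=> /measurable_funsqrt h; exact: (measurable_funM mr h).
have a0 x : S x -> [/\ 0 <= a x, 0 <= b x & 0 <= l x * m x].
  by move=> /HS[h1 h2 h3]; split => //; [move: h1|move: h2]; lra.
have mP u : 0 <= u -> measurable_fun setT (P u) by move=> /CP[/Lfun2P[]].
have mQ u : 0 <= u -> measurable_fun setT (Q u) by move=> /CQ[/Lfun2P[]].
pose X t xi := x1 xi * P t xi + x2 xi * Q t xi.
pose Y t xi := y xi * P t xi + 0 * Q t xi.
have YE u x : Y u x = y x * P u x by rewrite /Y mul0r addr0.
have mX u : 0 <= u -> measurable_fun setT (X u).
  by move=> u0; exact: (measurable_funD (measurable_funM mx1 (mP _ u0)) (measurable_funM mx2 (mQ _ u0))).
have mY u : 0 <= u -> measurable_fun setT (Y u).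
  by move=> u0; exact: (measurable_funD (measurable_funM my (mP _ u0)) (measurable_funM (measurable_cst (0 : R)) (mQ _ u0))).
have mXY u : 0 <= u -> measurable_fun S (fun x => (X u x ^+ 2 + Y u x ^+ 2)%:E).
  move=> u0; apply/measurable_EFinP; apply: measurable_funTS.
  exact: (measurable_funD (measurable_funX 2 (mX _ u0)) (measurable_funX 2 (mY _ u0))).
have mdP u : 0 <= u -> measurable_fun setT (fun x => - a x * P u x + l x * Q u x).
  by move=> /CP[_ /Lfun2P[]].
have XY0 u x : 0 <= X u x ^+ 2 + Y u x ^+ 2 by rewrite addr_ge0// sqr_ge0.
have D : (\int[mu]_(x in S) (X t x ^+ 2 + Y t x ^+ 2)%:E <=
   (expR (- c * t))%:E * \int[mu]_(x in S) (X 0%R x ^+ 2 + Y 0%R x ^+ 2)%:E)%E.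
  apply: (@weighted_energy_decay _ P Q _ _ x1 x2 y (cst 0) c S CP CQ) => //.
  move=> u x u0 Sx; have [h1 h2 h3] := HS _ Sx.
  have := @oscillator_dissipation (a x) (b x) (l x) (m x) c (r x) (P u x) (Q u x)
    _ _ _ _ _ c0 h1 h2 h3 erefl erefl erefl erefl erefl.
  by rewrite /= !mul0r !addr0.
apply: (@le_trans _ _ (6%:E * \int[mu]_(x in S) (X t x ^+ 2 + Y t x ^+ 2)%:E)%E).
  rewrite -ge0_integralZl_EFin//; last 2 first.
  - by move=> x _; rewrite lee_fin.
  - exact: mXY.
  apply: ge0_le_integral => //.
  - move=> x _; rewrite lee_fin; apply: mulr_ge0 (sqr_ge0 _) _; apply: addr_ge0 (sqr_ge0 _) _.
    by apply: mulr_ge0; exact: sqr_ge0.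
  - apply/measurable_EFinP; apply: measurable_funTS.
    exact: (measurable_funM (measurable_funX 2 mr) (measurable_funD (measurable_funX 2 (mdP _ t0))
      (measurable_funM (measurable_funX 2 msf) (measurable_funX 2 (mP _ t0))))).
  - by apply: measurable_funeM; exact: mXY.
  - move=> x Sx; have [h1 h2 h3] := a0 _ Sx; rewrite -EFinM lee_fin YE.
    exact: (oscillator_energy_ge h1 h2 h3).
apply: (@le_trans _ _ (6%:E * ((expR (- c * t))%:E * \int[mu]_(x in S) (X 0%R x ^+ 2 + Y 0%R x ^+ 2)%:E))%E).
  exact: lee_wpmul2l.
rewrite (_ : 9 * expR (- c * t) = 6 * expR (- c * t) * (3 / 2)); last by field.
rewrite muleA -EFinM [X in (_ <= X * _)%E]EFinM -muleA.
apply: lee_wpmul2l; first by rewrite lee_fin mulr_ge0// expR_ge0.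
have m0 : measurable_fun S (fun x => (r x ^+ 2 * ((- a x * P 0 x + l x * Q 0 x) ^+ 2
      + ((a x + b x) ^+ 2 + l x * m x) * P 0 x ^+ 2))%:E).
  apply/measurable_EFinP; apply: measurable_funTS.
  exact: (measurable_funM (measurable_funX 2 mr) (measurable_funD (measurable_funX 2 (mdP _ (lexx 0)))
      (measurable_funM (measurable_funD (measurable_funX 2 msf) (measurable_funM ml mm))
         (measurable_funX 2 (mP _ (lexx 0)))))).
have p0 x : S x -> (0 <= (r x ^+ 2 * ((- a x * P 0 x + l x * Q 0 x) ^+ 2
      + ((a x + b x) ^+ 2 + l x * m x) * P 0 x ^+ 2))%:E)%E.
  move=> /a0[_ _ h]; rewrite lee_fin mulr_ge0 ?sqr_ge0// addr_ge0 ?sqr_ge0//.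
  by rewrite mulr_ge0 ?sqr_ge0// addr_ge0// sqr_ge0.
rewrite -ge0_integralZl_EFin//.
apply: ge0_le_integral => //.
- by move=> x _; rewrite lee_fin.
- exact: mXY.
- exact: measurable_funeM.
- move=> x Sx; have [h1 h2 h3] := a0 _ Sx; rewrite -EFinM lee_fin YE.
  exact: (oscillator_energy_le h1 h2 h3).
Qed.

End damped_oscillator.

(** * Decay in frequency space *)

Section frequency_estimates.
Context {R : realType}.
Local Notation R2 := (measurableTypeR R * measurableTypeR R)%type.
Local Notation mu := (@leb2_sf R).
Variables (nu eta a1 a2 : R).
Hypotheses (nu0 : 0 < nu) (eta0 : 0 < eta) (a10 : 0 < a1) (a20 : 0 < a2).

Definition u_damping (xi : R2) : R := nu * xi.2 ^+ 2.
Definition theta_damping (xi : R2) : R := eta * xi.1 ^+ 2.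
Definition riesz11 (xi : R2) : R := xi.1 * xi.1 / sqnorm xi.
Definition riesz12 (xi : R2) : R := xi.1 * xi.2 / sqnorm xi.

Definition freq_set : set R2 := [set xi | a1 < `|xi.1| /\ a2 < `|xi.2|].

Definition rate : R := Num.min (nu * a2 ^+ 2) (eta * a1 ^+ 2) / 4.

(** For [q = |xi|^2 >= a1^2] one has [1 + q <= (1 + a1^2) (q / a1^2)^2], while the total damping is
    at least [Num.min nu eta * q]. The leading [1] ensures [gap >= 1], so that the same constant
    also covers the time derivative. *)
Definition gap : R := 1 + (1 + a1 ^+ 2) / (a1 ^+ 2 * Num.min nu eta) ^+ 2.

(** [gap] compares the estimated norms with the energy at time [t], [9] comes from
    [damped_oscillator_decay], and the last factor compares the initial energy with the norms of the
    data. *)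
Definition decay_const : R := gap * 9 * (4 * (nu + eta) ^+ 2 + 4).

Lemma rate_gt0 : 0 < rate.
Proof. by rewrite divr_gt0// lt_min !mulr_gt0// exprn_gt0. Qed.

Lemma gap_ge1 : 1 <= gap.
Proof. by rewrite lerDl divr_ge0 ?sqr_ge0// addr_ge0// sqr_ge0. Qed.

Lemma decay_const_gt0 : 0 < decay_const.
Proof.
rewrite /decay_const !mulr_gt0//; first exact: lt_le_trans gap_ge1.
by rewrite ltr_wpDl// mulr_ge0// sqr_ge0.
Qed.

Lemma freq_set_lower xi : freq_set xi ->
  [/\ a1 ^+ 2 <= xi.1 ^+ 2, a2 ^+ 2 <= xi.2 ^+ 2 & xi.1 != 0].
Proof.
move=> [h1 h2].
have E (a x : R) : 0 < a -> a < `|x| -> a ^+ 2 <= x ^+ 2.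
  by move=> a0 ax; rewrite -[x ^+ 2]real_normK ?num_real// ler_pXn2r ?nnegrE// ltW.
split; [exact: E|exact: E|].
by apply: contraTneq h1 => ->; rewrite normr0 -leNgt ltW.
Qed.

Lemma sqnorm_gt0 xi : freq_set xi -> 0 < sqnorm xi.
Proof.
move=> /freq_set_lower[h1 _ x0].
by rewrite /sqnorm ltr_wpDr ?sqr_ge0// lt_def sqrf_eq0 x0 sqr_ge0.
Qed.

Lemma rate_le xi : freq_set xi -> 4 * rate <= u_damping xi /\ 4 * rate <= theta_damping xi.
Proof.
move=> /freq_set_lower[h1 h2 _]; rewrite /rate /u_damping /theta_damping.
rewrite mulrCA mulfV ?mulr1//.
split; rewrite ge_min.
  by apply/orP; left; rewrite ler_pM2l.
by apply/orP; right; rewrite ler_pM2l.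
Qed.

Lemma riesz11_ge0 xi : 0 <= riesz11 xi.
Proof. by rewrite /riesz11 -expr2 divr_ge0 ?addr_ge0 ?sqr_ge0. Qed.

Lemma riesz11_le1 xi : riesz11 xi <= 1.
Proof.
rewrite /riesz11 -expr2.
have [->|n0] := eqVneq (sqnorm xi) 0; first by rewrite invr0 mulr0.
have n1 : 0 < sqnorm xi by rewrite lt_def n0 addr_ge0// sqr_ge0.
by rewrite ler_pdivrMr// mul1r lerDl sqr_ge0.
Qed.

Lemma gap_le xi : freq_set xi -> 1 + sqnorm xi <= gap * (u_damping xi + theta_damping xi) ^+ 2.
Proof.
move=> Sxi; have [h1 h2 _] := freq_set_lower Sxi.
have q0 := sqnorm_gt0 Sxi.
set k := Num.min nu eta; have k0 : 0 < k by rewrite lt_min nu0.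
have kq : k * sqnorm xi <= u_damping xi + theta_damping xi.
  rewrite /sqnorm mulrDr addrC lerD// ler_wpM2r ?sqr_ge0// ge_min lexx// orbT//.
have aq : a1 ^+ 2 <= sqnorm xi by apply: le_trans h1 _; rewrite lerDl sqr_ge0.
have a10' : 0 < a1 ^+ 2 by rewrite exprn_gt0.
have k2 : (k * sqnorm xi) ^+ 2 <= (u_damping xi + theta_damping xi) ^+ 2.
  rewrite ler_pXn2r// nnegrE ?(mulr_ge0 (ltW k0) (ltW q0))//.
  by rewrite addr_ge0// mulr_ge0 ?sqr_ge0// ltW.
have H : 1 + sqnorm xi <= (1 + a1 ^+ 2) / (a1 ^+ 2 * k) ^+ 2 * (k * sqnorm xi) ^+ 2.
  move: (sqnorm xi) (a1 ^+ 2) q0 aq a10' => q a q0 aq a_gt0.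
  rewrite (_ : _ * _ = (1 + a) * (q / a) ^+ 2); last by field; rewrite !gt_eqF.
  have ge1 : 1 <= q / a by rewrite ler_pdivlMr// mul1r.
  have qE : q = q / a * a by rewrite divfK// gt_eqF.
  rewrite [in X in X <= _]qE; move: (q / a) ge1 => z z1.
  rewrite -subr_ge0 (_ : _ - _ = (z - 1) * (z + 1) + a * (z * (z - 1))); last by ring.
  have z0 : 0 <= z - 1 by rewrite subr_ge0.
  have zp : 0 <= z by lra.
  by apply: addr_ge0; [apply: mulr_ge0 => //; lra|rewrite !mulr_ge0// ltW].
apply: (le_trans H); apply: (@le_trans _ _ (gap * (k * sqnorm xi) ^+ 2)).
  by rewrite ler_wpM2r ?sqr_ge0// /gap lerDr.
by rewrite ler_wpM2l// (le_trans ler01) ?gap_ge1.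
Qed.

Lemma damping_le xi :
  [/\ 0 <= u_damping xi, 0 <= theta_damping xi & u_damping xi + theta_damping xi <= (nu + eta) * (1 + sqnorm xi)].
Proof.
have x2 := sqr_ge0 xi.1; have y2 := sqr_ge0 xi.2.
rewrite /u_damping /theta_damping /sqnorm; split; [by rewrite mulr_ge0// ltW|by rewrite mulr_ge0// ltW|].
have h1 := mulr_ge0 (ltW nu0) x2; have h2 := mulr_ge0 (ltW eta0) y2.
move: (xi.1 ^+ 2) (xi.2 ^+ 2) h1 h2 => x y h1 h2; rewrite -subr_ge0.
rewrite (_ : _ - _ = nu + eta + nu * x + eta * y); last by ring.
by rewrite !addr_ge0// ltW.
Qed.

Lemma measurable_u_damping : measurable_fun setT u_damping.
Proof. exact: (measurable_funM (measurable_cst nu) (measurable_funX 2 measurable_snd)). Qed.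

Lemma measurable_theta_damping : measurable_fun setT theta_damping.
Proof. exact: (measurable_funM (measurable_cst eta) (measurable_funX 2 measurable_fst)). Qed.

Lemma measurable_sqnorm : measurable_fun setT (@sqnorm R : R2 -> R).
Proof.
exact: (measurable_funD (measurable_funX 2 measurable_fst) (measurable_funX 2 measurable_snd)).
Qed.

Lemma measurable_riesz11 : measurable_fun setT riesz11.
Proof.
exact: (measurable_funM (measurable_funM measurable_fst measurable_fst) (measurable_funV measurable_sqnorm)).
Qed.

Lemma measurable_riesz12 : measurable_fun setT riesz12.
Proof.
exact: (measurable_funM (measurable_funM measurable_fst measurable_snd) (measurable_funV measurable_sqnorm)).
Qed.

Lemma measurable_freq_set : measurable freq_set.
Proof.
have mn (f : R2 -> R) (a : R) : measurable_fun setT f -> measurable [set x | a < `|f x|].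
  move=> mf; rewrite -[X in measurable X]setTI.
  have m := measurableT_comp (@normr_measurable R setT) mf.
  have := m measurableT `]a, +oo[%classic (measurable_itv _).
  by congr measurable; apply/seteqP; split=> x /=; rewrite in_itv/= andbT.
by apply: measurableI; exact: mn.
Qed.

(** The Riesz terms cancel in [D = x.1 * V1 + x.2 * V2], which therefore satisfies
    [D' = - u_damping D]. Energy decay with rate [0] from a vanishing initial value is enough. *)
Lemma divergence_conserved (V1 V2 Th : R -> R2 -> R) :
  L2_curve V1 (fun t x => - u_damping x * V1 t x - riesz12 x * Th t x) ->
  L2_curve V2 (fun t x => - u_damping x * V2 t x + riesz11 x * Th t x) ->
  {ae mu, forall x : R2, x.1 * V1 0 x + x.2 * V2 0 x = 0} ->
  forall t, 0 <= t -> {ae mu, forall x : R2, x.1 * V1 t x + x.2 * V2 t x = 0}.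
Proof.
move=> C1 C2 D0 t t0.
have mD u : 0 <= u -> measurable_fun setT (fun x : R2 => x.1 * V1 u x + x.2 * V2 u x).
  move=> u0; have [/Lfun2P[m1 _] _ _] := C1 _ u0; have [/Lfun2P[m2 _] _ _] := C2 _ u0.
  exact: (measurable_funD (measurable_funM measurable_fst m1) (measurable_funM measurable_snd m2)).
apply: nsq_eq0; first exact: mD.
apply/eqP; rewrite eq_le nsq_ge0 andbT.
have := @weighted_energy_decay _ V1 V2 _ _ fst snd (cst 0) (cst 0) 0 setT C1 C2 measurableT
  measurable_fst measurable_snd (measurable_cst (0:R)) (measurable_cst (0:R)).
move=> /(_ _) /(_ t t0) E.
have E0 u : (\int[mu]_(x in setT) ((x.1 * V1 u x + x.2 * V2 u x) ^+ 2 +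
    (cst 0 x * V1 u x + cst 0 x * V2 u x) ^+ 2)%:E)%E = nsq mu (fun x : R2 => x.1 * V1 u x + x.2 * V2 u x)%R.
  by apply: eq_integral => x _; rewrite /= !mul0r addr0 expr0n/= addr0.
move: E; rewrite !E0.
rewrite [X in (_ * X)%E](_ : _ = 0%E) ?mule0; last first.
  rewrite -[RHS](_ : nsq mu (cst 0%R : R2 -> R) = 0%E); last first.
    by rewrite /nsq integral0_eq// => x _; rewrite expr0n.
  by apply: eq_nsq => //; exact: mD.
apply => u x u0 _ /=.
rewrite oppr0 !mul0r !addr0.
rewrite (_ : 2 * _ = - (2 * u_damping x * (x.1 * V1 u x + x.2 * V2 u x) ^+ 2)).
  by rewrite oppr_le0; apply: mulr_ge0 (sqr_ge0 _); rewrite mulr_ge0//; have [] := damping_le x.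
rewrite /riesz11 /riesz12; move: (V1 u x) (V2 u x) (Th u x) (u_damping x) (sqnorm x)^-1 => v w z a b.
by ring.
Qed.

Lemma integral_le_trans (S : set R2) (F G G0 H : R2 -> R) (A B e : R) : measurable S ->
  measurable_fun setT F -> measurable_fun setT G -> measurable_fun setT G0 -> measurable_fun setT H ->
  (forall x, 0 <= F x) -> (forall x, 0 <= G x) -> (forall x, 0 <= G0 x) -> (forall x, 0 <= H x) ->
  0 <= A -> 0 <= B -> 0 <= e ->
  {ae mu, forall x, S x -> F x <= A * G x} -> {ae mu, forall x, S x -> G0 x <= B * H x} ->
  (\int[mu]_(x in S) (G x)%:E <= e%:E * \int[mu]_(x in S) (G0 x)%:E)%E ->
  (\int[mu]_(x in S) (F x)%:E <= (A * e * B)%:E * \int[mu]_(x in S) (H x)%:E)%E.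
Proof.
move=> mS mF mG mG0 mH F0 G_0 G00 H0 A0 B0 e0 FG GH GG.
have le_int (f g : R2 -> R) (a : R) : measurable_fun setT f -> measurable_fun setT g ->
    (forall x, 0 <= f x) -> (forall x, 0 <= g x) -> 0 <= a ->
    {ae mu, forall x, S x -> f x <= a * g x} ->
    (\int[mu]_(x in S) (f x)%:E <= a%:E * \int[mu]_(x in S) (g x)%:E)%E.
  move=> mf mg f0 g0 a0 fg.
  have mEf : measurable_fun S (EFin \o f) by apply: measurable_funTS; exact/measurable_EFinP.
  have mEg : measurable_fun S (EFin \o g) by apply: measurable_funTS; exact/measurable_EFinP.
  rewrite -ge0_integralZl_EFin//; last by move=> x _; rewrite lee_fin.
  apply: ae_ge0_le_integral => //.
  - by move=> x _; rewrite lee_fin.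
  - by move=> x _; rewrite -EFinM lee_fin mulr_ge0.
  - exact: measurable_funeM.
apply: (le_trans (le_int _ _ _ mF mG F0 G_0 A0 FG)).
rewrite !EFinM -!muleA; apply: lee_wpmul2l => //; apply: (le_trans GG).
by apply: lee_wpmul2l => //; exact: le_int.
Qed.

Lemma sqr_orthogonal (x : R2) (u v : R) : x.1 != 0 -> x.1 * u + x.2 * v = 0 ->
  u ^+ 2 + v ^+ 2 = sqnorm x / x.1 ^+ 2 * v ^+ 2.
Proof.
move=> x0 H; have -> : u = - (x.2 / x.1 * v).
  by apply: (mulfI x0); rewrite mulrN mulrA [x.1 * (_ / _)]mulrC divfK//; apply/eqP; rewrite -addr_eq0 H.
by rewrite /sqnorm; field.
Qed.

(** The oscillator is the pair [V2], [Th] with coupling [riesz11 * 1]; orthogonality to the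
    frequency converts the estimate of [V2], weighted by [r], into one of the whole velocity. *)
Lemma velocity_decay (V1 V2 Th : R -> R2 -> R) :
  L2_curve V1 (fun t x => - u_damping x * V1 t x - riesz12 x * Th t x) ->
  L2_curve V2 (fun t x => - u_damping x * V2 t x + riesz11 x * Th t x) ->
  L2_curve Th (fun t x => - theta_damping x * Th t x - V2 t x) ->
  {ae mu, forall x : R2, x.1 * V1 0 x + x.2 * V2 0 x = 0} ->
  forall t, 0 <= t ->
  (\int[mu]_(x in freq_set) ((- u_damping x * V1 t x - riesz12 x * Th t x) ^+ 2 +
     (- u_damping x * V2 t x + riesz11 x * Th t x) ^+ 2 +
     (1 + sqnorm x) * (V1 t x ^+ 2 + V2 t x ^+ 2))%:E <=
   (decay_const * expR (- rate * t))%:E * \int[mu]_(x in freq_set)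
     ((1 + sqnorm x) ^+ 2 * (V1 0 x ^+ 2 + V2 0 x ^+ 2) + Th 0 x ^+ 2)%:E)%E.
Proof.
move=> C1 C2 C3 D0 t t0.
have Dt := divergence_conserved C1 C2 D0 t0.
have lx := lexx (0 : R).
(* [r^2 V2^2 = V1^2 + V2^2] because [x.1 V1 + x.2 V2 = 0]. *)
pose r (x : R2) := Num.sqrt (sqnorm x) / x.1.
have mr : measurable_fun setT r.
  exact: (measurable_funM (measurable_funsqrt measurable_sqnorm) (measurable_funV measurable_fst)).
have r2 x : r x ^+ 2 = sqnorm x / x.1 ^+ 2.
  by rewrite /r exprMn exprVn sqr_sqrtr// addr_ge0// sqr_ge0.
have C3' : L2_curve Th (fun t x => - theta_damping x * Th t x - 1 * V2 t x).
  by under eq_fun => u do (under eq_fun => x do rewrite mul1r).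
have mV1 u : 0 <= u -> measurable_fun setT (V1 u) by move=> /C1[/Lfun2P[]].
have mV2 u : 0 <= u -> measurable_fun setT (V2 u) by move=> /C2[/Lfun2P[]].
have mTh u : 0 <= u -> measurable_fun setT (Th u) by move=> /C3[/Lfun2P[]].
have mdV1 u : 0 <= u -> measurable_fun setT (fun x => - u_damping x * V1 u x - riesz12 x * Th u x).
  by move=> /C1[_ /Lfun2P[]].
have mdV2 u : 0 <= u -> measurable_fun setT (fun x => - u_damping x * V2 u x + riesz11 x * Th u x).
  by move=> /C2[_ /Lfun2P[]].
have mq := measurable_funD (measurable_cst (1:R)) measurable_sqnorm.
have msum : measurable_fun setT (fun x => u_damping x + theta_damping x) by exact: measurable_funD measurable_u_damping measurable_theta_damping.
have q0 (x : R2) : 0 <= sqnorm x by rewrite addr_ge0// sqr_ge0.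
have := damped_oscillator_decay C2 C3' measurable_freq_set measurable_u_damping measurable_theta_damping
  measurable_riesz11 (measurable_cst (1:R)) mr (ltW rate_gt0) _ t0.
move=> /(_ _) E.
rewrite (_ : decay_const * _ = gap * (9 * expR (- rate * t)) * (4 * (nu + eta) ^+ 2 + 4)); last first.
  by rewrite /decay_const; ring.
have gap0 : 0 <= gap by rewrite (le_trans ler01) ?gap_ge1.
apply: integral_le_trans (E _).
- exact: measurable_freq_set.
- exact: (measurable_funD (measurable_funD (measurable_funX 2 (mdV1 _ t0)) (measurable_funX 2 (mdV2 _ t0)))
    (measurable_funM mq (measurable_funD (measurable_funX 2 (mV1 _ t0)) (measurable_funX 2 (mV2 _ t0))))).
- exact: (measurable_funM (measurable_funX 2 mr) (measurable_funD (measurable_funX 2 (mdV2 _ t0))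
    (measurable_funM (measurable_funX 2 msum) (measurable_funX 2 (mV2 _ t0))))).
- exact: (measurable_funM (measurable_funX 2 mr) (measurable_funD (measurable_funX 2 (mdV2 _ lx))
    (measurable_funM (measurable_funD (measurable_funX 2 msum)
      (measurable_funM measurable_riesz11 (measurable_cst (1:R)))) (measurable_funX 2 (mV2 _ lx))))).
- exact: (measurable_funD (measurable_funM (measurable_funX 2 mq)
    (measurable_funD (measurable_funX 2 (mV1 _ lx)) (measurable_funX 2 (mV2 _ lx)))) (measurable_funX 2 (mTh _ lx))).
- move=> x; apply: addr_ge0; first by rewrite addr_ge0// sqr_ge0.
  by apply: mulr_ge0; rewrite addr_ge0// sqr_ge0.
- move=> x; apply: mulr_ge0 (sqr_ge0 _) _; apply: addr_ge0 (sqr_ge0 _) _.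
  by apply: mulr_ge0; exact: sqr_ge0.
- move=> x; apply: mulr_ge0 (sqr_ge0 _) _; apply: addr_ge0 (sqr_ge0 _) _.
  by apply: mulr_ge0 (sqr_ge0 _); rewrite addr_ge0 ?sqr_ge0// mulr1 riesz11_ge0.
- move=> x; apply: addr_ge0 (sqr_ge0 _); apply: mulr_ge0 (sqr_ge0 _) _.
  by rewrite addr_ge0// sqr_ge0.
- exact: gap0.
- by rewrite addr_ge0// mulr_ge0// sqr_ge0.
- by rewrite mulr_ge0// expR_ge0.
- apply: filterS Dt => x Dx Sx; have [_ _ x0] := freq_set_lower Sx.
  (* The time derivative of the velocity is orthogonal to the frequency as well, so its first
     component is recovered in the same way. *)
  have dD : x.1 * (- u_damping x * V1 t x - riesz12 x * Th t x) +
      x.2 * (- u_damping x * V2 t x + riesz11 x * Th t x) = 0.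
    rewrite -[RHS](mulr0 (- u_damping x)) -Dx /riesz11 /riesz12.
    move: (V1 t x) (V2 t x) (Th t x) (u_damping x) (sqnorm x)^-1 => v w z a b.
    by ring.
  rewrite (sqr_orthogonal x0 dD) (sqr_orthogonal x0 Dx) r2.
  have := gap_le Sx; have := gap_ge1.
  have : 0 <= sqnorm x / x.1 ^+ 2 by rewrite divr_ge0// sqr_ge0.
  move: (sqr_ge0 (V2 t x)) (sqr_ge0 (- u_damping x * V2 t x + riesz11 x * Th t x)).
  move: (V2 t x ^+ 2) ((- u_damping x * V2 t x + riesz11 x * Th t x) ^+ 2)
    (sqnorm x / x.1 ^+ 2) ((u_damping x + theta_damping x) ^+ 2) => v w o s v0 w0 o0 g1 gs.
  rewrite -subr_ge0.
  rewrite (_ : _ - _ = o * ((gap - 1) * w + (gap * s - (1 + sqnorm x)) * v)); last by ring.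
  by rewrite mulr_ge0// addr_ge0// mulr_ge0// subr_ge0.
- apply: filterS D0 => x Dx Sx; have [_ _ x0] := freq_set_lower Sx.
  rewrite (sqr_orthogonal x0 Dx) mulr1 r2.
  have sq := sqnorm_gt0 Sx.
  (* The weight [r x ^+ 2] is [1 / riesz11 x]. It meets the temperature only through
     [riesz11 x ^+ 2], so a factor [riesz11 x <= 1] remains and the initial temperature is needed in
     L^2 only. *)
  have ok : sqnorm x / x.1 ^+ 2 * riesz11 x = 1.
    by rewrite /riesz11 -expr2; field; rewrite x0 gt_eqF.
  have := riesz11_ge0 x; have := riesz11_le1 x.
  have : 0 <= sqnorm x / x.1 ^+ 2 by rewrite divr_ge0// sqr_ge0.
  have [a0 b0 ab] := damping_le x.
  move: ab ok a0 b0 (q0 x).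
  move: (V2 0 x) (Th 0 x) (riesz11 x) (u_damping x) (theta_damping x) (sqnorm x) (sqnorm x / x.1 ^+ 2) (nu + eta)
    => v z k a b q o M ab ok a0 b0 {}q0 o0 k1 k0.
  have ab2 : (a + b) ^+ 2 <= M ^+ 2 * (1 + q) ^+ 2.
    by rewrite -exprMn ler_pXn2r// nnegrE ?addr_ge0// (le_trans _ ab)// addr_ge0.
  have aa2 : a ^+ 2 <= (a + b) ^+ 2 by rewrite ler_pXn2r// ?nnegrE ?addr_ge0// lerDl.
  have q1 : 1 <= (1 + q) ^+ 2 by rewrite -[X in X <= _](expr1n _ 2) ler_pXn2r// ?nnegrE ?addr_ge0// lerDl.
  have n0 := mulr_ge0 o0 (sqr_ge0 v).
  rewrite -subr_ge0.
  (* Based on [(k z - a v)^2 = 2 a^2 v^2 + 2 k^2 z^2 - (a v + k z)^2]; the other terms are the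
     slacks in [a <= a + b <= M (1 + q)], [1 <= 1 + q] and [k <= 1]. *)
  rewrite (_ : _ - _ = o * (a * v + k * z) ^+ 2 + o * v ^+ 2 * (
      2 * ((a + b) ^+ 2 - a ^+ 2) + 3 * (M ^+ 2 * (1 + q) ^+ 2 - (a + b) ^+ 2) +
      M ^+ 2 * (1 + q) ^+ 2 + 4 * ((1 + q) ^+ 2 - 1) + (1 - k) + 3) +
      z ^+ 2 * (4 * M ^+ 2 + 2 + 2 * (1 - o * k * k))); last by ring.
  have M2 := sqr_ge0 M; have Mq := mulr_ge0 M2 (sqr_ge0 (1 + q)).
  apply: addr_ge0; first apply: addr_ge0.
  + by rewrite mulr_ge0// sqr_ge0.
  + by apply: mulr_ge0 => //; lra.
  + by apply: mulr_ge0; [exact: sqr_ge0|rewrite ok; lra].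
- move=> x Sx; have [h1 h2] := rate_le Sx; split => //.
  by rewrite mulr1 riesz11_ge0.
Qed.

(** The roles are exchanged: [Th] is the oscillating unknown, with [l = -1] and [m = - riesz11],
    whose product is again [riesz11]. No other component has to be recovered, so the weight [r] is
    [1]. *)
Lemma temperature_decay (V2 Th : R -> R2 -> R) :
  L2_curve V2 (fun t x => - u_damping x * V2 t x + riesz11 x * Th t x) ->
  L2_curve Th (fun t x => - theta_damping x * Th t x - V2 t x) ->
  forall t, 0 <= t ->
  (\int[mu]_(x in freq_set) ((- theta_damping x * Th t x - V2 t x) ^+ 2 +
     (1 + sqnorm x) * Th t x ^+ 2)%:E <=
   (decay_const * expR (- rate * t))%:E * \int[mu]_(x in freq_set)
     ((1 + sqnorm x) ^+ 2 * Th 0 x ^+ 2 + V2 0 x ^+ 2)%:E)%E.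
Proof.
move=> C2 C3 t t0.
have lx := lexx (0 : R).
have dThE u x : - theta_damping x * Th u x + - 1 * V2 u x = - theta_damping x * Th u x - V2 u x by rewrite mulN1r.
have C3' : L2_curve Th (fun t x => - theta_damping x * Th t x + cst (- 1) x * V2 t x).
  by under eq_fun => u do (under eq_fun => x do rewrite /= dThE).
have C2' : L2_curve V2 (fun t x => - u_damping x * V2 t x - (fun x => - riesz11 x) x * Th t x).
  by under eq_fun => u do (under eq_fun => x do rewrite /= [- riesz11 x * _]mulNr opprK).
have mk : measurable_fun setT (fun x => - riesz11 x).
  exact: (measurableT_comp (@oppr_measurable R setT) measurable_riesz11).
have mV2 u : 0 <= u -> measurable_fun setT (V2 u) by move=> /C2[/Lfun2P[]].
have mTh u : 0 <= u -> measurable_fun setT (Th u) by move=> /C3[/Lfun2P[]].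
have mdTh u : 0 <= u -> measurable_fun setT (fun x => - theta_damping x * Th u x - V2 u x).
  by move=> /C3[_ /Lfun2P[]].
have mdTh' u : 0 <= u -> measurable_fun setT (fun x => - theta_damping x * Th u x + cst (- 1) x * V2 u x).
  by move=> /C3'[_ /Lfun2P[]].
have mq := measurable_funD (measurable_cst (1:R)) measurable_sqnorm.
have msum : measurable_fun setT (fun x => theta_damping x + u_damping x) by exact: measurable_funD measurable_theta_damping measurable_u_damping.
have q0 (x : R2) : 0 <= sqnorm x by rewrite addr_ge0// sqr_ge0.
have := damped_oscillator_decay C3' C2' measurable_freq_set measurable_theta_damping measurable_u_damping
  (measurable_cst (-1:R)) mk (measurable_cst (1:R)) (ltW rate_gt0) _ t0.
move=> /(_ _) E.
rewrite (_ : decay_const * _ = gap * (9 * expR (- rate * t)) * (4 * (nu + eta) ^+ 2 + 4)); last first.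
  by rewrite /decay_const; ring.
have gap0 : 0 <= gap by rewrite (le_trans ler01) ?gap_ge1.
apply: integral_le_trans (E _).
- exact: measurable_freq_set.
- exact: (measurable_funD (measurable_funX 2 (mdTh _ t0)) (measurable_funM mq (measurable_funX 2 (mTh _ t0)))).
- exact: (measurable_funM (measurable_funX 2 (measurable_cst (1:R))) (measurable_funD (measurable_funX 2 (mdTh' _ t0))
    (measurable_funM (measurable_funX 2 msum) (measurable_funX 2 (mTh _ t0))))).
- exact: (measurable_funM (measurable_funX 2 (measurable_cst (1:R))) (measurable_funD (measurable_funX 2 (mdTh' _ lx))
    (measurable_funM (measurable_funD (measurable_funX 2 msum)
      (measurable_funM (measurable_cst (-1:R)) mk)) (measurable_funX 2 (mTh _ lx))))).
- exact: (measurable_funD (measurable_funM (measurable_funX 2 mq)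
    (measurable_funX 2 (mTh _ lx))) (measurable_funX 2 (mV2 _ lx))).
- move=> x; apply: addr_ge0 (sqr_ge0 _) _.
  by apply: mulr_ge0 (sqr_ge0 _); rewrite addr_ge0.
- move=> x; apply: mulr_ge0 (sqr_ge0 _) _; apply: addr_ge0 (sqr_ge0 _) _.
  by apply: mulr_ge0; exact: sqr_ge0.
- move=> x; apply: mulr_ge0 (sqr_ge0 _) _; apply: addr_ge0 (sqr_ge0 _) _.
  by apply: mulr_ge0 (sqr_ge0 _); rewrite addr_ge0 ?sqr_ge0// mulrN mulN1r opprK riesz11_ge0.
- move=> x; apply: addr_ge0 (sqr_ge0 _); apply: mulr_ge0 (sqr_ge0 _) _.
  exact: sqr_ge0.
- exact: gap0.
- by rewrite addr_ge0// mulr_ge0// sqr_ge0.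
- by rewrite mulr_ge0// expR_ge0.
- apply/aeW => x Sx; rewrite /= dThE expr1n mul1r.
  have := gap_le Sx; have := gap_ge1; rewrite (addrC (u_damping x)).
  move: (sqr_ge0 (Th t x)) (sqr_ge0 (- theta_damping x * Th t x - V2 t x)).
  move: (Th t x ^+ 2) ((- theta_damping x * Th t x - V2 t x) ^+ 2)
    ((theta_damping x + u_damping x) ^+ 2) => v w s v0 w0 g1 gs.
  rewrite -subr_ge0.
  rewrite (_ : _ - _ = (gap - 1) * w + (gap * s - (1 + sqnorm x)) * v); last by ring.
  by rewrite addr_ge0// mulr_ge0// subr_ge0.
- apply/aeW => x Sx; rewrite /= dThE expr1n mul1r.
  have := riesz11_le1 x.
  have [a0 b0 ab] := damping_le x.
  move: ab a0 b0 (q0 x).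
  move: (V2 0 x) (Th 0 x) (riesz11 x) (u_damping x) (theta_damping x) (sqnorm x) (nu + eta)
    => z v k b a q M ab b0 a0 {}q0 k1.
  have ab2 : (a + b) ^+ 2 <= M ^+ 2 * (1 + q) ^+ 2.
    rewrite addrC in ab.
    by rewrite -exprMn ler_pXn2r// nnegrE ?addr_ge0// (le_trans _ ab)// addr_ge0.
  have aa2 : a ^+ 2 <= (a + b) ^+ 2 by rewrite ler_pXn2r// ?nnegrE ?addr_ge0// lerDl.
  have q1 : 1 <= (1 + q) ^+ 2 by rewrite -[X in X <= _](expr1n _ 2) ler_pXn2r// ?nnegrE ?addr_ge0// lerDl.
  rewrite -subr_ge0.
  rewrite (_ : _ - _ = (a * v - z) ^+ 2 + v ^+ 2 * (
      2 * ((a + b) ^+ 2 - a ^+ 2) + 3 * (M ^+ 2 * (1 + q) ^+ 2 - (a + b) ^+ 2) +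
      M ^+ 2 * (1 + q) ^+ 2 + 4 * ((1 + q) ^+ 2 - 1) + (1 - k) + 3) +
      z ^+ 2 * (4 * M ^+ 2 + 2)); last by ring.
  have M2 := sqr_ge0 M; have Mq := mulr_ge0 M2 (sqr_ge0 (1 + q)).
  apply: addr_ge0; first apply: addr_ge0.
  + exact: sqr_ge0.
  + by apply: mulr_ge0 (sqr_ge0 _) _; lra.
  + by apply: mulr_ge0 (sqr_ge0 _) _; lra.
- move=> x Sx; have [h1 h2] := rate_le Sx; split => //.
  by rewrite /= mulrN mulN1r opprK riesz11_ge0.
Qed.

End frequency_estimates.

(** * Solutions of the system *)

Section solutions.
Context {R : realType}.
Local Notation R2 := (measurableTypeR R * measurableTypeR R)%type.
Local Notation mu := (@leb2_sf R).
Local Notation L2f := (Lfun mu 2%:E).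
Implicit Types (f g D : R2 -> R).

(** The derivative is replaced by an explicit function [D] that agrees with it almost everywhere, so
    that the algebra of the energy holds at every frequency, as [weighted_energy_decay] requires. *)
Lemma L2_curve_fourier b (w D : R -> R2 -> R) :
  (forall t, 0 <= t -> w t \in L2f) ->
  (forall t, 0 <= t -> measurable_fun setT (D t)) ->
  (forall t, 0 <= t -> exists2 g, time_derivative w t g &
     {ae mu, forall xi, fpart b g xi = D t xi}) ->
  L2_curve (fcurve b w) D.
Proof.
move=> w2 mD H t t0; have [g /time_derivativeE[g2 Dg] gD] := H t t0.
have mg := measurable_fpart b g2.
have D2 : D t \in L2f.
  apply/Lfun2P; split; first exact: mD.
  rewrite -(eq_nsq mg (mD _ t0) gD).
  by have /Lfun2P[] := L2_fpart b g2.
split => //; first exact: L2_fpart (w2 _ t0).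
apply: cvge0_le (nsq_derivative_fpart b w2 g2 t0 Dg); first by move=> h; exact: nsq_ge0.
apply: filterS (time_filter_ge0 t) => h th.
have mq := measurable_fcurve_quotient b w2 t0 th.
rewrite le_eqVlt; apply/orP; left; apply/eqP; apply: eq_nsq.
- exact: (measurable_funB mq (mD _ t0)).
- exact: (measurable_funB mq mg).
- by apply: filterS gD => xi ->.
Qed.

Lemma d11_symbolE : @d11_symbol R = fun xi => (- xi.1 ^+ 2)%:C%C.
Proof.
by apply/funext => xi; rewrite /d11_symbol /d1_symbol; apply/eqP; rewrite eq_complex /=;
  rewrite !mul0r !mulr0 addr0 sub0r expr2 !eqxx.
Qed.

Lemma d22_symbolE : @d22_symbol R = fun xi => (- xi.2 ^+ 2)%:C%C.
Proof.
by apply/funext => xi; rewrite /d22_symbol /d2_symbol; apply/eqP; rewrite eq_complex /=;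
  rewrite !mul0r !mulr0 addr0 sub0r expr2 !eqxx.
Qed.

Lemma multiplier_imaginary (m : R2 -> R) f g : multiplier (fun xi => (0 +i* m xi)%C) f g ->
  forall b, {ae mu, forall xi, fpart b g xi = (if b then - m xi else m xi) * fpart (~~ b) f xi}.
Proof.
move=> [_ _ H] b.
have {}H : {ae mu, forall xi : R2, fourier g xi = (0 +i* m xi)%C * fourier f xi} by [].
apply: filterS H => xi; rewrite /fpart => ->.
by case: (fourier f xi) => x y; case: b; rewrite /= ?mul0r ?sub0r ?add0r// mulNr.
Qed.

Lemma fpart_ae_eq b f g : f \in L2f -> g \in L2f -> f = g %[ae mu] -> fpart b f = fpart b g.
Proof.
move=> /Lfun2P[mf _] /Lfun2P[mg _] fg; rewrite /fpart (eq_ae_fourier mf mg)//.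
by apply: filterS fg => x; apply.
Qed.

Lemma fpart_divergence_free f1 f2 : divergence_free f1 f2 -> forall b,
  {ae mu, forall xi : R2, xi.1 * fpart b f1 xi + xi.2 * fpart b f2 xi = 0}.
Proof.
move=> [g1 [g2 [m1 m2 g0]]] b.
have [f12 g12] := multiplier_L2 m1; have [f22 g22] := multiplier_L2 m2.
have {}g0 : {ae mu, forall x : R2, [set: R2] x -> g1 x + g2 x = 0} := g0.
have lin := fpart_lin (~~ b) 1 1 g12 g22.
(* The zero function is written as a linear combination, so that [fpart_lin] also yields the
   vanishing of its transform. *)
have zero := fpart_lin (~~ b) 0 0 g12 g12.
have E : fpart (~~ b) (fun x => 1 * g1 x + 1 * g2 x) = fpart (~~ b) (fun x => 0 * g1 x + 0 * g1 x).
  apply: fpart_ae_eq; [exact: L2_lin|exact: L2_lin|].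
  by apply: filterS g0 => x /= h /h; rewrite !mul1r !mul0r addr0.
rewrite E in lin.
have := multiplier_imaginary m2 (~~ b); have := multiplier_imaginary m1 (~~ b).
rewrite negbK => a1 a2; apply: filterS3 (filterI a1 a2) lin zero => xi [-> ->] ->.
move: (fpart b f1 xi) (fpart b f2 xi) (fpart (~~ b) g1 xi) => x y z.
rewrite !mul1r !mul0r addr0; case: (~~ b) => [e|->//].
by apply/eqP; rewrite -oppr_eq0 opprD -!mulNr e.
Qed.

Section system.
Variables (nu eta : R) (u01 u02 theta0 : R * R -> R) (u1 u2 theta : R -> R * R -> R).
Hypothesis sol : solution nu eta u01 u02 theta0 u1 u2 theta.

Lemma solution_L2 t : 0 <= t -> [/\ u1 t \in L2f, u2 t \in L2f & theta t \in L2f].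
Proof. exact: (sol_L2 sol). Qed.

Let u1_2 t : 0 <= t -> u1 t \in L2f. Proof. by move=> /solution_L2[]. Qed.
Let u2_2 t : 0 <= t -> u2 t \in L2f. Proof. by move=> /solution_L2[]. Qed.
Let theta_2 t : 0 <= t -> theta t \in L2f. Proof. by move=> /solution_L2[]. Qed.

Definition u1_rhs b t (xi : R2) := - u_damping nu xi * fcurve b u1 t xi - riesz12 xi * fcurve b theta t xi.
Definition u2_rhs b t (xi : R2) := - u_damping nu xi * fcurve b u2 t xi + riesz11 xi * fcurve b theta t xi.
Definition theta_rhs b t (xi : R2) := - theta_damping eta xi * fcurve b theta t xi - fcurve b u2 t xi.

Let mvisc := measurableT_comp (@oppr_measurable R setT) (@measurable_u_damping R nu).
Let mdiff := measurableT_comp (@oppr_measurable R setT) (@measurable_theta_damping R eta).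

Lemma fourier_u1 t : 0 <= t -> exists g, time_derivative u1 t g /\
  forall b, {ae mu, forall xi, fpart b g xi = u1_rhs b t xi}.
Proof.
move=> t0; have [d [r [md mr D]]] := sol_u1 sol t0; eexists; split; first exact: D.
move=> b; rewrite d22_symbolE in md.
have [_ d2] := multiplier_L2 md; have [_ r2] := multiplier_L2 mr.
have := fpart_lin b nu (-1) d2 r2.
rewrite (_ : (fun x => nu * d x + -1 * r x) = (fun x => nu * d x - r x)); last first.
  by apply/funext => x; rewrite mulN1r.
apply: filterS3 (multiplier_real md b) (multiplier_real mr b) => xi e1 e2 ->.
rewrite e1 e2 /u1_rhs /u_damping /riesz12 /fcurve.
by move: (fpart b (u1 t) xi) (fpart b (theta t) xi) (sqnorm xi)^-1 => v w z; ring.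
Qed.

Lemma fourier_u2 t : 0 <= t -> exists g, time_derivative u2 t g /\
  forall b, {ae mu, forall xi, fpart b g xi = u2_rhs b t xi}.
Proof.
move=> t0; have [d [r [md mr D]]] := sol_u2 sol t0; eexists; split; first exact: D.
move=> b; rewrite d22_symbolE in md.
have [_ d2] := multiplier_L2 md; have [_ r2] := multiplier_L2 mr.
have := fpart_lin b nu 1 d2 r2.
rewrite (_ : (fun x => nu * d x + 1 * r x) = (fun x => nu * d x + r x)); last first.
  by apply/funext => x; rewrite mul1r.
apply: filterS3 (multiplier_real md b) (multiplier_real mr b) => xi e1 e2 ->.
rewrite e1 e2 /u2_rhs /u_damping /riesz11 /fcurve.
by move: (fpart b (u2 t) xi) (fpart b (theta t) xi) (sqnorm xi)^-1 => v w z; ring.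
Qed.

Lemma fourier_theta t : 0 <= t -> exists g, time_derivative theta t g /\
  forall b, {ae mu, forall xi, fpart b g xi = theta_rhs b t xi}.
Proof.
move=> t0; have [d [md D]] := sol_theta sol t0; eexists; split; first exact: D.
move=> b; rewrite d11_symbolE in md.
have [_ d2] := multiplier_L2 md.
have := fpart_lin b eta (-1) d2 (u2_2 t0).
rewrite (_ : (fun x => eta * d x + -1 * u2 t x) = (fun x => eta * d x - u2 t x)); last first.
  by apply/funext => x; rewrite mulN1r.
apply: filterS2 (multiplier_real md b) => xi e1 ->.
rewrite e1 /theta_rhs /theta_damping /fcurve.
by move: (fpart b (u2 t) xi) (fpart b (theta t) xi) => v w; ring.
Qed.

Lemma measurable_u1_rhs b t : 0 <= t -> measurable_fun setT (u1_rhs b t).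
Proof.
move=> t0; have mu1 := measurable_fpart b (u1_2 t0); have mth := measurable_fpart b (theta_2 t0).
exact: (measurable_funB (measurable_funM mvisc mu1) (measurable_funM measurable_riesz12 mth)).
Qed.

Lemma measurable_u2_rhs b t : 0 <= t -> measurable_fun setT (u2_rhs b t).
Proof.
move=> t0; have mu2 := measurable_fpart b (u2_2 t0); have mth := measurable_fpart b (theta_2 t0).
exact: (measurable_funD (measurable_funM mvisc mu2) (measurable_funM measurable_riesz11 mth)).
Qed.

Lemma measurable_theta_rhs b t : 0 <= t -> measurable_fun setT (theta_rhs b t).
Proof.
move=> t0; have mu2 := measurable_fpart b (u2_2 t0); have mth := measurable_fpart b (theta_2 t0).
exact: (measurable_funB (measurable_funM mdiff mth) mu2).
Qed.

Lemma curve_u1 b : L2_curve (fcurve b u1) (u1_rhs b).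
Proof.
apply: L2_curve_fourier => // t t0; first exact: measurable_u1_rhs.
by have [g [Dg /(_ b) gD]] := fourier_u1 t0; exists g.
Qed.

Lemma curve_u2 b : L2_curve (fcurve b u2) (u2_rhs b).
Proof.
apply: L2_curve_fourier => // t t0; first exact: measurable_u2_rhs.
by have [g [Dg /(_ b) gD]] := fourier_u2 t0; exists g.
Qed.

Lemma curve_theta b : L2_curve (fcurve b theta) (theta_rhs b).
Proof.
apply: L2_curve_fourier => // t t0; first exact: measurable_theta_rhs.
by have [g [Dg /(_ b) gD]] := fourier_theta t0; exists g.
Qed.

End system.

(** * Sobolev norms in frequency space *)

Definition freq_energy (k : nat) (S : set R2) f : \bar R :=
  (\int[mu]_(xi in S) ((1 + sqnorm xi) ^+ k * f xi ^+ 2)%:E)%E.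

Lemma measurable_bessel_weight (k : nat) f : measurable_fun setT f ->
  measurable_fun setT (fun xi : R2 => ((1 + sqnorm xi) ^+ k * f xi ^+ 2)%:E).
Proof.
move=> mf; apply/measurable_EFinP.
have mq := measurable_funD (measurable_cst (1:R)) (@measurable_sqnorm R).
exact: (measurable_funM (measurable_funX k mq) (measurable_funX 2 mf)).
Qed.

Lemma bessel_weight_ge0 (k : nat) f (xi : R2) : (0 <= ((1 + sqnorm xi) ^+ k * f xi ^+ 2)%:E)%E.
Proof.
by rewrite lee_fin mulr_ge0 ?sqr_ge0// exprn_ge0// addr_ge0// addr_ge0// sqr_ge0.
Qed.

Lemma freq_energy_ge0 k S f : (0 <= freq_energy k S f)%E.
Proof. by apply: integral_ge0 => xi _; exact: bessel_weight_ge0. Qed.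

Lemma freq_energyD (i j : nat) (S : set R2) (f g : R2 -> R) : measurable S ->
  measurable_fun setT f -> measurable_fun setT g ->
  (freq_energy i S f + freq_energy j S g =
   \int[mu]_(xi in S) ((1 + sqnorm xi) ^+ i * f xi ^+ 2 + (1 + sqnorm xi) ^+ j * g xi ^+ 2)%:E)%E.
Proof.
move=> mS mf mg; rewrite /freq_energy.
have mw n (u : R2 -> R) : measurable_fun setT u ->
    measurable_fun S (fun xi : R2 => ((1 + sqnorm xi) ^+ n * u xi ^+ 2)%:E).
  by move=> mu'; apply: measurable_funTS; exact: measurable_bessel_weight.
by rewrite -ge0_integralD//; [move=> x _; exact: bessel_weight_ge0|exact: mw
  |move=> x _; exact: bessel_weight_ge0|exact: mw].
Qed.

Lemma freq_energyD4 (i j k n : nat) (S : set R2) (f g h u : R2 -> R) : measurable S ->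
  measurable_fun setT f -> measurable_fun setT g -> measurable_fun setT h -> measurable_fun setT u ->
  (freq_energy i S f + freq_energy j S g + (freq_energy k S h + freq_energy n S u) =
   \int[mu]_(xi in S) ((1 + sqnorm xi) ^+ i * f xi ^+ 2 + (1 + sqnorm xi) ^+ j * g xi ^+ 2 +
     ((1 + sqnorm xi) ^+ k * h xi ^+ 2 + (1 + sqnorm xi) ^+ n * u xi ^+ 2))%:E)%E.
Proof.
move=> mS mf mg mh mu'.
have mw p q (v w : R2 -> R) : measurable_fun setT v -> measurable_fun setT w ->
    measurable_fun S (fun xi : R2 => ((1 + sqnorm xi) ^+ p * v xi ^+ 2 + (1 + sqnorm xi) ^+ q * w xi ^+ 2)%:E).
  move=> mv mw; apply: measurable_funTS.
  exact: (emeasurable_funD (measurable_bessel_weight p mv) (measurable_bessel_weight q mw)).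
rewrite !freq_energyD// -ge0_integralD//.
- by move=> x _; rewrite EFinD adde_ge0//; exact: bessel_weight_ge0.
- exact: mw.
- by move=> x _; rewrite EFinD adde_ge0//; exact: bessel_weight_ge0.
- exact: mw.
Qed.

Lemma Hnorm_sqr k f : f \in L2f ->
  (Hnorm k f ^+ 2 = freq_energy k setT (fpart true f) + freq_energy k setT (fpart false f))%E.
Proof.
move=> f2.
have mt := measurable_fpart true f2; have mf := measurable_fpart false f2.
rewrite /Hnorm Lnorm2_sqr /freq_energy -ge0_integralD//.
- apply: eq_integral => xi _; rewrite -EFinD -mulrDr exprMn -exprM mulnC exprM cabs_sqr.
  by rewrite sqr_sqrtr// addr_ge0// addr_ge0// sqr_ge0.
- by move=> x _; exact: bessel_weight_ge0.
- exact: measurable_bessel_weight.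
- by move=> x _; exact: bessel_weight_ge0.
- exact: measurable_bessel_weight.
Qed.

Lemma L2norm_sqr f : f \in L2f -> (L2norm f ^+ 2 = Hnorm 0 f ^+ 2)%E.
Proof.
move=> f2; rewrite Hnorm_sqr// /L2norm Lnorm2_sqr -(plancherel f2).
by congr (_ + _)%E; apply: eq_integral => xi _; rewrite expr0 mul1r.
Qed.

(** Serves the convolutions with [phi], where [D] is the transform of the original function, and
    their time derivatives, where [D] is the right-hand side of the transformed equation. *)
Lemma Hnorm_localized k S g (D : bool -> R2 -> R) : measurable S -> g \in L2f ->
  (forall b, measurable_fun setT (D b)) ->
  (forall b, {ae mu, forall xi, fpart b g xi = \1_S xi * D b xi}) ->
  (Hnorm k g ^+ 2 = freq_energy k S (D true) + freq_energy k S (D false))%E.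
Proof.
move=> mS g2 mD gD; rewrite Hnorm_sqr//.
suff E b : freq_energy k setT (fpart b g) = freq_energy k S (D b) by rewrite !E.
rewrite /freq_energy [RHS]integral_mkcond.
have mg := measurable_fpart b g2.
have mr : measurable_fun setT ((fun xi : R2 => ((1 + sqnorm xi) ^+ k * D b xi ^+ 2)%:E) \_ S).
  apply/(measurable_restrictT _ mS); apply: measurable_funTS; exact: measurable_bessel_weight.
apply: ae_eq_integral => //; first exact: measurable_bessel_weight.
apply: filterS (gD b) => xi -> _; rewrite /patch indicE; case: ifPn => _.
  by rewrite mul1r.
by rewrite mul0r expr0n/= mulr0.
Qed.

Lemma phi_hatE (a1 a2 : R) (xi : R2) : phi_hat a1 a2 xi = \1_(freq_set a1 a2) xi.
Proof.
rewrite /phi_hat indicE; case: ifPn => [/orP H|].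
  case: (boolP (xi \in _)) => //; rewrite inE => -[]; case: H; rewrite leNgt.
    by move=> /negP.
  by move=> /negP h _.
rewrite negb_or -!ltNge => /andP[h1 h2].
by rewrite mem_set.
Qed.

Lemma phi_conv_fpart (a1 a2 : R) f g : phi_conv a1 a2 f g ->
  forall b, {ae mu, forall xi, fpart b g xi = \1_(freq_set a1 a2) xi * fpart b f xi}.
Proof.
move=> /multiplier_real H b; apply: filterS (H b) => xi ->; by rewrite phi_hatE.
Qed.

Lemma measurable_phi_hat (a1 a2 : R) : measurable_fun setT (phi_hat a1 a2 : R2 -> R).
Proof.
rewrite (_ : phi_hat a1 a2 = \1_(freq_set a1 a2)); last by apply/funext => xi; exact: phi_hatE.
exact: measurable_indic (measurable_freq_set a1 a2).
Qed.

Lemma phi_hat_le1 (a1 a2 : R) (xi : R2) : `|phi_hat a1 a2 xi| <= 1.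
Proof. by rewrite phi_hatE indicE; case: (_ \in _); rewrite ?normr1 ?normr0. Qed.

Section decay.
Variables (nu eta a1 a2 : R).
Hypotheses (nu0 : 0 < nu) (eta0 : 0 < eta) (a10 : 0 < a1) (a20 : 0 < a2).
Variables (u01 u02 theta0 : R * R -> R) (u1 u2 theta : R -> R * R -> R).
Hypothesis sol : solution nu eta u01 u02 theta0 u1 u2 theta.

Local Notation E k f := (freq_energy k (freq_set a1 a2) f).
Local Notation K t := (decay_const nu eta a1 * expR (- rate nu eta a1 a2 * t))%:E.

Lemma velocity_freq_decay b t : divergence_free u01 u02 -> u01 \in L2f -> u02 \in L2f -> 0 <= t ->
  (E 0%N (u1_rhs nu u1 theta b t) + E 0%N (u2_rhs nu u2 theta b t) +
     (E 1%N (fcurve b u1 t) + E 1%N (fcurve b u2 t)) <=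
   K t * (E 2%N (fcurve b u1 0) + E 2%N (fcurve b u2 0) + E 0%N (fcurve b theta 0)))%E.
Proof.
move=> divfree u01_2 u02_2 t0; have mS := @measurable_freq_set R a1 a2.
have [u1_2 u2_2 _] := solution_L2 sol (lexx 0).
have [e1 e2 _] := sol_init sol.
have D0 := fpart_divergence_free divfree b.
rewrite -(fpart_ae_eq b u1_2 u01_2 e1) -(fpart_ae_eq b u2_2 u02_2 e2) in D0.
have m1 s : 0 <= s -> measurable_fun setT (fcurve b u1 s).
  by move=> /(solution_L2 sol)[h _ _]; exact: measurable_fpart.
have m2 s : 0 <= s -> measurable_fun setT (fcurve b u2 s).
  by move=> /(solution_L2 sol)[_ h _]; exact: measurable_fpart.
have m3 s : 0 <= s -> measurable_fun setT (fcurve b theta s).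
  by move=> /(solution_L2 sol)[_ _ h]; exact: measurable_fpart.
have z : measurable_fun setT (cst 0 : R2 -> R) by exact: measurable_cst.
rewrite freq_energyD4//; [|exact: (measurable_u1_rhs sol)|exact: (measurable_u2_rhs sol)|exact: m1|exact: m2].
(* A vanishing fourth term brings the data into the shape of [freq_energyD4]. *)
rewrite -[E 0%N (fcurve b theta 0)]adde0.
have -> : 0%E = E 0%N (cst 0).
  by apply/esym; rewrite /freq_energy integral0_eq// => x _; rewrite expr0n/= mulr0.
rewrite freq_energyD4//; [|exact: m1|exact: m2|exact: m3].
have := velocity_decay nu0 eta0 a10 a20 (curve_u1 sol b) (curve_u2 sol b) (curve_theta sol b) D0 t0.
congr (_ <= _)%E.
  by apply: eq_integral => x _; rewrite !expr0 expr1 !mul1r mulrDr.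
congr (_ * _)%E; apply: eq_integral => x _.
rewrite [cst 0 x]/=.
move: (fcurve b u1 0 x) (fcurve b u2 0 x) (fcurve b theta 0 x) (1 + sqnorm x) => v w y q.
by congr EFin; ring.
Qed.

Lemma temperature_freq_decay b t : 0 <= t ->
  (E 0%N (theta_rhs eta u2 theta b t) + E 1%N (fcurve b theta t) <=
   K t * (E 2%N (fcurve b theta 0) + E 0%N (fcurve b u2 0)))%E.
Proof.
move=> t0; have mS := @measurable_freq_set R a1 a2.
have m2 s : 0 <= s -> measurable_fun setT (fcurve b u2 s).
  by move=> /(solution_L2 sol)[_ h _]; exact: measurable_fpart.
have m3 s : 0 <= s -> measurable_fun setT (fcurve b theta s).
  by move=> /(solution_L2 sol)[_ _ h]; exact: measurable_fpart.
rewrite !freq_energyD//; [|exact: m3|exact: m2|exact: (measurable_theta_rhs sol)|exact: m3].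
have := temperature_decay nu0 eta0 a10 a20 (curve_u2 sol b) (curve_theta sol b) t0.
congr (_ <= _)%E.
  by apply: eq_integral => x _; rewrite expr0 expr1 mul1r.
by congr (_ * _)%E; apply: eq_integral => x _; rewrite expr0 mul1r.
Qed.

End decay.

End solutions.

(** * Combining real and imaginary parts *)

Section sum_of_parts.
Context {R : realType}.
Local Open Scope ereal_scope.
Implicit Types (C c : R) (x y z : \bar R).

Lemma velocity_parts C c x1 x2 y1 y2 z1 z2 z3
    (x1t x1f x2t x2f y1t y1f y2t y2f z1t z1f z2t z2f z3t z3f : \bar R) :
  x1 = x1t + x1f -> x2 = x2t + x2f -> y1 = y1t + y1f -> y2 = y2t + y2f ->
  z1 = z1t + z1f -> z2 = z2t + z2f -> z3 = z3t + z3f ->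
  0 <= (C * c)%:E -> 0 <= z1t + z2t + z3t -> 0 <= z1f + z2f + z3f ->
  x1t + x2t + (y1t + y2t) <= (C * c)%:E * (z1t + z2t + z3t) ->
  x1f + x2f + (y1f + y2f) <= (C * c)%:E * (z1f + z2f + z3f) ->
  x1 + x2 + (y1 + y2) <= C%:E * (z1 + z2 + z3) * c%:E.
Proof.
move=> -> -> -> -> -> -> -> K0 z0 z0' Vt Vf.
rewrite muleAC -EFinM.
rewrite (addeACA x1t) (addeACA y1t) (addeACA z1t) (addeACA (x1t + x2t)) (addeACA (z1t + z2t)).
by rewrite ge0_muleDr//; exact: leeD.
Qed.

(** The frequency estimate involves the second velocity component alone, here [z2]; the first one,
    [z1], is added on the right by positivity. *)
Lemma temperature_parts C c x y z z1 z2
    (xt xf yt yf zt zf z1t z1f z2t z2f : \bar R) :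
  x = xt + xf -> y = yt + yf -> z = zt + zf -> z1 = z1t + z1f -> z2 = z2t + z2f ->
  0 <= (C * c)%:E -> 0 <= zt -> 0 <= zf -> 0 <= z1t -> 0 <= z1f -> 0 <= z2t -> 0 <= z2f ->
  xt + yt <= (C * c)%:E * (zt + z2t) ->
  xf + yf <= (C * c)%:E * (zf + z2f) ->
  x + y <= C%:E * (z + (z1 + z2)) * c%:E.
Proof.
move=> -> -> -> -> -> K0 zt0 zf0 z1t0 z1f0 z2t0 z2f0 Vt Vf.
rewrite muleAC -EFinM addeACA; apply: le_trans (leeD Vt Vf) _.
rewrite -ge0_muleDr ?adde_ge0//; apply: lee_wpmul2l => //.
by rewrite addeACA leeD// leeDr// adde_ge0.
Qed.

End sum_of_parts.

Theorem theorem1p2 (R : realType) (nu eta a1 a2 : R)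
  (nu_gt0 : 0 < nu) (eta_gt0 : 0 < eta) (a1_gt0 : 0 < a1) (a2_gt0 : 0 < a2) :
  exists C0 C : R, [/\ 0 < C0, 0 < C &
    forall u01 u02 theta0 : R * R -> R,
      Sobolev 2 u01 -> Sobolev 2 u02 -> Sobolev 2 theta0 ->
      divergence_free u01 u02 ->
    forall u1 u2 theta : R -> R * R -> R,
      solution nu eta u01 u02 theta0 u1 u2 theta ->
    forall phi_u01 phi_u02 phi_theta0 : R * R -> R,
      phi_conv a1 a2 u01 phi_u01 ->
      phi_conv a1 a2 u02 phi_u02 ->
      phi_conv a1 a2 theta0 phi_theta0 ->
    forall phi_u1 phi_u2 phi_theta : R -> R * R -> R,
      (forall t, 0 <= t ->
        [/\ phi_conv a1 a2 (u1 t) (phi_u1 t),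
            phi_conv a1 a2 (u2 t) (phi_u2 t) &
            phi_conv a1 a2 (theta t) (phi_theta t)]) ->
    forall t, 0 <= t ->
    exists dt_phi_u1 dt_phi_u2 dt_phi_theta : R * R -> R,
      [/\ time_derivative phi_u1 t dt_phi_u1,
          time_derivative phi_u2 t dt_phi_u2,
          time_derivative phi_theta t dt_phi_theta,
          (L2norm dt_phi_u1 ^+ 2 + L2norm dt_phi_u2 ^+ 2
             + (Hnorm 1 (phi_u1 t) ^+ 2 + Hnorm 1 (phi_u2 t) ^+ 2)
           <= C%:E * (Hnorm 2 phi_u01 ^+ 2 + Hnorm 2 phi_u02 ^+ 2
                      + L2norm phi_theta0 ^+ 2) * (expR (- C0 * t))%:E)%E &
          (L2norm dt_phi_theta ^+ 2 + Hnorm 1 (phi_theta t) ^+ 2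
           <= C%:E * (Hnorm 2 phi_theta0 ^+ 2
                      + (L2norm phi_u01 ^+ 2 + L2norm phi_u02 ^+ 2))
              * (expR (- C0 * t))%:E)%E]].
Proof.
exists (rate nu eta a1 a2), (decay_const nu eta a1).
split; [exact: rate_gt0|exact: decay_const_gt0|].
move=> u01 u02 theta0 [u01_2 _] [u02_2 _] [theta0_2 _] divfree u1 u2 theta sol.
move=> pu01 pu02 ptheta0 c01 c02 cth0 pu1 pu2 ptheta pc t t0.
have mS := @measurable_freq_set R a1 a2.
have [i1 i2 i3] := sol_init sol.
have [u1_0 u2_0 theta_0] := solution_L2 sol (lexx 0).
have mm := @measurable_phi_hat R a1 a2; have m1 := @phi_hat_le1 R a1 a2.
(* The difference quotients of the convolutions converge because the multiplier [phi_hat] is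
   bounded; this also identifies the transform of the limit. *)
have derivative (w pw : R -> R * R -> R) (D : bool -> R * R -> R) :
    (forall s, 0 <= s -> phi_conv a1 a2 (w s) (pw s)) ->
    (exists g, time_derivative w t g /\ forall b, {ae leb2_sf, forall xi, fpart b g xi = D b xi}) ->
    exists dpw, time_derivative pw t dpw /\
      forall b, {ae leb2_sf, forall xi, fpart b dpw xi = \1_(freq_set a1 a2) xi * D b xi}.
  move=> cw [g [Dg gD]]; have [g' [Dg' g'D]] := time_derivative_multiplier mm m1 cw t0 Dg.
  exists g'; split => // b; apply: filterS2 (g'D b) (gD b) => xi -> ->.
  by rewrite phi_hatE.
have cu1 s : 0 <= s -> phi_conv a1 a2 (u1 s) (pu1 s) by move=> /pc[].
have cu2 s : 0 <= s -> phi_conv a1 a2 (u2 s) (pu2 s) by move=> /pc[].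
have cth s : 0 <= s -> phi_conv a1 a2 (theta s) (ptheta s) by move=> /pc[].
have [d1 [Dd1 d1E]] := derivative _ _ _ cu1 (fourier_u1 sol t0).
have [d2 [Dd2 d2E]] := derivative _ _ _ cu2 (fourier_u2 sol t0).
have [d3 [Dd3 d3E]] := derivative _ _ _ cth (fourier_theta sol t0).
have norm_conv k f g : phi_conv a1 a2 f g -> (Hnorm k g ^+ 2 =
    freq_energy k (freq_set a1 a2) (fpart true f) + freq_energy k (freq_set a1 a2) (fpart false f))%E.
  move=> cfg; have [f2 g2] := multiplier_L2 cfg.
  apply: (Hnorm_localized k mS g2 _ (phi_conv_fpart cfg)).
  by move=> b; exact: measurable_fpart.
have norm0 (g : R * R -> R) : L2 g -> (L2norm g ^+ 2 = Hnorm 0 g ^+ 2)%E by exact: L2norm_sqr.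
have L2c f g : phi_conv a1 a2 f g -> L2 g by move=> /multiplier_L2[].
have K0 : (0 <= (decay_const nu eta a1 * expR (- rate nu eta a1 a2 * t))%:E)%E.
  by rewrite lee_fin mulr_ge0 ?expR_ge0// ltW// decay_const_gt0.
have eqd (g : R * R -> R) (x : \bar R) : L2 g -> (Hnorm 0 g ^+ 2 = x)%E -> (L2norm g ^+ 2 = x)%E.
  by move=> /norm0 ->.
(* The solution at time [0] agrees with the data only almost everywhere, but their chosen transforms
   are equal, so the norms of the convolved data can be read off the curve at [0]. *)
have norm_at0 k f f0 g : L2 f -> L2 f0 -> f = f0 %[ae leb2] -> phi_conv a1 a2 f0 g -> (Hnorm k g ^+ 2 =
    freq_energy k (freq_set a1 a2) (fpart true f) + freq_energy k (freq_set a1 a2) (fpart false f))%E.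
  move=> f2 f02 ff0 cg; rewrite (fpart_ae_eq true f2 f02 ff0) (fpart_ae_eq false f2 f02 ff0).
  exact: norm_conv.
have [L2d1 _] := Dd1; have [L2d2 _] := Dd2; have [L2d3 _] := Dd3.
have normd1 := @Hnorm_localized R 0 _ d1 (fun b => u1_rhs nu u1 theta b t) mS L2d1
  (fun b => measurable_u1_rhs sol b t0) d1E.
have normd2 := @Hnorm_localized R 0 _ d2 (fun b => u2_rhs nu u2 theta b t) mS L2d2
  (fun b => measurable_u2_rhs sol b t0) d2E.
have normd3 := @Hnorm_localized R 0 _ d3 (fun b => theta_rhs eta u2 theta b t) mS L2d3
  (fun b => measurable_theta_rhs sol b t0) d3E.
exists d1, d2, d3; split => //.
- have V b := velocity_freq_decay nu_gt0 eta_gt0 a1_gt0 a2_gt0 sol b divfree u01_2 u02_2 t0.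
  apply: (velocity_parts (eqd d1 _ L2d1 normd1) (eqd d2 _ L2d2 normd2)
    (norm_conv 1%N _ _ (cu1 _ t0)) (norm_conv 1%N _ _ (cu2 _ t0))
    (norm_at0 2%N _ _ _ u1_0 u01_2 i1 c01) (norm_at0 2%N _ _ _ u2_0 u02_2 i2 c02)
    (eqd _ _ (L2c _ _ cth0) (norm_at0 0%N _ _ _ theta_0 theta0_2 i3 cth0)) K0 _ _ (V true) (V false)).
  + by apply: adde_ge0 (adde_ge0 _ _) _; exact: freq_energy_ge0.
  + by apply: adde_ge0 (adde_ge0 _ _) _; exact: freq_energy_ge0.
- have V b := temperature_freq_decay nu_gt0 eta_gt0 a1_gt0 a2_gt0 sol b t0.
  apply: (temperature_parts (eqd d3 _ L2d3 normd3) (norm_conv 1%N _ _ (cth _ t0))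
    (norm_at0 2%N _ _ _ theta_0 theta0_2 i3 cth0)
    (eqd _ _ (L2c _ _ c01) (norm_at0 0%N _ _ _ u1_0 u01_2 i1 c01))
    (eqd _ _ (L2c _ _ c02) (norm_at0 0%N _ _ _ u2_0 u02_2 i2 c02)) K0 _ _ _ _ _ _ (V true) (V false));
    exact: freq_energy_ge0.
Qed.
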